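(* Let $f:I\to I$, $m$, $\mu$ be as in the context, with $m$ satisfying (AR) with exponent $s_f$. Suppose there exists an interval $Y\subset I$ with $\mu(Y)>0$ such that $f$ satisfies property (Cov) with respect to $Y$. Assume that the first return map $F=f^{\tau_Y}:Y\to Y$, equipped with $\mu_Y$ and the partition $\mathcal Y$, satisfies properties (a1)--(a6), (Diam), (BD), (Adj) and (AR) (all defined in the context). Assume additionally that $\mu_Y(\tau_Y>n)=O(n^{-\gamma})$ for some $\gamma>2$. Then there exist $0<c<C<\infty$ such that for all sufficiently small $\delta>0$, $$c\,\delta^{-s_f}\le\mathbb E_\mu(\tau_\delta)\le C\,\delta^{-s_f}\log(1/\delta).$$ Moreover, if $F$ has at least 2 full branches, then there exist $0<c<C<\infty$ such that for all sufficiently small $\delta>0$, $$c\,\delta^{-s_f}\log(1/\delta)\le\mathbb E_\mu(\tau_\delta)\le C\,\delta^{-s_f}\log(1/\delta).$$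
   Context: **The system $f$.** $I\subset\mathbb R$ is a bounded interval and $f:I\to I$ is a piecewise continuous, piecewise strictly monotone map with a finite or countable collection $\mathcal Z$ of intervals of monotonicity with disjoint interiors; $\mathcal Z^n$ is the set of $n$-cylinders of $f$ (maximal intervals $Z$ such that for each $0\le k\le n-1$, $f^k(Z)$ is contained in some element of $\mathcal Z$). $m$ is a probability measure conformal for a potential $\phi$, i.e. $\frac{dm}{d(m\circ f)}=e^\phi$, and $\mu$ is an ergodic $f$-invariant probability measure absolutely continuous with respect to $m$. $f$ itself need not satisfy (a1)--(a6) below. **First return map.** For an interval $Y\subset I$ with $\mu(Y)>0$, $\tau_Y(x)=\inf\{n\ge1:f^n(x)\in Y\}$, $F=f^{\tau_Y}:Y\to Y$, $\mu_Y=\frac1{\mu(Y)}\mu|_Y$. $\mathcal Y=\{Y_i\}_i$ is the collection of intervals on which $\tau_Y$ is constant, and $F$ is assumed monotone on each $Y_i$; $F$ has a full branch on $Y_i$ if $F(Y_i)=Y$. (Cov) There is $N_1\in\mathbb N$ such that (a) $\bigcup_{n=0}^{N_1}f^n(Y)=I$; (b) $\mathcal Z^{N_1}$ is finite in $Y$ (only finitely many $N_1$-cylinders of $f$ meet $Y$); (c) $\sup_{1\le n\le N_1}\sup_{x\in Y}|(f^n)'(x)|<\infty$. **Properties.** The following are stated for a generic system: a bounded interval $I$, a finite or countable collection $\mathcal Z=\{Z_i\}_{i\in\mathcal I}$ of subintervals with disjoint interiors, a map $f:\bigcup_iZ_i\to I$ continuous and strictly monotonic on each $Z_i$, with $f_i=f|_{Z_i}$,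 $D=I\setminus\bigcup_iZ_i$, repeller $\Lambda=\{x\in I:f^k(x)\in\bigcup_iZ_i\ \forall k\ge0\}$, $n$-cylinders $\mathcal Z^n$ ($\mathcal Z^0=\{I\}$), a nonatomic Borel probability measure $m$ with $m(D)=0$ conformal for a potential $\phi:\Lambda\to\mathbb R$ ($\frac{dm}{d(m\circ f)}=e^\phi$, $\phi|_D=-\infty$), $S_n\phi=\sum_{i=0}^{n-1}\phi\circ f^i$, $\mathcal L\psi(x)=\sum_{y\in f^{-1}x}\psi(y)e^{\phi(y)}$, and $\mu$ the invariant probability absolutely continuous with respect to $m$. ''$F$ satisfies'' them means with $I,\mathcal Z,f,\phi,m,\mu$ replaced by $Y,\mathcal Y,F,\sum_{k=0}^{\tau_Y-1}\phi\circ f^k,\frac{1}{m(Y)}m|_Y,\mu_Y$. (a1) There is $C_d>0$ with $|e^{S_n\phi(x)-S_n\phi(y)}-1|\le C_d|f^n(x)-f^n(y)|$ whenever $f^i(x),f^i(y)$ lie in the same element of $\mathcal Z$ for $i=0,\dots,n-1$. (a2) There is $n_0$ with $\sup_\Lambda e^{S_{n_0}\phi}<\inf_{\Lambda\setminus D}\mathcal L^{n_0}1$. (a3) For each $x\in\Lambda$, $\delta>0$ with $J=B(x,\delta)$, $J\cap D=\emptyset$, there is $N$ with $\inf_{\Lambda\setminus D}\mathcal L^N\mathbf 1_{J\cap\Lambda}>0$. (a4) There is $c_m>0$ with $\inf_{Z\in\mathcal Z^{n_1}}m(f^{n_1}(Z))\ge c_m$, where $n_1$ is a fixed integer with $(2n_1+5)(C_d+1)\sup_\Lambda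 e^{S_{n_1}\phi}<1$ (which exists by (a2)). Coding: $\Sigma\subset\mathcal I^{\mathbb N_0}$ is the set of sequences $(i_n)$ such that some $x\in\Lambda$ has $f^n(x)\in Z_{i_n}$ for all $n\ge 0$, $\Pi$ maps the sequence to $x$; $\Sigma_n,\Sigma^*$ are the words of length $n$/all finite words; $[w]$ the cylinder of $w$; $\tilde\mu$ the measure on $\Sigma$ with $\Pi_*\tilde\mu=\mu$. (a5) There is $C_*>1$ with $C_*^{-1}\tilde\mu([\mathbf i])\tilde\mu([\mathbf j])\le\tilde\mu([\mathbf i\mathbf j])\le C_*\tilde\mu([\mathbf i])\tilde\mu([\mathbf j])$ for all finite words $\mathbf i,\mathbf j\in\Sigma^*$ (with $\mathbf i\mathbf j\in\Sigma^*$). (a6) $\left|\frac{\tilde\mu(\bigcup[x_0,\dots,x_{i-1},y_0,\dots,y_{j-1},z_0,\dots,z_{\ell-1}])}{\tilde\mu([x_0,\dots,x_{i-1}])\tilde\mu([z_0,\dots,z_{\ell-1}])}-1\right|\le\gamma(j)$, union over all words $y_0\dots y_{j-1}$ of length $j$ with concatenation in $\Sigma_{i+j+\ell}$, and $\gamma(j)\to0$. (Diam) There are $C_m<\infty$, $s>0$ with $m(U)\le C_m\,\mathrm{diam}(U)^s$ for all intervals $U\subset I$. (BD) There is $C_{bd}>0$ with $C_{bd}^{-1}\le|(f^n)'(x)|/|(f^n)'(y)|\le C_{bd}$ for all $n$ and $x,y\in\Lambda$ with $f^i(x),f^i(y)$ in the same element of $\mathcal Z$ for $0\le i\le n-1$.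 (Adj) There is $C>0$ with $\frac1C\le\frac{\mu(Z)}{\mu(Z')}\le C$ for all $n\ge1$ and adjacent $Z,Z'\in\mathcal Z^n$ contained in a common $Z_{n-1}\in\mathcal Z^{n-1}$; adjacent means there is an interval $A\subset Z_{n-1}$ such that $Z,Z'$ are the only elements of $\mathcal Z^n$ intersecting $A$; also each $Z\in\mathcal Z^n$ in $Z_{n-1}$ has an adjacent $Z'\in\mathcal Z^n$ in $Z_{n-1}$. (AR) There is $c>0$ with $\frac{r^{s_f}}c\le m(B(x,r))\le c\,r^{s_f}$ for all $x\in\Lambda$, $0<r\le1$, with $s_f=\dim_{\mathrm H}\Lambda$. (For the original map $f:I\to I$, $\Lambda$ is the state space $I$.) **Cover time.** $\tau_\delta(x)=\inf\{n\ge1:\{x,f(x),\dots,f^n(x)\}\text{ is }\delta\text{-dense in }I\}$, where a set is $\delta$-dense if every point of $I$ is within distance $\le\delta$ of it; $\mathbb E_\mu$ is expectation with respect to $\mu$. *)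

(* Defs.v *)
From HB Require Import structures.
From mathcomp Require Import all_boot all_order all_algebra.
From mathcomp Require Import all_classical all_reals all_analysis measurable_realfun.

Set Implicit Arguments.
Unset Strict Implicit.
Unset Printing Implicit Defensive.

Import Order.TTheory GRing.Theory Num.Theory.
Import numFieldNormedType.Exports.

Local Open Scope classical_set_scope.
Local Open Scope ring_scope.

(* Every function on a subset of the line is represented by a total function
   R -> R whose values off its domain of definition are never used. *)
Record system (R : realType) := System {
  state_space : set R;
  branches : set (set R);
  dyn : R -> R;
  pot : R -> R;
  conf_measure : probability (measurableTypeR R) R;
  inv_measure : probability (measurableTypeR R) R }.

Definition nd_interval (R : realType) (J : set R) : Prop :=
  is_interval J /\ exists x y, [/\ J x, J y & x < y].

(* inf {n >= 1 | P n}, equal to +oo when there is no such n *)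
Definition first_time (R : realType) (P : nat -> Prop) : \bar R :=
  ereal_inf [set n%:R%:E | n in [set n : nat | (0 < n)%N /\ P n]].

Definition ediam (R : realType) (U : set R) : \bar R :=
  ereal_sup [set z | exists x y, [/\ U x, U y & z = `|x - y|%:E]].

Definition hausdorff_content (R : realType) (s delta : R) (A : set R) : \bar R :=
  ereal_inf [set (\sum_(0 <= i <oo) poweR (ediam (U i)) s)%E |
    U in [set U : nat -> set R | A `<=` \bigcup_i U i /\
                                 forall i, (ediam (U i) <= delta%:E)%E]].

Definition hausdorff_measure (R : realType) (s : R) (A : set R) : \bar R :=
  ereal_sup [set hausdorff_content s delta A | delta in [set d : R | 0 < d]].

(* Since [ediam set0 = -oo], the empty set contributes 0 to [hausdorff_content]
   for every s > 0; the value at s = 0 does not influence the infimum. *)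
Definition hausdorff_dim (R : realType) (A : set R) : \bar R :=
  ereal_inf [set s%:E | s in [set s : R | 0 <= s /\
                                          hausdorff_measure s A = 0%E]].

(* One-sided at an endpoint of an interval A. *)
Definition derivative_within (R : realType) (A : set R) (g : R -> R) (x d : R)
    : Prop :=
  (fun y => (g y - g x) / (y - x)) @ within A x^' --> d.

Section System.
Variables (R : realType) (S : system R).

Local Notation I := (state_space S).
Local Notation Z := (branches S).
Local Notation f := (dyn S).
Local Notation phi := (pot S).
Local Notation m := (conf_measure S).
Local Notation mu := (inv_measure S).

Definition regular_part : set R := \bigcup_(J in Z) J.

Definition singular_part : set R := I `\` regular_part.

Definition repeller : set R :=
  [set x | I x /\ forall k : nat, regular_part (iter k f x)].

Definition birkhoff (n : nat) (x : R) : R := \sum_(k < n) phi (iter k f x).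

Definition strictly_monotone_on (J : set R) : Prop :=
  (forall x y, J x -> J y -> x < y -> f x < f y) \/
  (forall x y, J x -> J y -> x < y -> f y < f x).

Definition piecewise_monotone : Prop :=
  [/\ nd_interval I, bounded_set I & countable Z] /\
  [/\ forall J, Z J -> nd_interval J /\ J `<=` I,
      forall J K, Z J -> Z K -> J <> K -> interior J `&` interior K = set0,
      forall J, Z J -> {within J, continuous f},
      forall J, Z J -> strictly_monotone_on J &
      forall J, Z J -> f @` J `<=` I].

(* dm/d(m o f) = e^phi on each J, where nu = m o f is A |-> m (f (A `&` J)) *)
Definition conformal : Prop :=
  forall J, Z J ->
    measurable_fun (J : set (measurableTypeR R)) phi /\
    exists nu : {measure set (measurableTypeR R) -> \bar R},
      (forall A, measurable A -> nu A = m (f @` (A `&` J))) /\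
      (forall A, measurable A ->
        m (A `&` J) = \int[nu]_(x in A `&` J) (expR (phi x))%:E)%E.

Definition invariant_system : Prop :=
  forall A : set (measurableTypeR R), measurable A ->
    mu (regular_part `&` f @^-1` A) = mu A.

Definition conformal_system : Prop :=
  [/\ piecewise_monotone, m I = 1%E, m singular_part = 0%E & conformal] /\
  [/\ invariant_system & mu `<< m].

Definition nonatomic : Prop := forall x : R, m [set x] = 0%E.

Definition ergodic : Prop :=
  forall A : set (measurableTypeR R), measurable A -> A `<=` I ->
    I `&` f @^-1` A = A -> mu A = 0%E \/ mu A = 1%E.

(* "Interval" always means nondegenerate interval, so that isolated endpoints
   are not cylinders. *)
Definition n_admissible (n : nat) (J : set R) : Prop :=
  [/\ nd_interval J, J `<=` I &
      forall k : nat, (k < n)%N -> exists2 K, Z K & iter k f @` J `<=` K].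

Definition cylinders (n : nat) : set (set R) :=
  [set J | n_admissible n J /\
           forall K, n_admissible n K -> J `<=` K -> K = J].

Definition same_branches (n : nat) (x y : R) : Prop :=
  forall i : nat, (i < n)%N -> exists K, [/\ Z K, K (iter i f x) & K (iter i f y)].

(* The domain of the composition of the branches listed in the word w. *)
Definition branch_domain (w : seq (set R)) : set R :=
  [set x | I x /\ forall k : nat, (k < size w)%N -> (nth set0 w k) (iter k f x)].

Definition branch_word (w : seq (set R)) : Prop :=
  forall k : nat, (k < size w)%N -> Z (nth set0 w k).

(* Derivative at x of the branch of f^(size w) determined by w. *)
Definition branch_derivative (w : seq (set R)) (x d : R) : Prop :=
  derivative_within (branch_domain w) (iter (size w) f) x d.

Definition exp_sup (n : nat) : \bar R :=
  ereal_sup [set (expR (birkhoff n x))%:E | x in repeller].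

(* The sum only involves preimages outside [singular_part], in accordance with
   the convention phi = -oo there. It is only applied to psi >= 0. *)
Definition transfer (psi : R -> \bar R) (x : R) : \bar R :=
  (\esum_(y in [set y | regular_part y /\ f y = x])
     (psi y * (expR (phi y))%:E))%E.

Definition transfer_inf (n : nat) (psi : R -> \bar R) : \bar R :=
  ereal_inf [set iter n transfer psi x | x in repeller `\` singular_part].

Definition bounded_distortion_pot (Cd : R) : Prop :=
  0 < Cd /\
  forall (n : nat) x y, repeller x -> repeller y -> same_branches n x y ->
    `|expR (birkhoff n x - birkhoff n y) - 1| <=
      Cd * `|iter n f x - iter n f y|.

Definition contracting_pot : Prop :=
  exists n0 : nat, (exp_sup n0 < transfer_inf n0 (cst 1%E))%E.

Definition covering : Prop :=
  forall x delta, repeller x -> 0 < delta ->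
    ball x delta `&` singular_part = set0 ->
    exists N : nat, (0 < transfer_inf N
      (fun y => (\1_(ball x delta `&` repeller) y)%:E))%E.

Definition large_images (Cd : R) : Prop :=
  exists n1 : nat,
    (((2 * n1 + 5)%:R * (Cd + 1))%:E * exp_sup n1 < 1)%E /\
    exists2 cm : R, 0 < cm &
      (cm%:E <= ereal_inf [set m (iter n1 f @` J) | J in cylinders n1])%E.

Definition coded_by (i : nat -> set R) (x : R) : Prop :=
  repeller x /\ forall n : nat, Z (i n) /\ (i n) (iter n f x).

Definition Sigma : set (nat -> set R) :=
  [set i | exists x, coded_by i x].

Definition cyl (w : seq (set R)) : set (nat -> set R) :=
  [set i | Sigma i /\ forall k : nat, (k < size w)%N -> i k = nth set0 w k].

Definition words : set (seq (set R)) :=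
  [set w | cyl w !=set0].

(* The measure of the Pi-image of A. As Pi maps Sigma onto the repeller, this is
   the measure on Sigma whose image under Pi is mu. *)
Definition coding_measure (A : set (nat -> set R)) : R :=
  fine (mu [set x | exists2 i, A i & coded_by i x]).

Definition quasi_bernoulli : Prop :=
  exists2 C : R, 1 < C &
    forall v w, words v -> words w -> words (v ++ w) ->
      C^-1 * coding_measure (cyl v) * coding_measure (cyl w)
        <= coding_measure (cyl (v ++ w)) /\
      coding_measure (cyl (v ++ w))
        <= C * coding_measure (cyl v) * coding_measure (cyl w).

Definition psi_mixing : Prop :=
  exists2 gamma : nat -> R, gamma @ \oo --> 0 &
    forall (j : nat) x z, words x -> words z ->
      `| coding_measure
           (\bigcup_(y in [set y | size y = j /\ words (x ++ y ++ z)])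
              cyl (x ++ y ++ z))
         / (coding_measure (cyl x) * coding_measure (cyl z)) - 1 | <= gamma j.

Definition diam_regular : Prop :=
  exists C s : R, 0 < s /\
    forall U, is_interval U -> U `<=` I ->
      (m U <= C%:E * poweR (ediam U) s)%E.

Definition bounded_distortion : Prop :=
  exists2 C : R, 0 < C &
    forall w x y, branch_word w -> repeller x -> repeller y ->
      branch_domain w x -> branch_domain w y ->
      exists dx dy : R, [/\ branch_derivative w x dx, branch_derivative w y dy,
        C^-1 <= `|dx| / `|dy| & `|dx| / `|dy| <= C].

Definition adjacent (n : nat) (P J K : set R) : Prop :=
  [/\ cylinders n J, cylinders n K, J `<=` P, K `<=` P & J <> K] /\
  exists A, [/\ is_interval A, A `<=` P &
    [set L | cylinders n L /\ L `&` A !=set0] = [set J; K]].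

Definition adjacent_comparable : Prop :=
  exists2 C : R, 0 < C &
    forall (n : nat) P, cylinders n P ->
      (forall J K, adjacent n.+1 P J K ->
         C^-1 <= fine (mu J) / fine (mu K) /\ fine (mu J) / fine (mu K) <= C) /\
      (forall J, cylinders n.+1 J -> J `<=` P -> exists K, adjacent n.+1 P J K).

(* L is the repeller for a system with holes, and the whole space for a
   self-map of the space. *)
Definition ahlfors_regular (L : set R) : Prop :=
  let s := fine (hausdorff_dim L) in
  exists2 c : R, 0 < c &
    forall x r, L x -> 0 < r -> r <= 1 ->
      ((r `^ s / c)%:E <= m (ball x r) /\ m (ball x r) <= (c * r `^ s)%:E)%E.

Definition delta_dense (delta : R) (A : set R) : Prop :=
  forall y, I y -> exists2 a, A a & `|y - a| <= delta.

Definition cover_time (delta : R) (x : R) : \bar R :=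
  first_time R (fun n => delta_dense delta [set iter k f x | k in `I_n.+1]).

Definition mean_cover_time (delta : R) : \bar R :=
  (\int[mu]_(x in (I : set (measurableTypeR R))) cover_time delta x)%E.

Definition good_system : Prop :=
  [/\ conformal_system, nonatomic &
      exists Cd, bounded_distortion_pot Cd /\ large_images Cd] /\
  [/\ contracting_pot, covering, quasi_bernoulli & psi_mixing] /\
  [/\ diam_regular, bounded_distortion, adjacent_comparable &
      ahlfors_regular repeller].

(* The map is defined on the whole interval; the branches cover it up to an
   m-null set, and the state space playing the role of the repeller is I. *)
Definition interval_map : Prop :=
  [/\ conformal_system, forall x, I x -> I (f x),
      measurable_fun (I : set (measurableTypeR R)) (f : _ -> measurableTypeR R) &
      ergodic].

Variable Y : set R.

Definition return_time (x : R) : \bar R := first_time R (fun n => Y (iter n f x)).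

(* The value of [return_time x] when finite, and 0 otherwise. *)
Definition return_nat (x : R) : nat :=
  xget 0%N [set n : nat | return_time x = n%:R%:E].

Definition return_const (J : set R) : Prop :=
  [/\ nd_interval J, J `<=` Y &
      exists n : nat, forall x, J x -> return_time x = n%:R%:E].

Definition return_branches : set (set R) :=
  [set J | return_const J /\ forall K, return_const K -> J `<=` K -> K = J].

Definition normalized_restriction (P : probability (measurableTypeR R) R)
    (iY : is_interval Y) : probability (measurableTypeR R) R :=
  mnormalize (mrestr P (is_interval_measurable iY)) P.

Definition first_return (iY : is_interval Y) : system R :=
  {| state_space := Y;
     branches := return_branches;
     dyn := fun x => iter (return_nat x) f x;
     pot := fun x => birkhoff (return_nat x) x;
     conf_measure := normalized_restriction m iY;
     inv_measure := normalized_restriction mu iY |}.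

Definition cov : Prop :=
  exists N1 : nat,
    [/\ \bigcup_(n in `I_N1.+1) (iter n f @` Y) = I,
        finite_set [set J | cylinders N1 J /\ J `&` Y !=set0] &
        exists M : R, forall w x, (1 <= size w <= N1)%N -> branch_word w ->
          Y x -> branch_domain w x ->
          exists2 d, branch_derivative w x d & `|d| <= M].

Definition full_branch (J : set R) : Prop :=
  return_branches J /\ (fun x => iter (return_nat x) f x) @` J = Y.

Definition two_full_branches : Prop :=
  exists J K, [/\ full_branch J, full_branch K & J <> K].

End System.

(* Main.v *)
Require Import Defs.
From HB Require Import structures.
From mathcomp Require Import all_boot all_order all_algebra.
From mathcomp Require Import all_classical all_reals all_analysis measurable_realfun.
From mathcomp Require Import ring lra zify.

Import Order.TTheory GRing.Theory Num.Theory.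
Import numFieldNormedType.Exports.
Local Open Scope classical_set_scope.
Local Open Scope ring_scope.

Set Implicit Arguments.
Unset Strict Implicit.
Unset Printing Implicit Defensive.

(** Two facts carry the whole argument.

    First, regularity of the conformal measure on an interval forces the exponent
    to be one and makes the measure comparable with length ([ar_exponent],
    [conf_length]), so that covering at scale [delta] amounts to visiting about
    [1 / delta] intervals of length of the order of [delta].

    Secondly, the first return map is understood through the itineraries of its
    points, and the record [coded] collects what is needed of them: words are convex
    sets of small conformal measure, branches have bounded distortion, the invariant
    measure is quasi-Bernoulli and mixes after a fixed gap ([exists_coded]).  This
    already gives a two-sided bound for the invariant density: mixing spreads half of
    the mass of any event everywhere, and distortion converts this into conformal
    measure ([P_le_L], [P_ge_length]).

    Upper bound.  An interval of length [h], enlarged to a union of words, is a target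
    of mass of the order of [h].  Visits sampled with a large constant gap are almost
    uncorrelated, so by Bonferroni's inequality the target is hit with a probability
    bounded below within a time of the order of [1 / h] ([hit_interval]).  After [q]
    such windows the probability of missing one of the [1 / delta] targets is at most
    [1 / delta] times [(1 - a) ^ q], which is summable with sum of the order of
    [ln (1 / delta)]: in the time scale of returns, the mean cover time is at most of
    the order of [ln (1 / delta) / delta] ([cover_upper]).  To go back to the original
    map, the orbit must first enter the base [Y], and every return has to be charged
    with its duration.  By invariance, the mass of the first entrances at time [n] is
    controlled by the tail of the return time ([entrance_bound]), and quasi-independence
    decouples the entrance delay, the bad events and the durations of the following
    returns.  The tail exponent above two makes all the resulting series converge
    ([late_sum], [mean_cover_bound]).  Finally, visits to [Y] that are dense in [Y]
    yield an orbit that is dense in the whole interval a bounded time later, since the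
    covering property provides finitely many uniformly Lipschitz inverse charts
    ([cov_dense]).

    Lower bounds.  An orbit segment of length [n] covers at most [n + 1] balls of radius
    [delta], which gives the bound without logarithm ([mean_cover_lower]).  With two full
    branches [a] and [b], all words in these two letters occur, so that there are
    about a fixed power of [1 / delta] disjoint words of mass of the order of [delta], and
    they can be chosen without overlaps.  Visiting them all is a coupon collector's
    problem: a potential equal to the mean harmonic sum of the number of unvisited
    words decreases by at most a multiple of [delta] at each step, and it is of the
    order of [ln (1 / delta)] at the beginning ([potential_step], [cover_lower]).  Each
    word contains an interval of length [2 * delta], hence a point that is not covered
    as long as the word is not visited, and returns take at least one unit of time
    each ([mean_cover_lower_full]). *)

(** * Real values of a probability *)

Section RealProbability.
Context d (T : measurableType d) (R : realType).
Implicit Types (P : probability T R) (A B E : set T).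

(** Real values turn most estimates below into linear arithmetic. *)
Definition pr P A : R := fine (P A).

Lemma prE P A : measurable A -> (pr P A)%:E = P A.
Proof. by move=> mA; rewrite /pr fineK// fin_num_measure. Qed.

Lemma pr_ge0 P A : 0 <= pr P A.
Proof. exact/fine_ge0/measure_ge0. Qed.

Lemma pr_le P A B : measurable A -> measurable B -> A `<=` B -> pr P A <= pr P B.
Proof.
by move=> mA mB AB; rewrite -lee_fin !prE//; apply: le_measure; rewrite ?inE.
Qed.

Lemma pr_le1 P A : measurable A -> pr P A <= 1.
Proof. by move=> mA; rewrite -lee_fin prE//; exact: probability_le1. Qed.

Lemma pr0 P : pr P set0 = 0.
Proof. by rewrite /pr measure0. Qed.

Lemma prU P A B : measurable A -> measurable B -> A `&` B = set0 ->
  pr P (A `|` B) = pr P A + pr P B.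
Proof.
move=> mA mB AB; apply: EFin_inj; rewrite EFinD !prE// ?measureU//.
exact: measurableU.
Qed.

Lemma prU_le P A B : measurable A -> measurable B ->
  pr P (A `|` B) <= pr P A + pr P B.
Proof.
move=> mA mB; rewrite -lee_fin EFinD !prE//; last exact: measurableU.
exact: measureU2.
Qed.

Lemma pr_split P A B : measurable A -> measurable B ->
  pr P A = pr P (A `&` B) + pr P (A `\` B).
Proof.
move=> mA mB; rewrite -prU; [|exact: measurableI|exact: measurableD|].
  by rewrite setUIDK.
by rewrite setDE setIACA setICr setI0.
Qed.

Lemma pr_bigcup_le P (A : nat -> set T) n : (forall i, measurable (A i)) ->
  pr P (\bigcup_(i < n) A i) <= \sum_(i < n) pr P (A i).
Proof.
move=> mA; elim: n => [|n IHn].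
  by rewrite big_ord0 bigcup_mkord big_ord0 pr0.
rewrite big_ord_recr/= bigcup_mkord big_ord_recr/= -bigcup_mkord.
by rewrite (le_trans (prU_le _ _ _))// ?lerD2r//; exact: bigcup_measurable.
Qed.

(** A partition indexed by a countable type turns an inequality on every piece
    into an inequality on the whole set, by sigma-additivity of both sides. *)
Lemma pr_le_fibres P1 P2 (W : countType) (l : T -> W) (K : R) E S1 S2 :
  measurable E -> measurable S1 -> measurable S2 ->
  (forall w, measurable (E `&` l @^-1` [set w])) -> 0 <= K ->
  (forall w, pr P1 (E `&` l @^-1` [set w] `&` S1) <=
             K * pr P2 (E `&` l @^-1` [set w] `&` S2)) ->
  pr P1 (E `&` S1) <= K * pr P2 (E `&` S2).
Proof.
move=> mE mS1 mS2 mw K0 H.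
pose D i := if @pickle_inv W i is Some w then E `&` l @^-1` [set w] else set0.
have mD i : measurable (D i) by rewrite /D; case: pickle_inv.
have decE (P : probability T R) S : measurable S ->
    P (E `&` S) = (\sum_(0 <= i <oo) P (D i `&` S))%E.
  move=> mS; rewrite -measure_semi_bigcup//.
  - congr (P _); rewrite -setI_bigcupl; congr (_ `&` _); apply/seteqP; split.
      by move=> x Ex; exists (pickle (l x)); rewrite // /D pickleK_inv.
    by move=> x [i _]; rewrite /D; case: pickle_inv => [w []|].
  - by move=> i; exact: measurableI.
  - move=> i j _ _ [x [[+ _] [+ _]]]; rewrite /D.
    have := @pickle_invK W i; have := @pickle_invK W j.
    case: (@pickle_inv W i) => [u|]//; case: (@pickle_inv W j) => [v|]//=.
    by move=> <- <- [_ /= <-] [_ /= <-].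
  - by apply: bigcup_measurable => i _; exact: measurableI.
rewrite -lee_fin EFinM !prE; [|exact: measurableI|exact: measurableI].
rewrite !decE// -nneseriesZl//; apply: lee_nneseries => // i _.
rewrite -!prE; [|exact: measurableI|exact: measurableI].
rewrite -EFinM lee_fin /D; case: pickle_inv => [w|]; first exact: H.
by rewrite !set0I !pr0 mulr0.
Qed.

(** Absolute continuity in its epsilon-delta form, by the Borel-Cantelli lemma:
    sets of summable [P2]-measure have a [P2]-null upper limit. *)
Lemma pr_continuous P1 P2 : P1 `<< P2 -> forall e : R, 0 < e ->
  exists2 d : R, 0 < d & forall A, measurable A -> pr P2 A < d -> pr P1 A < e.
Proof.
move=> /null_content_dominatesP dom e e0; apply: contrapT => H.
have {H} : forall n, exists A,
    [/\ measurable A, pr P2 A < 2 ^- n.+1 & e <= pr P1 A].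
  move=> n; apply: contrapT => Hn; apply: H.
  exists (2 ^- n.+1) => [|A mA A1]; first by rewrite invr_gt0 exprn_gt0.
  by rewrite ltNge; apply/negP => A2; apply: Hn; exists A.
move=> /choice[F /= HF].
have mF i : measurable (F i) by have [] := HF i.
have F0 : P2 (lim_sup_set F) = 0%E.
  apply: lim_sup_set_cvg0 => //.
  apply: (@le_lt_trans _ _ (\sum_(0 <= n <oo) (1 / (2 ^ n.+1)%N%:R)%:E)%E).
    apply: lee_nneseries => // n _.
    rewrite -[leLHS]/(P2 (F n)) -(prE P2 (mF n)) lee_fin natrX div1r.
    by have [_ + _] := HF n; exact: ltW.
  by apply: le_lt_trans (epsilon_trick0 _ (@ler01 R)) _; rewrite ltry.
have mL : measurable (lim_sup_set F).
  by apply: bigcap_measurable => // k _; exact: bigcup_measurable.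
have := dom _ mL F0; apply/eqP; rewrite gt_eqF//.
apply: (@lt_le_trans _ _ e%:E) => //.
have Fcvg : P1 (\bigcup_(j >= n) F j) @[n --> \oo] --> P1 (lim_sup_set F).
  by apply: lim_sup_set_cvg => //; rewrite -ge0_fin_numE// fin_num_measure//;
    exact: bigcup_measurable.
have Fge n : (e%:E <= P1 (\bigcup_(j >= n) F j))%E.
  have [_ _] := HF n; rewrite -lee_fin prE// => /le_trans; apply.
  rewrite le_measure ?inE//; first exact: bigcup_measurable.
  by apply: bigcup_sup => /=.
rewrite -(cvg_lim _ Fcvg)//; apply: lime_ge; last exact: nearW.
by apply/cvg_ex; eexists; exact: Fcvg.
Qed.

(** Inclusion-exclusion truncated after the pairwise terms, by induction: the part of
    [A j] lost to the earlier sets is at most the sum of its overlaps with them. *)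
Lemma pr_bonferroni P (A : nat -> set T) n : (forall i, measurable (A i)) ->
  \sum_(j < n) (pr P (A j) - \sum_(i < j) pr P (A i `&` A j)) <=
    pr P (\bigcup_(i < n) A i).
Proof.
move=> mA; elim: n => [|n IHn].
  by rewrite big_ord0 bigcup_mkord big_ord0 pr0.
rewrite big_ord_recr/= bigcup_mkord big_ord_recr/= -bigcup_mkord.
have mU : measurable (\bigcup_(i < n) A i) by exact: bigcup_measurable.
rewrite [X in _ <= pr P X](_ : _ = \bigcup_(i < n) A i `|` (A n `\` \bigcup_(i < n) A i)).
  rewrite prU//; [|exact: measurableD|]; last by rewrite setDE setICA setICr setI0.
  rewrite lerD// (@pr_split P (A n) _ (mA n) mU) lerBlDr addrC lerD2l.
  by rewrite setIC setI_bigcupl; apply: pr_bigcup_le => i; exact: measurableI.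
by rewrite setDE setUIr setUv setIT.
Qed.

Lemma pr_disjoint_le1 P (A : nat -> set T) n :
  (forall i, measurable (A i)) -> (forall i j, (i < j < n)%N -> A i `&` A j = set0) ->
  \sum_(i < n) pr P (A i) <= 1.
Proof.
move=> mA dA; apply: le_trans (_ : pr P (\bigcup_(i < n) A i) <= 1); last first.
  by apply: pr_le1; exact: bigcup_measurable.
apply: le_trans (pr_bonferroni P n mA); apply: ler_sum => j _.
rewrite big1 ?subr0// => i _; rewrite dA ?pr0//.
by rewrite ltn_ord ltn_ord.
Qed.

End RealProbability.

(** * Itineraries *)

Section Itineraries.
Variables (R : realType) (X : set (measurableTypeR R)) (F : R -> R)
  (br : R -> nat).

Definition itinerary (n : nat) (x : R) : seq nat :=
  [seq br (iter k F x) | k <- iota 0 n].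

Definition word_set (n : nat) (w : seq nat) : set (measurableTypeR R) :=
  [set x | X x /\ itinerary n x = w].

Definition hit_at (n : nat) (A : set R) : set (measurableTypeR R) :=
  [set x | X x /\ A (iter n F x)].

(** The algebra generated by the words of length [n], described by saturation in order
    to avoid unions over words. *)
Definition cylindrical (n : nat) (A : set R) : Prop :=
  A `<=` X /\ forall x y, X x -> X y -> itinerary n x = itinerary n y -> A x -> A y.

Lemma size_itin n x : size (itinerary n x) = n.
Proof. by rewrite size_map size_iota. Qed.

Lemma nth_itin n x j : (j < n)%N -> nth 0%N (itinerary n x) j = br (iter j F x).
Proof. by move=> jn; rewrite (nth_map 0%N) ?size_iota// nth_iota. Qed.

Lemma itinD n k x : itinerary (n + k) x = itinerary n x ++ itinerary k (iter n F x).
Proof.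
rewrite /itinerary iotaD map_cat; congr (_ ++ _).
rewrite add0n -[n in iota n k]addn0 iotaDl -map_comp.
by apply: eq_map => i /=; rewrite addnC iterD.
Qed.

Lemma itinS n x : itinerary n.+1 x = br x :: itinerary n (F x).
Proof. by rewrite -add1n itinD. Qed.

Lemma itin_prefix n k x y : (n <= k)%N -> itinerary k x = itinerary k y ->
  itinerary n x = itinerary n y.
Proof.
by move=> nk /(congr1 (take n)); rewrite -(subnKC nk) !itinD !take_size_cat ?size_itin.
Qed.

Lemma itin_suffix n k x y : itinerary (n + k) x = itinerary (n + k) y ->
  itinerary k (iter n F x) = itinerary k (iter n F y).
Proof.
by move=> /(congr1 (drop n)); rewrite !itinD !drop_size_cat ?size_itin.
Qed.

Lemma wsetX n w : word_set n w `<=` X. Proof. by move=> x []. Qed.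

Lemma preX n A : hit_at n A `<=` X. Proof. by move=> x []. Qed.

Lemma cylX n A : cylindrical n A -> A `<=` X. Proof. by case. Qed.

Lemma cyl_le n k A : (n <= k)%N -> cylindrical n A -> cylindrical k A.
Proof.
move=> nk [AX sA]; split => // x y Xx Xy xy; apply: sA => //.
exact: itin_prefix nk xy.
Qed.

Lemma cyl_setI n A B : cylindrical n A -> cylindrical n B -> cylindrical n (A `&` B).
Proof.
move=> [AX sA] [BX sB]; split => [x [/AX]//|x y Xx Xy xy [Ax Bx]].
by split; [apply: (sA x)|apply: (sB x)].
Qed.

Lemma cyl_bigcup n (I : Type) (D : set I) (A : I -> set R) :
  (forall i, D i -> cylindrical n (A i)) -> cylindrical n (\bigcup_(i in D) A i).
Proof.
move=> H; split=> [x [i /H[AX _] /AX]//|x y Xx Xy xy [i Di Ai]].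
by exists i => //; have [_ /(_ x y)] := H _ Di; apply.
Qed.

Lemma cyl_compl n A : cylindrical n A -> cylindrical n (X `\` A).
Proof.
move=> [AX sA]; split => [x []//|x y Xx Xy xy [_ nAx]]; split => // Ay.
by apply: nAx; apply: (sA y).
Qed.

Lemma cylT n : cylindrical n X. Proof. by split. Qed.

Lemma cyl0 n : cylindrical n set0. Proof. by split. Qed.

Lemma cyl_wset n w : cylindrical n (word_set n w).
Proof. by split => [x []//|x y Xx Xy xy [_ <-]]; split. Qed.

Hypothesis FX : forall x, X x -> X (F x).

Lemma X_iter n x : X x -> X (iter n F x).
Proof. by move=> Xx; elim: n => //= n; exact: FX. Qed.

Lemma cyl_pre n k A : cylindrical k A -> cylindrical (n + k) (hit_at n A).
Proof.
move=> [AX sA]; split => [x []//|x y Xx Xy xy [_ Ax]]; split => //.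
by apply: sA Ax; rewrite ?(itin_suffix xy)//; exact: X_iter.
Qed.

Lemma cyl_setI_pre n k A B : cylindrical n A -> cylindrical k B -> cylindrical (n + k) (A `&` hit_at n B).
Proof.
move=> cA cB; apply: cyl_setI; last exact: cyl_pre.
by apply: cyl_le cA; exact: leq_addr.
Qed.

End Itineraries.

(** The system seen through the itineraries of its points.  The two probability
    measures are the invariant one [cP] and the conformal one [cL], and all the
    dynamics enters through them: the words, as subsets of the line, are convex in
    [cX], the conformal measure has bounded distortion along words, is comparable
    with length, and gives exponentially small mass to long words, while the
    invariant measure is quasi-Bernoulli and mixes after a gap.  The probabilistic part
    of the proof sees nothing else of the map. *)
Record coded (R : realType) := Coded {
  cY : set R;
  cX : set (measurableTypeR R);
  cF : R -> R;
  cbr : R -> nat;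
  cP : probability (measurableTypeR R) R;
  cL : probability (measurableTypeR R) R;
  cK : R;
  cD : R;
  cA : R;
  cj : nat;
  cn : nat;
  cY_interval : is_interval cY;
  cY_nd : exists x y, [/\ cY x, cY y & x < y];
  cXY : cX `<=` cY;
  cmX : measurable cX;
  cPX : pr cP cX = 1;
  cLX : pr cL cX = 1;
  cFX : forall x, cX x -> cX (cF x);
  cmF : forall A : set (measurableTypeR R), measurable A ->
    measurable (cX `&` cF @^-1` A);
  cmbr : forall a, measurable (cX `&` cbr @^-1` [set a]);
  cinv : forall A : set (measurableTypeR R), measurable A ->
    pr cP (cX `&` cF @^-1` A) = pr cP A;
  cac : cP `<< cL;
  cconv : forall n w x y z, word_set cX cF cbr n w x -> word_set cX cF cbr n w z ->
    cX y -> x <= y -> y <= z -> word_set cX cF cbr n w y;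
  cconv_img : forall n w x y z, word_set cX cF cbr n w x -> word_set cX cF cbr n w z ->
    cX y -> iter n cF x <= y -> y <= iter n cF z ->
    (iter n cF @` word_set cX cF cbr n w) y;
  cm_img : forall n w, measurable (iter n cF @` word_set cX cF cbr n w :
    set (measurableTypeR R));
  cD1 : 1 <= cD;
  cdist : forall n w (B : set (measurableTypeR R)), measurable B ->
    let W := word_set cX cF cbr n w in let T := iter n cF @` W in
    pr cL W * pr cL (B `&` T) <= cD * (pr cL (W `&` hit_at cX cF n B) * pr cL T) /\
    pr cL (W `&` hit_at cX cF n B) * pr cL T <= cD * (pr cL W * pr cL (B `&` T));
  cn0 : (0 < cn)%N;
  ccontr : forall n w, pr cL (word_set cX cF cbr (n * cn) w) <= 2^-1 ^+ n;
  cK1 : 1 <= cK;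
  cpos : forall n w, word_set cX cF cbr n w !=set0 -> 0 < pr cP (word_set cX cF cbr n w);
  cqb_le : forall n k v w,
    pr cP (word_set cX cF cbr n v `&` hit_at cX cF n (word_set cX cF cbr k w)) <=
    cK * (pr cP (word_set cX cF cbr n v) * pr cP (word_set cX cF cbr k w));
  cqb_ge : forall n k v w,
    word_set cX cF cbr n v `&` hit_at cX cF n (word_set cX cF cbr k w) !=set0 ->
    pr cP (word_set cX cF cbr n v) * pr cP (word_set cX cF cbr k w) <=
    cK * pr cP (word_set cX cF cbr n v `&` hit_at cX cF n (word_set cX cF cbr k w));
  cmix : forall n k v w,
    pr cP (word_set cX cF cbr n v) * pr cP (word_set cX cF cbr k w) <=
    2 * pr cP (word_set cX cF cbr n v `&` hit_at cX cF (n + cj) (word_set cX cF cbr k w));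
  cA1 : 1 <= cA;
  clen_ge : forall x y, cY x -> cY y -> x < y ->
    y - x <= cA * pr cL (cX `&` `]x, y[%classic);
  clen_le : forall x y, x <= y -> pr cL (cX `&` `[x, y]%classic) <= cA * (y - x)
}.

Section CodedBasics.
Variables (R : realType) (G : coded R).
Local Notation X := (cX G).
Local Notation F := (cF G).
Local Notation P := (cP G).
Local Notation L := (cL G).
Local Notation itin := (itinerary (cF G) (cbr G)).
Local Notation wset := (word_set (cX G) (cF G) (cbr G)).
Local Notation pre := (hit_at (cX G) (cF G)).
Local Notation cyl := (cylindrical (cX G) (cF G) (cbr G)).

Lemma m_pre n A : measurable (A : set (measurableTypeR R)) ->
  measurable (pre n A).
Proof.
move=> mA; elim: n => [|n IHn].
  by rewrite (_ : pre 0 A = X `&` A)//; apply: measurableI => //; exact: cmX.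
rewrite (_ : pre n.+1 A = X `&` F @^-1` (pre n A)); first exact: cmF.
apply/seteqP; split => x /=; rewrite /hit_at/= -iterS iterSr.
  by move=> [Xx Ax]; split => //; split => //; exact: cFX.
by move=> [Xx [_ Ax]].
Qed.

Lemma pr_X A : measurable (A : set (measurableTypeR R)) ->
  pr P (X `&` A) = pr P A.
Proof.
move=> mA; have mX := @cmX R G.
have := @prU_le _ _ R P (X `&` A) (X `\` A); rewrite setUIDK cPX.
have := @pr_split _ _ R P A X mA mX; rewrite [A `&` X]setIC.
have := @pr_split _ _ R P setT X measurableT mX; rewrite setTI cPX.
have : pr P setT = 1 by rewrite /pr probability_setT.
have : pr P (A `\` X) <= pr P (setT `\` X).
  by apply: pr_le; [exact: measurableD|exact: measurableD|exact: setSD].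
have := pr_ge0 P (A `\` X); lra.
Qed.

Lemma pr_pre n A : measurable (A : set (measurableTypeR R)) ->
  pr P (pre n A) = pr P A.
Proof.
move=> mA; elim: n => [|n IHn].
  by rewrite (_ : pre 0 A = X `&` A)// pr_X.
rewrite (_ : pre n.+1 A = X `&` F @^-1` (pre n A)).
  by rewrite cinv//; exact: m_pre.
apply/seteqP; split => x /=; rewrite /hit_at/= -iterS iterSr.
  by move=> [Xx Ax]; split => //; split => //; exact: cFX.
by move=> [Xx [_ Ax]].
Qed.

Lemma m_wset n w : measurable (wset n w).
Proof.
elim: n w => [|n IHn] [|a w].
- rewrite (_ : wset 0 [::] = X); first exact: cmX.
  by apply/seteqP; split => [x []//|x Xx]; split.
- rewrite (_ : wset 0 (a :: w) = set0)//.
  by apply/seteqP; split => // x [].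
- rewrite (_ : wset n.+1 [::] = set0)//.
  by apply/seteqP; split => // x [].
rewrite (_ : wset n.+1 (a :: w) =
  (X `&` cbr G @^-1` [set a]) `&` pre 1 (wset n w)).
  by apply: measurableI; [exact: cmbr|exact: m_pre].
apply/seteqP; split => x; rewrite /word_set/= itinS.
  by move=> [Xx [<- <-]]; do 3 split => //; exact: cFX.
by move=> [[Xx <-] [_ [_ <-]]].
Qed.

Lemma m_cyl n A : cyl n A -> measurable (A : set (measurableTypeR R)).
Proof.
move=> [AX sA].
rewrite (_ : A = \bigcup_w (if `[<exists2 x, A x & itin n x = w>] then wset n w
                            else set0)).
  apply: countable_bigcupT_measurable; first exact: countableP.
  by move=> w; case: ifP => // _; exact: m_wset.
apply/seteqP; split => [x Ax|x [w _]].
  exists (itin n x) => //; case: asboolP => [_|[]]; last by exists x.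
  by split => //; exact: AX.
case: asboolP => // -[y Ay yw] [Xx xw]; apply: (sA y) => //; first exact: AX.
by rewrite yw xw.
Qed.

Lemma m_fibre n k A w : measurable (A : set (measurableTypeR R)) ->
  A `<=` X ->
  measurable (A `&` (fun x => itin k (iter n F x)) @^-1` [set w] : set (measurableTypeR R)).
Proof.
move=> mA AX; rewrite (_ : _ `&` _ = A `&` pre n (wset k w)).
  by apply: measurableI => //; apply: m_pre; exact: m_wset.
apply/seteqP; split => [x [Ax /= xw]|x [Ax [Xx [_ /= xw]]]]; split => //.
by split; [exact: AX|split => //; apply: X_iter; [exact: cFX|exact: AX]].
Qed.

Lemma setI_fibre n A w : A `<=` X -> A `&` itin n @^-1` [set w] = A `&` wset n w.
Proof.
move=> AX; apply/seteqP; split => x [Ax /=]; first by split => //; split => //; exact: AX.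
by move=> [].
Qed.

Lemma cyl_fibre n A w : cyl n A ->
  A `&` wset n w = set0 \/ A `&` wset n w = wset n w.
Proof.
move=> [AX sA]; case: (pselect (exists x, (A `&` wset n w) x)) => [[x [Ax [Xx xw]]]|H].
  right; apply: setIidr => y [Xy yw]; apply: (sA x) => //.
  by rewrite xw yw.
by left; apply: contrapT => /eqP/set0P.
Qed.

(** It suffices to compare the two sides on words: both are sigma-additive in each
    of the two events. *)
Lemma decouple_le (c : R) N n k A B : 0 <= c ->
  (forall v w, pr P (wset n v `&` pre N (wset k w)) <=
     c * (pr P (wset n v) * pr P (wset k w))) ->
  cyl n A -> cyl k B -> pr P (A `&` pre N B) <= c * (pr P A * pr P B).
Proof.
move=> c0 H cA cB; have mA := m_cyl cA; have mB := m_cyl cB.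
have mN C : measurable (C : set (measurableTypeR R)) -> measurable (pre N C).
  exact: m_pre.
have Hw w : pr P (A `&` pre N (wset k w)) <= c * (pr P A * pr P (wset k w)).
  rewrite mulrCA mulrC -mulrA mulrC -[A in leRHS]setIT.
  rewrite [leRHS](_ : _ = (c * pr P (wset k w)) * pr P (A `&` setT)); last ring.
  apply: (@pr_le_fibres _ _ _ P P _ (itin n)) => //.
  - by apply: mN; exact: m_wset.
  - by move=> v; exact: (@m_fibre 0 n A v mA (cylX cA)).
  - by rewrite mulr_ge0// pr_ge0.
  - move=> v; rewrite setI_fibre; last exact: cylX cA.
    have [->|->] := cyl_fibre v cA.
      by rewrite !set0I !pr0 mulr0.
    by rewrite setIT -mulrA [X in _ <= _ * X]mulrC; exact: H.
rewrite setIC -[pr P B](pr_pre N mB) mulrA -[pre N B in leRHS]setIT.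
apply: (@pr_le_fibres _ _ _ P P _ (fun x => itin k (iter N F x))) => //.
- exact: mN.
- by move=> v; apply: m_fibre; [exact: mN|exact: preX].
- by rewrite mulr_ge0// pr_ge0.
- move=> w; have -> : pre N B `&` (fun x => itin k (iter N F x)) @^-1` [set w] =
      pre N (B `&` wset k w).
    apply/seteqP; split => [x [[Xx Bx] /= xw]|x [Xx [Bx [_ xw]]]]; last by split.
    by split => //; split => //; split => //; apply: X_iter => //; exact: cFX.
  rewrite setIT setIC; have [->|->] := cyl_fibre w cB.
    rewrite (_ : pre N set0 = set0); first by rewrite setI0 !pr0 mulr0.
    by apply/seteqP; split => // x [].
  by rewrite -mulrA (pr_pre N (m_wset _ _)).
Qed.

Lemma decouple_ge (c : R) N n k A B : 0 <= c ->
  (forall v w, pr P (wset n v) * pr P (wset k w) <=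
     c * pr P (wset n v `&` pre N (wset k w))) ->
  cyl n A -> cyl k B -> pr P A * pr P B <= c * pr P (A `&` pre N B).
Proof.
move=> c0 H cA cB; have mA := m_cyl cA; have mB := m_cyl cB.
have mN C : measurable (C : set (measurableTypeR R)) -> measurable (pre N C).
  exact: m_pre.
have div_le (a x y : R) : 0 <= a -> 0 <= y -> (0 < a -> x <= c / a * y) ->
    x * a <= c * y.
  rewrite le_eqVlt => /orP[/eqP<- y0 _|a0 y0 /(_ a0)].
    by rewrite mulr0 mulr_ge0.
  by move=> /(ler_wpM2r (ltW a0)); rewrite mulrAC divfK// gt_eqF.
have Hw w : pr P A * pr P (wset k w) <= c * pr P (A `&` pre N (wset k w)).
  apply: div_le => [||w0]; [exact: pr_ge0|exact: pr_ge0|].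
  rewrite -[A in leLHS]setIT.
  apply: (@pr_le_fibres _ _ _ P P _ (itin n)) => //.
  - by apply: mN; exact: m_wset.
  - by move=> v; exact: (@m_fibre 0 n A v mA (cylX cA)).
  - by rewrite divr_ge0// ltW.
  - move=> v; rewrite setI_fibre; last exact: cylX cA.
    have [->|->] := cyl_fibre v cA.
      by rewrite !set0I !pr0 mulr0.
    by rewrite setIT mulrAC ler_pdivlMr.
rewrite mulrC setIC; apply: div_le => [||A0]; [exact: pr_ge0|exact: pr_ge0|].
rewrite -[pr P B](pr_pre N mB) -[pre N B in leLHS]setIT.
apply: (@pr_le_fibres _ _ _ P P _ (fun x => itin k (iter N F x))) => //.
- exact: mN.
- by move=> v; apply: m_fibre; [exact: mN|exact: preX].
- by rewrite divr_ge0// ltW.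
- move=> w; have -> : pre N B `&` (fun x => itin k (iter N F x)) @^-1` [set w] =
      pre N (B `&` wset k w).
    apply/seteqP; split => [x [[Xx Bx] /= xw]|x [Xx [Bx [_ xw]]]]; last by split.
    by split => //; split => //; split => //; apply: X_iter => //; exact: cFX.
  rewrite setIT; have [->|->] := cyl_fibre w cB.
    rewrite (_ : pre N set0 = set0); first by rewrite set0I !pr0 mulr0.
    by apply/seteqP; split => // x [].
  rewrite (pr_pre N (m_wset _ _)) mulrAC ler_pdivlMr// setIC mulrC; exact: Hw.
Qed.

Lemma qb_le n k A B : cyl n A -> cyl k B ->
  pr P (A `&` pre n B) <= cK G * (pr P A * pr P B).
Proof.
by apply: decouple_le; [exact: le_trans ler01 (cK1 G)|move=> v w; exact: cqb_le].
Qed.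

Lemma mix_ge n k A B : cyl n A -> cyl k B ->
  pr P A * pr P B <= 2 * pr P (A `&` pre (n + cj G) B).
Proof. by apply: decouple_ge => // v w; exact: cmix. Qed.

(** * Intervals against words *)

Definition convX (T : set R) : Prop :=
  forall x y z, T x -> T z -> X y -> x <= y -> y <= z -> T y.

Definition hull k (T : set R) : set (measurableTypeR R) :=
  [set y | X y /\ exists y', [/\ T y', X y' & itin k y' = itin k y]].

Definition inner k (T : set R) : set (measurableTypeR R) :=
  [set y | X y /\ forall y', X y' -> itin k y' = itin k y -> T y'].

Lemma cyl_hull k T : cyl k (hull k T).
Proof.
split => [x []//|x y Xx Xy xy [_ [y' [Ty Xy' yy]]]].
by split => //; exists y'; split => //; rewrite yy.
Qed.

Lemma cyl_inner k T : cyl k (inner k T).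
Proof.
split => [x []//|x y Xx Xy xy [_ Tx]].
by split => // y' Xy' yy; apply: Tx => //; rewrite yy.
Qed.

Lemma sub_hull k T : T `<=` X -> T `<=` hull k T.
Proof. by move=> TX x Tx; split; [exact: TX|exists x; split => //; exact: TX]. Qed.

Lemma inner_sub k T : inner k T `<=` T.
Proof. by move=> x [Xx]; apply. Qed.

(** A word that meets a convex set without being inside it straddles one of its two
    ends, and two words that straddle the same end intersect. *)
Lemma hull_inner k T : convX T ->
  exists w1 w2, hull k T `\` inner k T `<=` wset k w1 `|` wset k w2.
Proof.
move=> cT.
pose above x := X x /\ exists t z, [/\ T t, X t & [/\ X z, t <= z, ~ T z,
  itin k t = itin k x & itin k z = itin k x]].
pose below x := X x /\ exists t z, [/\ T t, X t & [/\ X z, z <= t, ~ T z,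
  itin k t = itin k x & itin k z = itin k x]].
have uA x y : above x -> above y -> itin k x = itin k y.
  wlog : x y / exists t z t' z', [/\ T t, T t', t <= t' & [/\ X t, X z, X t', X z' &
      [/\ t <= z, t' <= z', ~ T z, ~ T z' & [/\ itin k t = itin k x,
      itin k z = itin k x, itin k t' = itin k y & itin k z' = itin k y]]]].
    move=> W Ax Ay; have [_ [t [z [Tt Xt [Xz tz Tz tx zx]]]]] := Ax.
    have [_ [t' [z' [Tt' Xt' [Xz' tz' Tz' tx' zx']]]]] := Ay.
    have [tt|/ltW tt] := leP t t'; first by apply: W => //; exists t, z, t', z'.
    by apply/esym; apply: W => //; exists t', z', t, z.
  move=> [t [z [t' [z' [Tt Tt' tt' [Xt Xz Xt' Xz' [tz tz' Tz Tz' [tx zx tx' zx']]]]]]]] _ _.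
  have t'z : t' <= z.
    rewrite leNgt; apply/negP => /ltW zt'; apply: Tz; exact: (cT t z t').
  have [_ <-] : wset k (itin k x) t' by apply: (@cconv _ G _ _ t t' z).
  by rewrite tx'.
have uB x y : below x -> below y -> itin k x = itin k y.
  wlog : x y / exists t z t' z', [/\ T t, T t', t' <= t & [/\ X t, X z, X t', X z' &
      [/\ z <= t, z' <= t', ~ T z, ~ T z' & [/\ itin k t = itin k x,
      itin k z = itin k x, itin k t' = itin k y & itin k z' = itin k y]]]].
    move=> W Ax Ay; have [_ [t [z [Tt Xt [Xz tz Tz tx zx]]]]] := Ax.
    have [_ [t' [z' [Tt' Xt' [Xz' tz' Tz' tx' zx']]]]] := Ay.
    have [tt|/ltW tt] := leP t' t; first by apply: W => //; exists t, z, t', z'.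
    by apply/esym; apply: W => //; exists t', z', t, z.
  move=> [t [z [t' [z' [Tt Tt' tt' [Xt Xz Xt' Xz' [tz tz' Tz Tz' [tx zx tx' zx']]]]]]]] _ _.
  have t'z : z <= t'.
    rewrite leNgt; apply/negP => /ltW zt'; apply: Tz; exact: (cT t' z t).
  have [_ <-] : wset k (itin k x) t' by apply: (@cconv _ G _ _ z t' t).
  by rewrite tx'.
exists (itin k (xget 0 above)), (itin k (xget 0 below)) => x [[Xx [t [Tt Xt tx]]] nx].
have [z [Xz zx Tz]] : exists z, [/\ X z, itin k z = itin k x & ~ T z].
  apply: contrapT => Hz; apply: nx; split => // y Xy yx; apply: contrapT => Ty.
  by apply: Hz; exists y.
have [tz|/ltW tz] := leP t z.
  have Ax : above x by split => //; exists t, z.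
  by left; split => //; apply: uA => //; exact: (xgetI _ Ax).
have Bx : below x by split => //; exists t, z.
by right; split => //; apply: uB => //; exact: (xgetI _ Bx).
Qed.

Lemma pr_hull_inner (Q : probability (measurableTypeR R) R) k T (e : R) :
  convX T -> (forall w, pr Q (wset k w) <= e) ->
  pr Q (hull k T) <= pr Q (inner k T) + 2 * e.
Proof.
move=> cT He; have mh := m_cyl (cyl_hull k T); have mi := m_cyl (cyl_inner k T).
have [w1 [w2 Hw]] := hull_inner k cT.
have mw w := m_wset k w.
rewrite (pr_split _ mh mi); apply: lerD.
  by apply: pr_le => //; exact: measurableI.
apply: (@le_trans _ _ (pr Q (wset k w1 `|` wset k w2))).
  by apply: pr_le => //; [exact: measurableD|exact: measurableU].
apply: le_trans (prU_le _ (mw _) (mw _)) _.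
by have := He w1; have := He w2; lra.
Qed.

(** Approximation of convex sets by events of finitely many symbols, from outside and,
    in the next lemma, from inside. *)
Lemma pr_hull_le (Q : probability (measurableTypeR R) R) k T (e : R) :
  measurable (T : set (measurableTypeR R)) -> convX T ->
  (forall w, pr Q (wset k w) <= e) -> pr Q (hull k T) <= pr Q T + 2 * e.
Proof.
move=> mT cT He; apply: le_trans (pr_hull_inner cT He) _; rewrite lerD2r.
by apply: pr_le => //; [exact: m_cyl (cyl_inner k T)|exact: inner_sub].
Qed.

Lemma pr_inner_ge (Q : probability (measurableTypeR R) R) k T (e : R) :
  measurable (T : set (measurableTypeR R)) -> T `<=` X -> convX T ->
  (forall w, pr Q (wset k w) <= e) -> pr Q T <= pr Q (inner k T) + 2 * e.
Proof.
move=> mT TX cT He; apply: le_trans (pr_hull_inner cT He).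
by apply: pr_le => //; [exact: m_cyl (cyl_hull k T)|exact: sub_hull].
Qed.

End CodedBasics.

(** * Upper bound for the invariant density *)

Section Densities.
Variables (R : realType) (G : coded R).
Local Notation X := (cX G).
Local Notation F := (cF G).
Local Notation P := (cP G).
Local Notation L := (cL G).
Local Notation itin := (itinerary (cF G) (cbr G)).
Local Notation wset := (word_set (cX G) (cF G) (cbr G)).
Local Notation pre := (hit_at (cX G) (cF G)).
Local Notation cyl := (cylindrical (cX G) (cF G) (cbr G)).

Definition img n w : set (measurableTypeR R) := iter n F @` wset n w.

Lemma half_pow_le q : (2^-1 : R) ^+ q <= q.+1%:R^-1.
Proof.
rewrite exprVn lef_pV2 ?posrE ?exprn_gt0 ?ltr0Sn//.
by rewrite -natrX ler_nat; exact: ltn_expl.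
Qed.

Lemma L_word k w : pr L (wset k w) <= 2^-1 ^+ (k %/ cn G).
Proof.
apply: le_trans (ccontr G (k %/ cn G) (take (k %/ cn G * cn G) w)).
have kk : (k %/ cn G * cn G <= k)%N by exact: leq_divM.
apply: pr_le; [exact: m_wset|exact: m_wset|move=> x [Xx <-]; split => //].
set m := (k %/ cn G * cn G)%N in kk *.
have -> : itin k x = itin (m + (k - m)) x by rewrite subnKC.
by rewrite itinD take_size_cat// size_itin.
Qed.

Lemma L_word_small (e : R) : 0 < e ->
  exists k, forall w, pr L (wset k w) <= e.
Proof.
move=> e0; exists (Num.truncn e^-1 * cn G)%N => w.
apply: le_trans (L_word _ _) _; rewrite mulnK; last exact: cn0.
apply: le_trans (half_pow_le _) _.
rewrite -[leRHS]invrK lef_pV2 ?posrE ?invr_gt0//.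
by apply/ltW/truncnS_gt.
Qed.

Lemma P_word_small (e : R) : 0 < e ->
  exists k, forall w, pr P (wset k w) <= e.
Proof.
move=> e0; have [d d0 Hd] := pr_continuous (@cac _ G) e0.
have d2 : 0 < d / 2 by lra.
have [k Hk] := L_word_small d2.
exists k => w; apply/ltW/Hd; first exact: m_wset.
by apply: le_lt_trans (Hk w) _; lra.
Qed.

Lemma img_conv n w : convX G (img n w).
Proof. by move=> _ y _ [x Wx <-] [z Wz <-] Xy xy yz; exact: (cconv_img Wx Wz). Qed.

(** Were the image of a word small, the word could not be followed by enough
    words to recover its own mass. *)
Lemma P_img n w : wset n w !=set0 -> 1 <= cK G * pr P (img n w).
Proof.
move=> W0; have K1 := cK1 G; have Wpos := cpos W0.
apply/ler_addgt0Pr => e e0.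
have e'0 : 0 < e / (2 * cK G) by rewrite divr_gt0// mulr_gt0// (lt_le_trans ltr01).
have [k Hk] := P_word_small e'0.
have := pr_hull_le (@cm_img _ G n w) (@img_conv n w) Hk.
have := qb_le (cyl_wset X F (cbr G) n w) (@cyl_hull _ G k (img n w)).
rewrite setIidl; last first.
  move=> x Wx; have Xx := wsetX Wx; split => //; split.
    by apply: X_iter => //; exact: cFX.
  exists (iter n F x); split => //; first by exists x.
  by apply: X_iter => //; exact: cFX.
rewrite mulrCA -{1}[pr P (wset n w)]mulr1 ler_pM2l// -/(img n w) => H1 H2.
apply: le_trans H1 _; rewrite -[e](@divfK _ (2 * cK G)); last by lra.
have -> : cK G * pr P (img n w) + e / (2 * cK G) * (2 * cK G) =
  cK G * (pr P (img n w) + 2 * (e / (2 * cK G))) by ring.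
by rewrite ler_pM2l//; lra.
Qed.

(** [P_img] together with absolute continuity. *)
Lemma L_img : exists2 eta, 0 < eta & forall n w, wset n w !=set0 ->
  eta <= pr L (img n w).
Proof.
have K1 := cK1 G; have K0 : 0 < cK G by exact: lt_le_trans ltr01 K1.
have K'0 : 0 < (cK G)^-1 by rewrite invr_gt0.
have [d d0 Hd] := pr_continuous (@cac _ G) K'0.
exists d => // n w W0; rewrite leNgt; apply/negP => /(Hd _ (@cm_img _ G n w)).
rewrite ltNge => /negP; apply; rewrite -div1r ler_pdivrMr// mulrC.
exact: P_img.
Qed.

(** The densities of the images of the conformal measure are uniformly bounded: on
    each word distortion is bounded, and the images of words are not small. *)
Lemma L_pre : exists2 c, 0 < c & forall n A, measurable (A : set (measurableTypeR R)) ->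
  pr L (pre n A) <= c * pr L A.
Proof.
have [eta eta0 Heta] := L_img; have D1 := cD1 G.
exists (cD G / eta) => [|n A mA]; first by rewrite divr_gt0// (lt_le_trans ltr01).
have c0 : 0 <= cD G / eta * pr L A.
  by rewrite mulr_ge0 ?pr_ge0// divr_ge0// ltW// (lt_le_trans ltr01).
have mpA := @m_pre _ G n _ mA.
have XX : X `<=` X by [].
suff : pr L (X `&` pre n A) <= cD G / eta * pr L A * pr L (X `&` setT).
  by rewrite setIT cLX mulr1 setIidr//; exact: preX.
apply: (@pr_le_fibres _ _ R L L _ (itin n)) => //; first exact: (@cmX _ G).
  by move=> w; exact: (@m_fibre _ G 0 n X w (@cmX _ G)).
have WX w : X `&` wset n w = wset n w by apply: setIidr; exact: wsetX.
move=> w; rewrite setI_fibre// setIT WX.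
have [->|/set0P W0] := eqVneq (wset n w) set0; first by rewrite set0I !pr0 mulr0.
have [_ H] := cdist G n w mA.
have Lw := pr_ge0 L (wset n w); have := Heta _ _ W0; rewrite /img => e1.
rewrite -[leRHS]mulrA mulrAC -mulrA -[leLHS](@mulfK _ eta); last by lra.
rewrite [leRHS](_ : _ = (cD G * (pr L (wset n w) * pr L A)) / eta); last by field; lra.
rewrite ler_pM2r ?invr_gt0//.
have e2 := ler_wpM2l (pr_ge0 L (wset n w `&` pre n A)) e1.
apply: (le_trans e2); apply: (le_trans H).
rewrite ler_pM2l ?(lt_le_trans ltr01)// ler_wpM2l//.
by apply: pr_le => //; apply: measurableI => //; exact: cm_img.
Qed.

(** Where the image of every word of [A] contains [B], distortion bounds the same
    densities from below. *)
Lemma L_pre_ge n A B : cyl n A -> measurable (B : set (measurableTypeR R)) ->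
  (forall w, A `&` wset n w !=set0 -> B `<=` img n w) ->
  pr L A * pr L B <= cD G * pr L (A `&` pre n B).
Proof.
move=> cA mB H; have mA := m_cyl cA; have D1 := cD1 G.
have [->|B0] := eqVneq (pr L B) 0.
  by rewrite mulr0 mulr_ge0 ?pr_ge0// (le_trans ler01).
have {}B0 : 0 < pr L B by rewrite lt_neqAle eq_sym B0 pr_ge0.
have c0 : 0 <= cD G / pr L B by rewrite divr_ge0 ?pr_ge0// (le_trans ler01).
have mpB := @m_pre _ G n _ mB.
rewrite -ler_pdivlMr// -[leRHS]mulrA mulrCA mulrC -[A in leLHS]setIT.
apply: (@pr_le_fibres _ _ _ L L _ (itin n)) => // w.
  exact: (@m_fibre _ G 0 n A w mA (cylX cA)).
rewrite setI_fibre ?setIT; last exact: cylX cA.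
have [AW|W0] := eqVneq (A `&` wset n w) set0.
  by rewrite AW set0I !pr0 mulr0.
move/set0P in W0; have BT := H _ W0.
have [AW|->] := cyl_fibre w cA; first by rewrite AW set0I !pr0 mulr0.
rewrite mulrAC ler_pdivlMr//; have [+ _] := cdist G n w mB.
rewrite -/(img n w) (setIidl BT) => /le_trans; apply.
rewrite ler_pM2l ?(lt_le_trans ltr01)// ler_piMr ?pr_ge0//.
by apply: pr_le1; exact: cm_img.
Qed.

Lemma cyl_setU n A B : cyl n A -> cyl n B -> cyl n (A `|` B).
Proof.
move=> [AX sA] [BX sB]; split => [x [/AX|/BX]//|x y Xx Xy xy [Ax|Bx]].
  by left; apply: (sA x).
by right; apply: (sB x).
Qed.

(** A near-optimal set for [P - c L] is an approximate Hahn decomposition of that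
    signed measure by a set that depends on finitely many symbols. *)
Lemma near_hahn (c e : R) : 0 < e -> exists n E, cyl n E /\
  forall k A, cyl k A -> (A `<=` E -> c * pr L A <= pr P A + e) /\
    (A `&` E = set0 -> pr P A <= c * pr L A + e).
Proof.
move=> e0; pose V := [set v | exists n E, cyl n E /\ v = pr P E - c * pr L E].
have V1 : has_sup V.
  split; first by exists 0, 0, set0; rewrite !pr0 mulr0 subr0; split => //; exact: cyl0.
  exists (1 + `|c|) => _ [n [E [/m_cyl mE ->]]].
  have := pr_le1 P mE; have := pr_le1 L mE; have := pr_ge0 L E.
  have : - c * pr L E <= `|c| * pr L E.
    by rewrite ler_wpM2r ?pr_ge0// -normrN ler_norm.
  have : `|c| * pr L E <= `|c| * 1 by rewrite ler_wpM2l// pr_le1.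
  by rewrite mulr1 mulNr; lra.
have [_ [n [E [cE ->]]] Esup] := sup_adherent e0 V1.
exists n, E; split => // k A cA.
have Vsup m B : cyl m B -> pr P B - c * pr L B < pr P E - c * pr L E + e.
  move=> cB; have : pr P B - c * pr L B <= sup V.
    by apply: sup_upper_bound => //; exists m, B.
  by move=> /le_lt_trans; apply; rewrite -ltrBlDr.
have mA := m_cyl cA; have mE := m_cyl cE.
have cA' : cyl (maxn n k) A by apply: cyl_le cA; exact: leq_maxr.
have cE' : cyl (maxn n k) E by apply: cyl_le cE; exact: leq_maxl.
split=> AE.
  have := Vsup _ _ (cyl_setI cE' (cyl_compl cA')).
  rewrite setIDA setIidl; last exact: cylX cE.
  have := pr_split P mE mA; have := pr_split L mE mA.
  by rewrite (setIidr AE) => -> ->; lra.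
have := Vsup _ _ (cyl_setU cE' cA').
rewrite !prU// 1?setIC//; lra.
Qed.

(** The invariant density is bounded: outside a near-optimal set of mass less than
    one half, mixing recovers half the mass of an event, and pulling back increases
    the conformal measure at most by a constant factor. *)
Lemma P_le_L : exists2 c, 0 < c & forall k A, cyl k A -> pr P A <= c * pr L A.
Proof.
have h2 : 0 < 1 / 2 :> R by lra.
have [d d0 Hd] := pr_continuous (@cac _ G) h2.
have [b b0 Hb] := L_pre.
exists (4 * (3 / d * b)) => [|k A cA]; first by rewrite !mulr_gt0 ?invr_gt0.
apply/ler_addgt0Pr => e0 e00; pose e := Num.min 1 (e0 / 4).
have e1 : e <= 1 by rewrite ge_min lexx.
have e2 : e <= e0 / 4 by rewrite ge_min lexx orbT.
have {e00} e0' : 0 < e by rewrite lt_min ltr01 divr_gt0.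
have [n [E [cE HE]]] := near_hahn (3 / d) e0'.
have [/(_ (@subset_refl _ E)) HEE _] := HE _ _ cE.
have mE := m_cyl cE.
have LE : pr L E < d.
  have := pr_le1 P mE.
  have -> : pr L E = (3 / d * pr L E) * (d / 3) by field; lra.
  move=> P1; apply: le_lt_trans (_ : 2 * (d / 3) < d); last by lra.
  by rewrite ler_pM2r ?divr_gt0//; lra.
have {}LE := Hd _ mE LE.
have cEc := cyl_compl cE; have mEc := m_cyl cEc.
have PEc : 1 / 2 <= pr P (X `\` E).
  have := pr_split P (@cmX _ G) mE; rewrite cPX setIidr; last exact: cylX cE.
  by lra.
have := mix_ge cEc cA.
have mA := m_cyl cA.
have cEA : cyl (n + cj G + k) ((X `\` E) `&` pre (n + cj G) A).
  apply: cyl_setI_pre => //; first exact: cFX.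
  by apply: cyl_le cEc; exact: leq_addr.
have [_ ] := HE _ _ cEA.
have -> : (X `\` E) `&` pre (n + cj G) A `&` E = set0.
  by apply/seteqP; split => // x [[[_ nE] _]].
move=> /(_ erefl) H1 H2.
have H3 : pr L ((X `\` E) `&` pre (n + cj G) A) <= b * pr L A.
  apply: le_trans (Hb (n + cj G)%N A mA); apply: pr_le => //.
  - exact: m_cyl cEA.
  - exact: m_pre.
have d3 : 0 < 3 / d by rewrite divr_gt0.
have := ler_wpM2l (ltW d3) H3.
have := ler_wpM2r (pr_ge0 P A) PEc.
by lra.
Qed.

Lemma P_word : exists2 c, 0 < c & forall k w,
  pr P (wset k w) <= c * 2^-1 ^+ (k %/ cn G).
Proof.
have [c c0 Hc] := P_le_L; exists c => // k w.
apply: le_trans (Hc _ _ (cyl_wset _ _ _ _ _)) _.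
by rewrite ler_pM2l//; exact: L_word.
Qed.

Lemma convX_itv x y : convX G (X `&` `]x, y[%classic).
Proof.
move=> a b c [Xa /=]; rewrite !in_itv/= => /andP[xa _] [Xc /andP[_ cy]] Xb ab bc.
split => //=.
by rewrite (lt_le_trans xa ab) (le_lt_trans bc cy).
Qed.

Lemma word_diam k x y : X x -> X y -> itin k x = itin k y -> x < y ->
  y - x <= cA G * 2^-1 ^+ (k %/ cn G).
Proof.
move=> Xx Xy xy lxy.
apply: le_trans (clen_ge (cXY Xx) (cXY Xy) lxy) _.
rewrite ler_pM2l ?(lt_le_trans ltr01 (cA1 G))//.
apply: le_trans (L_word k (itin k x)).
apply: pr_le; [apply: measurableI => //; exact: cmX|exact: m_wset|].
move=> z [Xz]; rewrite /= in_itv/= => /andP[/ltW xz /ltW zy].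
exact: (@cconv _ G _ _ x z y).
Qed.

End Densities.

(** * Lower bound for the invariant density *)

Section LowerDensity.
Variables (R : realType) (G : coded R).
Local Notation X := (cX G).
Local Notation F := (cF G).
Local Notation P := (cP G).
Local Notation L := (cL G).
Local Notation itin := (itinerary (cF G) (cbr G)).
Local Notation wset := (word_set (cX G) (cF G) (cbr G)).
Local Notation pre := (hit_at (cX G) (cF G)).
Local Notation cyl := (cylindrical (cX G) (cF G) (cbr G)).
Local Notation img := (@img R G).

Lemma cyl_pos k A : cyl k A -> A !=set0 -> 0 < pr P A.
Proof.
move=> cA [x Ax]; have Xx := cylX cA Ax.
have W0 : wset k (itin k x) !=set0 by exists x.
apply: lt_le_trans (cpos W0) _; apply: pr_le; [exact: m_wset|exact: m_cyl cA|].
by move=> y [Xy xy]; have [_ /(_ x y)] := cA; apply.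
Qed.

(** The symbols of [x] at the first [N] times decide everything that is said here
    about the image of its word, so these are cylinder events. *)
Lemma cyl_img N E (Q : set R -> Prop) : cyl N E ->
  cyl N (E `&` [set x | Q (img N (itin N x))]).
Proof.
move=> [EX sE]; split => [x [/EX]//|x y Xx Xy xy [Ex Qx]]; split.
  exact: (sE x).
by rewrite /= -xy.
Qed.

(** Pigeonhole: the masses of the [Up i] add up to at most one, and so do those of
    the [Lo i]. *)
Lemma few_straddle (Up Lo : nat -> set (measurableTypeR R)) (r : nat) (c : R) :
  (forall i, measurable (Up i)) -> (forall i, measurable (Lo i)) ->
  (forall i j, (i < j < r)%N -> Up i `&` Up j = set0) ->
  (forall i j, (i < j < r)%N -> Lo i `&` Lo j = set0) ->
  2 < r%:R * c ->
  exists2 i, (i < r)%N & pr P (Up i) + pr P (Lo i) <= c.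
Proof.
move=> mU mL dU dL rc; apply: contrapT => H.
have : \sum_(i < r) (pr P (Up i) + pr P (Lo i)) <= 1 + 1.
  by rewrite big_split/= lerD//; apply: pr_disjoint_le1.
apply/negP; rewrite -ltNge; apply: (@lt_le_trans _ _ (\sum_(i < r) c)).
  by rewrite sumr_const card_ord -mulr_natl; lra.
apply: ler_sum => i _; rewrite leNgt; apply/negP => Hi; apply: H.
by exists i => //; exact: ltW.
Qed.

(** The invariant density is bounded from below.  Let [E] be a set of mass at least
    one half on which [P] dominates a multiple of [L], up to a small error.  Mixing
    sends a definite part of [E] to every piece of the interval, through words whose
    images meet the piece; few of these images have an endpoint in the piece, for a
    suitable piece, and all the others contain it, so that bounded distortion
    provides a definite part of its conformal measure. *)
Lemma P_ge_length : exists2 c, 0 < c & forall x y, cY G x -> cY G y -> x < y ->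
  y - x <= c * pr P (X `&` `]x, y[%classic).
Proof.
have [b b0 Hb] := P_le_L G.
have K1 := cK1 G; have K0 : 0 < cK G by lra.
have A1 := cA1 G; have A0 : 0 < cA G by lra.
have D1 := cD1 G; have D0 : 0 < cD G by lra.
pose r := (Num.truncn (16 * cK G)).+1.
have r1 : 16 * cK G < r%:R by exact: truncnS_gt.
have r0 : 0 < r%:R :> R by lra.
pose l0 := (8 * cK G * b)^-1.
have l00 : 0 < l0 by rewrite invr_gt0 !mulr_gt0.
pose c1 := l0 / (8 * cA G * cD G * r%:R).
have c10 : 0 < c1 by rewrite divr_gt0// !mulr_gt0.
exists (cK G / c1) => [|x y Yx Yy xy]; first by rewrite divr_gt0.
rewrite mulrAC ler_pdivlMr//; apply/ler_addgt0Pr => e0 e00.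
pose e := Num.min (1 / 4) e0.
have e1 : e <= 1 / 4 by rewrite ge_min lexx.
have e2 : e <= e0 by rewrite ge_min lexx orbT.
have {e00} e0' : 0 < e by rewrite lt_min e00 andbT; lra.
apply: le_trans (_ : cK G * pr P (X `&` `]x, y[%classic) + e <= _); last by rewrite lerD2l.
pose h := (y - x) / r%:R.
have h0 : 0 < h by rewrite divr_gt0// subr_gt0.
pose J i := X `&` `](x + i%:R * h), (x + i.+1%:R * h)[%classic.
have JX i : J i `<=` X by move=> z [].
have mJ i : measurable (J i : set (measurableTypeR R)).
  by apply: measurableI => //; exact: cmX.
have e'0 : 0 < h / (4 * cA G) by rewrite divr_gt0// mulr_gt0.
have [k Hk] := L_word_small G e'0.
pose A i := inner G k (J i).
have cAi i : cyl k (A i) by exact: cyl_inner.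
have AJ i : A i `<=` J i by exact: inner_sub.
have mA i : measurable (A i : set (measurableTypeR R)) by exact: m_cyl (cAi i).
have Yi i : (i <= r)%N -> cY G (x + i%:R * h).
  move=> ir; apply: (@cY_interval _ G x y) => //; apply/andP; split.
    by rewrite lerDl mulr_ge0// ltW.
  have -> : y = x + r%:R * h by rewrite /h mulrC divfK ?gt_eqF// addrC subrK.
  by rewrite lerD2l ler_pM2r// ler_nat.
have Jxy i : (i < r)%N -> J i `<=` X `&` `]x, y[%classic.
  move=> ir z [Xz]; rewrite /= !in_itv/= => /andP[z1 z2]; split => //=.
  apply/andP; split.
    by apply: le_lt_trans z1; rewrite lerDl mulr_ge0// ltW.
  apply: lt_le_trans z2 _.
  have -> : y = x + r%:R * h by rewrite /h mulrC divfK ?gt_eqF// addrC subrK.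
  by rewrite lerD2l ler_pM2r// ler_nat.
have LA i : (i < r)%N -> h <= 2 * cA G * pr L (A i).
  move=> ir.
  have hi : x + i%:R * h < x + i.+1%:R * h.
    by rewrite ltrD2l ltr_pM2r// ltr_nat.
  have := clen_ge (Yi _ (ltnW ir)) (Yi _ ir) hi.
  have -> : x + i.+1%:R * h - (x + i%:R * h) = h by rewrite -natr1; ring.
  have := pr_inner_ge (mJ i) (@JX i) (@convX_itv _ G _ _) Hk.
  rewrite -/(J i) -/(A i) => /(ler_wpM2l (ltW A0)) H1 H2.
  have := le_trans H2 H1; rewrite mulrDr.
  have -> : cA G * (2 * (h / (4 * cA G))) = h / 2 by field; lra.
  by lra.
have [n [E [cE HE]]] := near_hahn G (1 / 4) e0'.
have mE := m_cyl cE.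
have PE : 1 / 2 <= pr P E.
  have [_] := HE _ _ (cyl_compl cE).
  rewrite setDKI => /(_ erefl).
  have mEc := m_cyl (cyl_compl cE).
  have := pr_le1 L mEc; have := pr_split P (@cmX _ G) mE.
  by rewrite cPX setIidr; [lra|exact: cylX cE].
pose N := (n + cj G)%N.
have cEN : cyl N E by apply: cyl_le cE; exact: leq_addr.
pose meets i (T : set R) := T `&` A i !=set0.
(* [Ui i] and [Fi i]: the image meets, resp. contains, the [i]-th piece; [Up i] and
   [Lo i]: the image meets the piece but stops short of one of its points. *)
pose Ui i := E `&` [set z | meets i (img N (itin N z))].
pose Fi i := E `&` [set z | A i `<=` img N (itin N z)].
pose up i (T : set R) := exists t z, [/\ T t, A i t, A i z, ~ T z & t <= z].
pose lo i (T : set R) := exists t z, [/\ T t, A i t, A i z, ~ T z & z <= t].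
pose Up i : set (measurableTypeR R) := E `&` [set z | up i (img N (itin N z))].
pose Lo i : set (measurableTypeR R) := E `&` [set z | lo i (img N (itin N z))].
have cUi i : cyl N (Ui i) by exact: (@cyl_img N E (meets i)).
have cFi i : cyl N (Fi i) by exact: (@cyl_img N E (fun T => A i `<=` T)).
have cUp i : cyl N (Up i) by exact: (@cyl_img N E (up i)).
have cLo i : cyl N (Lo i) by exact: (@cyl_img N E (lo i)).
have mFi i := m_cyl (cFi i); have mUp i := m_cyl (cUp i); have mLo i := m_cyl (cLo i).
have UFUL i : Ui i `<=` Fi i `|` (Up i `|` Lo i).
  move=> z [Ez [t [Tt At]]].
  have [sub|] := pselect (A i `<=` img N (itin N z)); first by left.
  move=> /existsNP[u /not_implyP[Au Tu]]; right.
  have [tu|/ltW ut] := leP t u; first by left; split => //; exists t, u.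
  by right; split => //; exists t, u.
have A_lt i j a a' : (i < j)%N -> A i a -> A j a' -> a < a'.
  move=> ij /AJ[_]; rewrite /= in_itv/= => /andP[_ a1] /AJ[_].
  rewrite /= in_itv/= => /andP[a2 _].
  by rewrite (lt_trans a1)// (le_lt_trans _ a2)// lerD2l ler_pM2r// ler_nat.
have AX i z : A i z -> X z by move=> /AJ /JX.
have dUp i j : (i < j < r)%N -> Up i `&` Up j = set0.
  move=> /andP[ij _]; apply/seteqP; split => // z.
  move=> [[Ez [t [u [Tt At Au Tu tu]]]] [_ [t' [u' [Tt' At' _ _ _]]]]].
  apply: Tu; apply: (@img_conv _ G _ _ t u t') => //; first exact: AX Au.
  exact/ltW/(A_lt i j).
have dLo i j : (i < j < r)%N -> Lo i `&` Lo j = set0.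
  move=> /andP[ij _]; apply/seteqP; split => // z.
  move=> [[Ez [t [u [Tt At Au _ _]]]] [_ [t' [u' [Tt' At' Au' Tu' ut]]]]].
  apply: Tu'; apply: (@img_conv _ G _ _ t u' t') => //; first exact: AX Au'.
  exact/ltW/(A_lt i j).
have [|i ir HUL] := few_straddle mUp mLo dUp dLo (c := 1 / (8 * cK G)).
  by rewrite mulrA mulr1 ltr_pdivlMr; lra.
have A0' : 0 < pr P (A i).
  apply: cyl_pos (cAi i) _; apply: contrapT => /set0P/negP/negPn/eqP A00.
  by have := LA _ ir; rewrite A00 pr0; lra.
have HU : 1 <= 4 * cK G * pr P (Ui i).
  have := mix_ge cE (cAi i).
  have sub : E `&` pre N (A i) `<=` Ui i `&` pre N (A i).
    move=> z [Ez [Xz Az]]; split => //; split => //.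
    by exists (iter N F z); split => //; exists z.
  have mp := @m_pre _ G N _ (mA i).
  have := pr_le P (measurableI _ _ mE mp) (measurableI _ _ (m_cyl (cUi i)) mp) sub.
  have := qb_le (cUi i) (cAi i); rewrite -/N => H1 H2 H3.
  rewrite -(ler_pM2r A0'); move: H3; have := ler_wpM2r (ltW A0') PE; lra.
have HF : 1 <= 8 * cK G * pr P (Fi i).
  have := pr_le P (m_cyl (cUi i)) (measurableU _ _ (mFi i) (measurableU _ _ (mUp i) (mLo i)))
    (@UFUL i).
  have := prU_le P (mFi i) (measurableU _ _ (mUp i) (mLo i)).
  have := prU_le P (mUp i) (mLo i).
  have K8 : cK G * (1 / (8 * cK G)) = 1 / 8 by field; lra.
  move=> H1 H2 H3; have : pr P (Ui i) <= pr P (Fi i) + 1 / (8 * cK G) by lra.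
  by move=> /(ler_wpM2l (ltW K0)); rewrite mulrDr K8; lra.
have LF : l0 <= pr L (Fi i).
  have := Hb _ _ (cFi i); move=> /(ler_wpM2l (ltW K0)) H1.
  rewrite /l0 -div1r ler_pdivrMr ?mulr_gt0//; lra.
have cFA : cyl (N + k) (Fi i `&` pre N (A i)).
  by apply: cyl_setI_pre => //; exact: cFX.
have [/(_ _)H1 _] := HE _ _ cFA.
have {}H1 : 1 / 4 * pr L (Fi i `&` pre N (A i)) <= pr P (Fi i `&` pre N (A i)) + e.
  by apply: H1 => z [[]].
have H2 := qb_le (cFi i) (cAi i).
have H3 : pr L (Fi i) * pr L (A i) <= cD G * pr L (Fi i `&` pre N (A i)).
  apply: L_pre_ge => // w [z [[_ Hz] [Xz zw]]].
  by rewrite -zw.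
have PF : pr P (Fi i) * pr P (A i) <= pr P (X `&` `]x, y[%classic).
  apply: (@le_trans _ _ (pr P (A i))); first by rewrite ler_piMl ?pr_ge0// pr_le1.
  apply: pr_le => //; first by apply: measurableI => //; exact: cmX.
  exact: subset_trans (@AJ i) (Jxy _ ir).
have {PF} H4 : 1 / 4 * pr L (Fi i `&` pre N (A i)) <=
    cK G * pr P (X `&` `]x, y[%classic) + e.
  by have := ler_wpM2l (ltW K0) PF; lra.
apply: le_trans H4.
have H5 : l0 * (h / (2 * cA G)) <= cD G * pr L (Fi i `&` pre N (A i)).
  apply: le_trans H3; apply: ler_pM => //; first exact: ltW.
    by rewrite ltW// divr_gt0// mulr_gt0.
  by rewrite ler_pdivrMr ?mulr_gt0// mulrC; exact: LA.
rewrite -(ler_pM2l D0); apply: le_trans (_ : 1 / 4 * (l0 * (h / (2 * cA G))) <= _); last by lra.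
rewrite /c1 /h le_eqVlt; apply/orP; left; apply/eqP; field.
by rewrite !gt_eqF// ltr0Sn.
Qed.

End LowerDensity.

(** * Hitting small intervals *)

Section Hitting.
Variables (R : realType) (G : coded R).
Local Notation X := (cX G).
Local Notation F := (cF G).
Local Notation P := (cP G).
Local Notation L := (cL G).
Local Notation itin := (itinerary (cF G) (cbr G)).
Local Notation wset := (word_set (cX G) (cF G) (cbr G)).
Local Notation pre := (hit_at (cX G) (cF G)).
Local Notation cyl := (cylindrical (cX G) (cF G) (cbr G)).

Lemma geometric_sum_le (a : R) n : 0 <= a -> a < 1 ->
  \sum_(i < n) a ^+ i <= (1 - a)^-1.
Proof.
move=> a0 a1; have := subrX1 a n => H.
rewrite -[leRHS]div1r ler_pdivlMr ?subr_gt0//.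
have -> : (\sum_(i < n) a ^+ i) * (1 - a) = 1 - a ^+ n by rewrite -opprB mulrN mulrC -H opprB.
by rewrite gerBl exprn_ge0.
Qed.

Lemma pre_setI_pre i j E : (i <= j)%N -> pre i E `&` pre j E = pre i (E `&` pre (j - i) E).
Proof.
move=> ij; apply/seteqP; split => [x [[Xx Ei] [_ Ej]]|x [Xx [Ei [_ Ej]]]].
  split => //; split => //; split; first by apply: X_iter => //; exact: cFX.
  by rewrite -iterD subnK.
by do 2 split => //; rewrite -[j](subnK ij) iterD.
Qed.

(** An event whose prefixes have small mass returns rarely, so it is visited by a
    definite part of all orbits in a time inversely proportional to its mass: the
    second-order term of the inclusion-exclusion formula is small if the visiting
    times are sampled with a large constant gap. *)
Lemma hit_window (E : set R) n (Pk : nat -> set R) (C h w : R) g m :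
  cyl n E -> (forall k, cyl k (Pk k)) -> (forall k, E `<=` Pk k) ->
  0 < w -> (forall k, pr P (Pk k) <= C * h + w * 2^-1 ^+ (k %/ cn G)) ->
  (0 < g)%N -> 2^-1 ^+ g <= (8 * cK G * w)^-1 ->
  m%:R * (4 * cK G * C * h) <= 1 -> 0 < C -> 0 < h ->
  m%:R * pr P E / 2 <= pr P (\bigcup_(t < m) pre (g * cn G * t) E).
Proof.
move=> cE cPk EPk w0 HPk g0 Hg Hm C0 h0; have K1 := cK1 G.
have mE := m_cyl cE.
have mA t : measurable (pre (g * cn G * t) E) by exact: m_pre.
apply: le_trans (pr_bonferroni P m mA).
rewrite -mulrA mulr_natl -[m in leLHS]card_ord -sumr_const.
apply: ler_sum => j _; rewrite pr_pre// lerBrDl -lerBrDr.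
rewrite [leRHS](_ : _ = pr P E / 2); last by lra.
have ret (i : 'I_j) : pr P (pre (g * cn G * i) E `&` pre (g * cn G * j) E) <=
    cK G * pr P E * (C * h + w * (2^-1 ^+ g) ^+ (j - i)).
  have ij : (i <= j)%N by exact: ltnW.
  rewrite pre_setI_pre ?leq_mul2l ?ij ?orbT// -mulnBr.
  set k := (g * cn G * (j - i))%N.
  have mEk : measurable (E `&` pre k E : set (measurableTypeR R)).
    by apply: measurableI => //; exact: m_pre.
  rewrite pr_pre//; apply: le_trans (_ : pr P (Pk k `&` pre k E) <= _).
    apply: pr_le => //; last exact: setSI.
    by apply: measurableI; [exact: m_cyl (cPk k)|exact: m_pre].
  apply: le_trans (qb_le (cPk k) cE) _.
  rewrite -mulrA ler_pM2l; last by lra.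
  rewrite mulrC ler_wpM2l ?pr_ge0//; apply: le_trans (HPk k) _.
  rewrite lerD2l -exprM ler_pM2l// /k mulnAC mulnK//; exact: cn0.
apply: le_trans (ler_sum _ (fun i _ => ret i)) _.
rewrite -mulr_sumr mulrAC [leRHS]mulrC ler_wpM2r ?pr_ge0//.
rewrite big_split/= sumr_const card_ord -[C * h *+ j]mulr_natl -mulr_sumr.
set th := 2^-1 ^+ g in Hg *.
have th0 : 0 < th by rewrite exprn_gt0.
have th2 : th <= 1 / 2.
  have -> : 1 / 2 = 2^-1 ^+ 1 :> R by rewrite expr1 div1r.
  by apply: ler_wiXn2l => //; lra.
have geo : \sum_(i < j) th ^+ (j - i) <= 2 * th.
  rewrite (reindex_inj rev_ord_inj)/=.
  have -> : \sum_(i < j) th ^+ (j - (j - i.+1)) = th * \sum_(i < j) th ^+ i.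
    by rewrite mulr_sumr; apply: eq_bigr => i _; rewrite subKn// exprS.
  rewrite [leRHS]mulrC ler_pM2l//; apply: le_trans (geometric_sum_le _ _ _) _; [lra|lra|].
  by rewrite -[leRHS]invrK lef_pV2 ?posrE; lra.
have jm : j%:R * (4 * cK G * C * h) <= 1.
  apply: le_trans Hm; have a0 : 0 <= 4 * cK G * C * h by rewrite !mulr_ge0//; lra.
  by apply: ler_wpM2r => //; rewrite ler_nat ltnW.
have := ler_wpM2l (ltW w0) geo.
have : cK G * (w * (2 * th)) <= 1 / 4.
  have Kw : 0 < 8 * cK G * w by rewrite !mulr_gt0//; lra.
  have := ler_wpM2l (ltW Kw) Hg; rewrite mulfV ?gt_eqF//; lra.
have K00 : 0 <= cK G by lra.
move=> H1 H2; have H3 := ler_wpM2l K00 H2; lra.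
Qed.

(** The target is the union of the words of diameter at most [h] that meet the interval.
    Its mass is of the order of [h], so [hit_window] applies to a number of samples of
    the order of [1 / h]. *)
Lemma hit_interval : exists C c h0 : R, [/\ 0 < C, 0 < c, 0 < h0 &
  forall h, 0 < h -> h <= h0 -> exists H, [/\ (0 < H)%N, H%:R <= C / h &
    forall u, cY G u -> cY G (u + h) -> exists V, [/\ cyl H V, c <= pr P V &
      forall x, V x -> exists t z, [/\ (t < H)%N, u < z < u + h &
        `|iter t F x - z| <= h]]]].
Proof.
have [b b0 Hb] := P_le_L G; have [w w0 Hw] := P_word G.
have [d d0 Hd] := P_ge_length G.
have K1 := cK1 G; have A1 := cA1 G; have A0 : 0 < cA G by lra.
have K0 : 0 < cK G by lra.
have n0 := cn0 G.
pose C2 := b * (cA G + 2) + 2 * w.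
have C20 : 0 < C2 by rewrite addr_gt0 ?mulr_gt0//; lra.
pose g := (Num.truncn (16 * cK G * w)).+1.
have Hg : (2^-1 : R) ^+ g <= (8 * cK G * (2 * w))^-1.
  apply: le_trans (half_pow_le _ _) _.
  have Kw : 0 < 8 * cK G * (2 * w) by rewrite !mulr_gt0.
  rewrite lef_pV2 ?posrE ?ltr0Sn//; apply/ltW.
  apply: lt_le_trans (_ : g%:R <= _); last by rewrite ler_nat.
  by rewrite (_ : _ * _ = 16 * cK G * w); [exact: truncnS_gt|ring].
pose a := 4 * cK G * C2.
have a0 : 0 < a by rewrite !mulr_gt0.
pose C := (g * cn G)%:R / a + (cn G)%:R * cA G + 1.
have C0 : 0 < C.
  by rewrite ltr_pwDr// addr_ge0// ?divr_ge0 ?mulr_ge0// ltW.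
exists C, (1 / (4 * a * d)), (Num.min 1 (1 / a)).
split => //; [by rewrite divr_gt0// !mulr_gt0|by rewrite lt_min ltr01 divr_gt0|].
move=> h h0; rewrite le_min => /andP[h1 ha].
pose q := Num.truncn (cA G / h); pose n := (q * cn G)%N.
pose m := Num.truncn (1 / (a * h)).
have ah : 0 < a * h by rewrite mulr_gt0.
have m_le : m%:R <= 1 / (a * h) by rewrite truncn_le divr_ge0// ltW.
have m_gt : 1 / (a * h) < m.+1%:R by exact: truncnS_gt.
have m_ge : 1 <= m%:R :> R.
  rewrite ler1n truncn_gt0 ler_pdivlMr//.
  by move: ha; rewrite ler_pdivlMr//; lra.
have qh : (2^-1 : R) ^+ q <= h / cA G.
  apply: le_trans (half_pow_le _ _) _.
  rewrite -[leRHS]invrK lef_pV2 ?posrE ?ltr0Sn// ?invr_gt0 ?divr_gt0// invf_div.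
  exact/ltW/truncnS_gt.
have qh1 : (2^-1 : R) ^+ q <= h.
  apply: le_trans qh _; rewrite ler_pdivrMr//; rewrite ler_peMr// ltW//.
pose H := (g * cn G * m + n + 1)%N.
exists H; split; first by rewrite /H addn1.
  rewrite /H /n !natrD natrM mulrDl !mulrDl; apply: lerD; first apply: lerD.
  - rewrite -mulrA ler_wpM2l//; apply: le_trans m_le _.
    by rewrite mul1r invfM.
  - rewrite natrM mulrC -mulrA ler_wpM2l//.
    by rewrite truncn_le divr_ge0// ltW.
  - by rewrite ler_pdivlMr// mul1r.
move=> u Yu Yv.
pose J : set (measurableTypeR R) := X `&` `]u, (u + h)[%classic.
have mJ : measurable J by apply: measurableI => //; exact: cmX.
have JX : J `<=` X by move=> z [].
have cJ : convX G J by exact: convX_itv.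
pose E := hull G n J.
have cE : cyl n E by exact: cyl_hull.
have mE := m_cyl cE.
have uh : u < u + h by lra.
have uhu : u + h - u = h by ring.
have LJ : pr L J <= cA G * h.
  have := clen_le G (ltW uh); rewrite uhu => /(le_trans _); apply.
  apply: pr_le => //; first by apply: measurableI => //; exact: cmX.
  by apply: setIS => z; rewrite /= !in_itv/= => /andP[/ltW -> /ltW ->].
have Lw k v : pr L (wset k v) <= 2^-1 ^+ (k %/ cn G) by exact: L_word.
have PE : pr P E <= b * (cA G + 2) * h.
  apply: le_trans (Hb _ _ cE) _; rewrite -mulrA ler_pM2l//.
  apply: le_trans (pr_hull_le mJ cJ (Lw n)) _.
  by rewrite mulnK//; lra.
have JE : pr P J <= pr P E by apply: pr_le => //; exact: sub_hull.
have PJ : h <= d * pr P J by have := Hd _ _ Yu Yv uh; rewrite uhu.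
pose Pk k := if (k <= n)%N then hull G k J : set R else E : set R.
have cPk k : cyl k (Pk k).
  rewrite /Pk; case: leqP => [kn|/ltnW nk]; first exact: cyl_hull.
  exact: cyl_le cE.
have EPk k : E `<=` Pk k.
  rewrite /Pk; case: leqP => [kn|_]; last exact: subset_refl.
  move=> z [Xz [z' [Jz Xz' zz]]].
  by split => //; exists z'; split => //; exact: itin_prefix zz.
have PPk k : pr P (Pk k) <= C2 * h + 2 * w * 2^-1 ^+ (k %/ cn G).
  have tw : 0 <= 2 * w * 2^-1 ^+ (k %/ cn G) by rewrite !mulr_ge0 ?exprn_ge0// ltW.
  have wh : 0 <= 2 * w * h by rewrite !mulr_ge0 ?exprn_ge0// ltW.
  rewrite /Pk; case: leqP => [kn|_]; last by rewrite /C2; lra.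
  have := pr_hull_le mJ cJ (Hw k) (Q := P).
  by rewrite /C2; lra.
have Hm : m%:R * (4 * cK G * C2 * h) <= 1.
  by move: m_le; rewrite ler_pdivlMr.
have w20 : 0 < 2 * w by lra.
have := hit_window cE cPk EPk w20 PPk (ltn0Sn _) Hg Hm C20 h0.
set V := \bigcup_(t < m) _ => HV.
have cV : cyl H V.
  apply: cyl_bigcup => t /= tm; apply: (@cyl_le _ _ _ _ (g * cn G * t + n)).
    by rewrite /H -addnA leq_add ?leq_mul2l ?(ltnW tm) ?orbT// leq_addr.
  by apply: cyl_pre => //; exact: cFX.
exists V; split => //.
  apply: le_trans HV.
  have PEh : h / d <= pr P E by rewrite ler_pdivrMr//; have := ler_wpM2l (ltW d0) JE; lra.
  have mm : 1 / (2 * (a * h)) <= m%:R.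
    have -> : 1 / (2 * (a * h)) = (1 / (a * h)) / 2 by field; lra.
    by move: m_gt; rewrite -natr1; lra.
  have hd : 0 <= h / d by rewrite divr_ge0// ltW.
  have ahi : 0 <= 1 / (2 * (a * h)) by rewrite divr_ge0// mulr_ge0// ltW.
  have := ler_pM ahi hd mm PEh.
  have -> : 1 / (2 * (a * h)) * (h / d) = 2 * (1 / (4 * a * d)) by field; lra.
  lra.
move=> x [t /= tm [Xx [Xt [z [[Xz Jz] _ zt]]]]].
exists (g * cn G * t)%N, z; split.
- rewrite /H addn1 ltnS; apply: leq_trans (leq_addr _ _).
  by rewrite leq_mul2l (ltnW tm) orbT.
- by move: Jz; rewrite /= in_itv.
- set y := iter _ _ _ in Xt zt *.
  have qA : cA G * 2^-1 ^+ (n %/ cn G) <= h.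
    by rewrite mulnK// mulrC; move: qh; rewrite ler_pdivlMr.
  have [zy|yz|->] := ltgtP z y; last by rewrite subrr normr0 ltW.
    rewrite gtr0_norm ?subr_gt0//; apply: le_trans qA.
    exact: word_diam.
  rewrite distrC gtr0_norm ?subr_gt0//; apply: le_trans qA.
  exact: word_diam.
Qed.
End Hitting.

(** * Covering in the time scale of returns: upper bound *)

Section CoverUpper.
Variables (R : realType) (G : coded R).
Local Notation X := (cX G).
Local Notation F := (cF G).
Local Notation P := (cP G).
Local Notation pre := (hit_at (cX G) (cF G)).
Local Notation cyl := (cylindrical (cX G) (cF G) (cbr G)).

Lemma cY_hull : exists lo hi, [/\ lo < hi, (forall y, cY G y -> lo <= y <= hi) &
  forall y, lo < y < hi -> cY G y].
Proof.
have [x [y [Yx Yy xy]]] := cY_nd G.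
have A1 := cA1 G; have A0 : 0 < cA G by lra.
have bnd a b : cY G a -> cY G b -> b <= a + cA G.
  move=> Ya Yb; have [ba|ab] := leP b a; first by lra.
  have := clen_ge Ya Yb ab.
  have := @pr_le1 _ _ R (cL G) (X `&` `]a, b[%classic) (measurableI _ _ (@cmX _ G) (measurable_itv _)).
  by move=> /(ler_wpM2l (ltW A0)); lra.
have Y0 : cY G !=set0 by exists x.
have hs : has_sup (cY G) by split => //; exists (x + cA G) => z Yz; exact: bnd.
have hi : has_inf (cY G).
  by split => //; exists (x - cA G) => z Yz; rewrite lerBlDr; exact: bnd.
have lox := ge_inf hi.2 Yx; have yhi := ub_le_sup hs.2 Yy.
exists (inf (cY G)), (sup (cY G)); split.
- by apply: le_lt_trans lox _; exact: lt_le_trans yhi.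
- by move=> z Yz; rewrite ge_inf ?ub_le_sup//; [exact: hs.2|exact: hi.2].
- move=> z /andP[lz zh]; have [a Ya az] := inf_lt Y0 lz.
  have [b Yb zb] := sup_gt Y0 zh.
  by apply: (@cY_interval _ G a b) => //; rewrite (ltW az) (ltW zb).
Qed.

Lemma sum_eventually_geometric (u : nat -> R) (a : R) q0 Q :
  0 <= a -> a < 1 -> (forall q, 0 <= u q <= 1) -> (forall j, u (q0 + j)%N <= a ^+ j) ->
  \sum_(q < Q) u q <= q0%:R + (1 - a)^-1.
Proof.
move=> a0 a1 u1 ua; apply: (@le_trans _ _ (\sum_(q < q0 + Q) u q)).
  rewrite addnC big_split_ord/= lerDl; apply: sumr_ge0 => i _.
  by have /andP[] := u1 (Q + i)%N.
rewrite big_split_ord/=; apply: lerD.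
  apply: (@le_trans _ _ (\sum_(i < q0) 1)); last by rewrite sumr_const card_ord.
  by apply: ler_sum => i _; have /andP[] := u1 i.
apply: le_trans (geometric_sum_le Q a0 a1).
by apply: ler_sum => i _; exact: ua.
Qed.

(** The points whose orbit avoids [V] in each of the first [q] time windows of length
    [B], the windows being separated by the mixing gap. *)
Fixpoint miss (V : set R) (B q : nat) : set R :=
  if q is q'.+1 then miss V B q' `&` pre (q' * B + cj G) (X `\` V) else X.

Lemma cyl_miss V H q : cyl H V -> cyl (q * (cj G + H)) (miss V (cj G + H) q).
Proof.
move=> cV; elim: q => [|q IHq]; first exact: cylT.
rewrite mulSnr /= addnA; apply: cyl_setI.
  by apply: cyl_le IHq; rewrite -addnA leq_addr.
apply: cyl_pre; [exact: cFX|exact: cyl_compl].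
Qed.

(** The windows are separated by the mixing gap, so each of them keeps at most the
    fraction [1 - c / 2] of the points that have missed [V] so far. *)
Lemma pr_miss V H (c : R) q : cyl H V -> c <= pr P V -> c <= 2 ->
  pr P (miss V (cj G + H) q) <= (1 - c / 2) ^+ q.
Proof.
move=> cV Vc c2; elim: q => [|q IHq] /=; first by rewrite cPX.
set B := (cj G + H)%N in IHq *.
have cM := cyl_miss q cV; have mM := m_cyl cM; have mV := m_cyl cV.
have mp := @m_pre _ G (q * B + cj G) _ mV.
have := mix_ge cM cV; rewrite -/B.
have := pr_split P mM mp.
have -> : miss V B q `\` pre (q * B + cj G) V = miss V B q `&` pre (q * B + cj G) (X `\` V).
  apply/seteqP; split => [x [Mx nV]|x [Mx [Xx [_ nV]]]]; split => //.
    have Xx := cylX cM Mx; split => //; split.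
      by apply: X_iter => //; exact: cFX.
    by move=> Vx; apply: nV.
  by move=> [].
have := ler_wpM2l (pr_ge0 P (miss V B q)) Vc.
have := ler_wpM2r (_ : 0 <= 1 - c / 2) IHq.
rewrite exprSr => /(_ _); lra.
Qed.

(** Cut the interval into [M] pieces, with [M] of the order of [1 / d].  The probability of
    missing one of them in [q] windows is at most [M * (1 - a) ^ q]; it is trivially at
    most one for the first [ln M / a] values of [q] and decays geometrically afterwards,
    which gives the logarithm.  The bad events depend on finitely many symbols, so that
    they decouple from the returns that follow. *)
Lemma cover_upper : exists C d0 : R, [/\ 0 < C, 0 < d0 &
  forall d, 0 < d -> d < d0 -> exists B (Bad : nat -> set R),
    [/\ (0 < B)%N, B%:R <= C / d, (forall q, cyl (q * B) (Bad q)),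
      forall Q, \sum_(q < Q) pr P (Bad q) <= C * ln (1 / d) &
      forall q x p, X x -> ~ Bad q x -> cY G p ->
        exists2 t, (t < q * B)%N & `|iter t F x - p| <= d]].
Proof.
have [lo [hi [lohi Ylohi Yin]]] := cY_hull.
have [C [c [h0 [C0 c0 h00 HV]]]] := hit_interval G.
pose l := hi - lo; have l0 : 0 < l by rewrite subr_gt0.
pose c2 := Num.min c 1; have c2c : c2 <= c by rewrite ge_min lexx.
have c21 : c2 <= 1 by rewrite ge_min lexx orbT.
have c20 : 0 < c2 by rewrite lt_min c0 ltr01.
pose a := c2 / 2; have a0 : 0 < a by rewrite /a; lra.
have a1 : a <= 1 / 2 by rewrite /a; lra.
have e1 : expR (-1) < 1 :> R by rewrite -[ltRHS]expR0 ltr_expR; lra.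
exists ((cj G)%:R + 6 * C + (3 / a + 1)).
exists (Num.min (Num.min l h0) (Num.min (1 / (3 * l)) (expR (-1)))).
have ai : 0 < 3 / a by rewrite divr_gt0.
split; [by have := ler0n R (cj G); lra| |].
  by rewrite !lt_min l0 h00 expR_gt0 divr_gt0// mulr_gt0.
move=> d d0; rewrite !lt_min => /andP[/andP[dl dh0] /andP[dl3 de]].
have d1 : d < 1 by exact: lt_trans e1.
pose m1 := Num.truncn (2 * l / d); pose M := m1.+1.
have M0 : 0 < M%:R :> R by [].
have ld0 : 0 <= 2 * l / d by rewrite divr_ge0 ?mulr_ge0// ltW.
have Mgt : 2 * l / d < M%:R by exact: truncnS_gt.
have m1le : m1%:R <= 2 * l / d by rewrite truncn_le.
have Mle : M%:R <= 3 * l / d.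
  have ld : 1 <= l / d by rewrite ler_pdivlMr// mul1r ltW.
  by rewrite /M -(natr1 m1); lra.
pose h := l / M%:R; have hh : 0 < h by rewrite divr_gt0.
have hM : h * M%:R = l by rewrite /h divfK// gt_eqF.
have hd : h <= d / 2.
  have : 2 * l < M%:R * d by rewrite -ltr_pdivrMr.
  by rewrite -hM -(ler_pM2r M0); lra.
have hd3 : d / 3 <= h.
  have : M%:R * d <= 3 * l by rewrite -ler_pdivlMr.
  by rewrite -hM => Md; rewrite -(ler_pM2r M0); lra.
have h2 : 0 < h / 2 by rewrite divr_gt0.
have h2h0 : h / 2 <= h0 by lra.
have [H [H0 HC HVi]] := HV _ h2 h2h0.
pose u i := lo + i%:R * h + h / 4.
have iM i : (i < M)%N -> lo + i%:R * h + h <= hi.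
  move=> im; have -> : hi = lo + M%:R * h by rewrite mulrC hM /l addrC subrK.
  have : i.+1%:R * h <= M%:R * h by rewrite ler_pM2r// ler_nat.
  by rewrite -natr1; lra.
have ih i : 0 <= i%:R * h by rewrite mulr_ge0// ltW.
have {HVi} : forall i, exists V : set R, (i < M)%N -> [/\ cyl H V, c <= pr P V &
      forall x, V x -> exists t z, [/\ (t < H)%N, u i < z < u i + h / 2 &
        `|iter t F x - z| <= h / 2]].
  move=> i; case: (ltnP i M) => im; last by exists set0.
  have Yu : cY G (u i).
    by apply: Yin; have := iM _ im; have := ih i; rewrite /u; lra.
  have Yv : cY G (u i + h / 2).
    by apply: Yin; have := iM _ im; have := ih i; rewrite /u; lra.
  by have [V HVV] := HVi _ Yu Yv; exists V.
move=> /choice[V HVM].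
pose B := (cj G + H)%N.
pose Bad q := \bigcup_(i in `I_M) miss (V i) B q.
have cBad q : cyl (q * B) (Bad q).
  by apply: cyl_bigcup => i /= /HVM[cV _ _]; exact: cyl_miss.
have PBad q : pr P (Bad q) <= M%:R * (1 - a) ^+ q.
  pose W i := if (i < M)%N then miss (V i) B q else set0.
  have cW i : cyl (q * B) (W i).
    rewrite /W; case: ifP => [/HVM[cV _ _]|_]; [exact: cyl_miss|exact: cyl0].
  have -> : Bad q = \bigcup_(i < M) W i.
    by apply: eq_bigcupr => i /= im; rewrite /W im.
  apply: le_trans (pr_bigcup_le _ _ _) _; first by move=> i; exact: m_cyl (cW i).
  apply: (@le_trans _ _ (\sum_(i < M) (1 - a) ^+ q)); last first.
    by rewrite sumr_const card_ord mulr_natl.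
  apply: ler_sum => i _; rewrite /W ltn_ord.
  have [cV Vc _] := HVM i (ltn_ord i).
  by apply: pr_miss => //; [exact: le_trans Vc|lra].
have lnd : 1 <= ln (1 / d).
  by rewrite -[leLHS]expRK ler_ln ?posrE ?expR_gt0 ?divr_gt0// div1r -[expR 1]invrK -expRN
    lef_pV2 ?posrE ?expR_gt0// ltW.
have lnM0 : 0 <= ln M%:R :> R by rewrite ln_ge0// ler1n.
have lnMd : ln M%:R <= 2 * ln (1 / d).
  have d1i : 0 < 1 / d by rewrite divr_gt0.
  have l3 : 3 * l <= 1 / d.
    by rewrite ler_pdivlMr// mulrC ltW// -ltr_pdivlMr// mulr_gt0.
  have -> : 2 * ln (1 / d) = ln (1 / d * (1 / d)).
    by rewrite [RHS]lnM ?posrE//; ring.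
  have dd : 0 < 1 / d * (1 / d) by apply: mulr_gt0.
  rewrite ler_ln ?posrE//; apply: le_trans Mle _.
  have -> : 3 * l / d = 3 * l * (1 / d) by field; rewrite gt_eqF.
  by rewrite ler_pM2r.
exists B, Bad; split => //.
- by rewrite /B addn_gt0 H0 orbT.
- rewrite ler_pdivlMr// /B natrD mulrDl.
  have := ler_wpM2l (ler0n R (cj G)) (ltW d1).
  move: HC; rewrite ler_pdivlMr// => HC.
  have dh : d <= 6 * (h / 2) by lra.
  have := ler_wpM2l (ler0n R H) dh; lra.
- move=> Q; pose q0 := (Num.truncn (ln M%:R / a)).+1.
  have q0M : ln M%:R <= a * q0%:R.
    by rewrite -ler_pdivrMl// mulrC ltW// truncnS_gt.
  have q0le : q0%:R <= ln M%:R / a + 1.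
    by rewrite -natr1 lerD2r truncn_le divr_ge0// ltW.
  have Pq0 j : pr P (Bad (q0 + j)%N) <= (1 - a) ^+ j.
    apply: le_trans (PBad _) _; rewrite exprD mulrA ler_piMl ?exprn_ge0//; first lra.
    apply: (@le_trans _ _ (M%:R * expR (- (a * q0%:R)))).
      have -> : - (a * q0%:R) = q0%:R * - a by ring.
      rewrite ler_pM2l// expRM_natl; apply: lerXn2r.
      - by rewrite nnegrE; lra.
      - by rewrite nnegrE expR_ge0.
      - exact: expR_ge1Dx.
    by rewrite expRN ler_pdivrMr ?expR_gt0// mul1r -[leLHS]lnK ?posrE// ler_expR.
  have g0 : 0 <= 1 - a by lra.
  have g1 : 1 - a < 1 by lra.
  have gP q : 0 <= pr P (Bad q) <= 1.
    by rewrite pr_ge0 pr_le1//; exact: m_cyl (cBad q).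
  apply: le_trans (sum_eventually_geometric Q g0 g1 gP Pq0) _.
  have -> : 1 - (1 - a) = a by ring.
  have : 1 / a * 1 <= 1 / a * ln (1 / d) by rewrite ler_pM2l// divr_gt0.
  have : 1 / a * ln M%:R <= 1 / a * (2 * ln (1 / d)) by rewrite ler_pM2l// divr_gt0.
  have : 0 <= (cj G)%:R * ln (1 / d) by rewrite mulr_ge0//; lra.
  have : 0 <= C * ln (1 / d) by rewrite mulr_ge0//; lra.
  lra.
- move=> q x p Xx nBad Yp.
  have [i [im Hi]] : exists i, (i < M)%N /\ forall z, u i < z < u i + h / 2 -> `|z - p| <= h.
    have /andP[lop phi] := Ylohi _ Yp.
    pose i := Num.truncn ((p - lo) / h).
    have ph0 : 0 <= (p - lo) / h by rewrite divr_ge0//; lra.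
    have ile : i%:R * h <= p - lo by rewrite -ler_pdivlMr// truncn_le.
    have igt : p - lo < i.+1%:R * h by rewrite -ltr_pdivrMr// truncnS_gt.
    have [im|Mi] := ltnP i M.
      exists i; split => // z /andP[]; rewrite /u => z1 z2.
      by rewrite ler_norml; apply/andP; split; move: igt; rewrite -natr1; lra.
    exists m1; split => // z /andP[]; rewrite /u => z1 z2.
    have Mh : M%:R * h <= i%:R * h by rewrite ler_pM2r// ler_nat.
    have lM : M%:R * h = l by rewrite mulrC.
    have : m1%:R * h + h = l by rewrite -lM /M -(natr1 m1); ring.
    by rewrite ler_norml; move=> E1; apply/andP; split; move: E1 Mh; rewrite lM /l; lra.
  have [cV _ HVx] := HVM i im.
  have : ~ miss (V i) B q x by move=> Mx; apply: nBad; exists i.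
  elim: q {nBad} => [//|q IHq] /= /not_andP[/IHq[t tq Ht]|npre].
    by exists t => //; apply: leq_trans tq _; rewrite leq_mul2r leqnSn orbT.
  have : V i (iter (q * B + cj G) F x).
    apply: contrapT => nV; apply: npre; split => //; split => //.
    by apply: X_iter => //; exact: cFX.
  move=> /HVx[t [z [tH zu zt]]]; exists (q * B + cj G + t)%N.
    by rewrite mulSnr -addnA ltn_add2l /B ltn_add2l.
  rewrite addnC iterD; have := Hi _ zu.
  set y := iter t _ _ in zt *; have := ler_normD (y - z) (z - p).
  by rewrite addrA subrK; lra.
Qed.
End CoverUpper.

(** * A coupon collector's potential *)

Section Potential.
Variables (R : realType) (G : coded R).
Local Notation X := (cX G).
Local Notation F := (cF G).
Local Notation P := (cP G).
Local Notation wset := (word_set (cX G) (cF G) (cbr G)).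
Local Notation itin := (itinerary (cF G) (cbr G)).
Local Notation pre := (hit_at (cX G) (cF G)).
Local Notation cyl := (cylindrical (cX G) (cF G) (cbr G)).

Lemma pr_fin_fibres (T : finType) (g : R -> T) (A : set (measurableTypeR R)) :
  measurable A -> A `<=` X ->
  (forall S, measurable (X `&` g @^-1` [set S] : set (measurableTypeR R))) ->
  pr P A = \sum_S pr P (A `&` g @^-1` [set S]).
Proof.
move=> mA AX mg.
have mAg S : measurable (A `&` g @^-1` [set S] : set (measurableTypeR R)).
  by rewrite -(setIidl AX) -setIA; exact: measurableI.
suff H (s : seq T) : uniq s ->
    measurable (A `&` [set x | g x \in s] : set (measurableTypeR R)) /\
    pr P (A `&` [set x | g x \in s]) = \sum_(S <- s) pr P (A `&` g @^-1` [set S]).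
  have [_] := H _ (index_enum_uniq T); rewrite /= => <-; congr pr.
  by apply/seteqP; split => [x Ax|x []//]; split => //=; exact: mem_index_enum.
elim: s => [_|S s IHs /andP[Ss /IHs[ms Es]]].
  by rewrite big_nil (_ : _ `&` _ = set0) ?pr0//; apply/seteqP; split => // x [].
have -> : A `&` [set x | g x \in S :: s] =
    (A `&` g @^-1` [set S]) `|` (A `&` [set x | g x \in s]).
  rewrite -setIUr; congr (_ `&` _); apply/seteqP; split => x /=; rewrite inE.
    by case/orP => [/eqP|]; [left|right].
  by case=> [->|->]; rewrite ?eqxx ?orbT.
split; first exact: measurableU.
rewrite big_cons prU// ?Es//; apply/seteqP; split => // x [[_ /= gS] [_ /= gs]].
by rewrite gS (negPf Ss) in gs.
Qed.

Definition harmonic_sum n : R := \sum_(i < n) i.+1%:R^-1.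

Lemma harmonic_sumS n : harmonic_sum n.+1 = harmonic_sum n + n.+1%:R^-1.
Proof. by rewrite /harmonic_sum big_ord_recr. Qed.

Lemma harmonic_sum_ge0 n : 0 <= harmonic_sum n.
Proof. by apply: sumr_ge0 => i _; rewrite invr_ge0. Qed.

Lemma harmonic_sum_le n k : (n <= k)%N -> harmonic_sum n <= harmonic_sum k.
Proof.
move=> /subnKC <-; rewrite [leRHS]/harmonic_sum big_split_ord/= lerDl.
by apply: sumr_ge0 => i _; rewrite invr_ge0.
Qed.

Lemma harmonic_sum_pow2 n : n%:R / 2 <= harmonic_sum (2 ^ n).
Proof.
elim: n => [|n IHn]; first by rewrite mul0r harmonic_sum_ge0.
rewrite expnS mul2n -addnn [leRHS]/harmonic_sum big_split_ord/= -natr1 mulrDl.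
apply: lerD => //; apply: (@le_trans _ _ (\sum_(i < 2 ^ n) (2 * 2 ^ n)%N%:R^-1)).
  have n0 : (2 ^ n)%N%:R != 0 :> R by rewrite pnatr_eq0 expn_eq0.
  by rewrite sumr_const card_ord -[_ *+ (2 ^ n)%N]mulr_natl natrM invfM mulrCA mulfV// mulr1 div1r.
apply: ler_sum => i _; rewrite lef_pV2 ?posrE ?ltr0n// ?muln_gt0 ?expn_gt0//.
by rewrite ler_nat mul2n -addnn -addnS leq_add2l.
Qed.

Variables (T : finType) (len : T -> nat) (z : T -> seq nat) (th : R).
Local Notation W i := (wset (len i) (z i)).
Hypothesis th0 : 0 <= th.
Hypothesis len_gt0 : forall i, (0 < len i)%N.
Hypothesis W_le : forall i, pr P (W i) <= th.
Hypothesis W_no_overlap : forall i j s t x, (s < t)%N -> (t < s + len i)%N ->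
  W i (iter s F x) -> ~ W j (iter t F x).
Hypothesis W_disjoint : forall i j x, W i x -> W j x -> i = j.

Definition unvisited t x : {set T} :=
  [set i | `[< forall s, (s < t)%N -> ~ W i (iter s F x) >] ].

(** Unlike [unvisited], this set counts a target only when it has been read to its end,
    and is therefore determined by the first [t] symbols. *)
Definition unread t x : {set T} :=
  [set i | `[< forall s, (s + len i <= t)%N -> ~ W i (iter s F x) >] ].

Lemma cyl_unread t S : cyl t (X `&` unread t @^-1` [set S]).
Proof.
split => [x []//|x y Xx Xy xy [_ /= <-]]; split => //=.
have sub u v : X u -> X v -> itin t u = itin t v -> forall i s, (s + len i <= t)%N ->
    W i (iter s F u) -> W i (iter s F v).
  move=> Xu Xv uv i s st [_ <-]; split; first by apply: X_iter => //; exact: cFX.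
  by apply/esym/itin_suffix/(itin_prefix st).
apply/setP => i; rewrite !inE; apply/asboolP/asboolP => H s st Ws; apply: (H s st).
  exact: sub Ws.
exact: sub Ws.
Qed.

Lemma cyl_unvisited t S : cyl (t + \max_i len i) (X `&` unvisited t @^-1` [set S]).
Proof.
split => [x []//|x y Xx Xy xy [_ /= <-]]; split => //=.
have sub u v : X u -> X v -> itin (t + \max_i len i) u = itin (t + \max_i len i) v ->
    forall i s, (s < t)%N -> W i (iter s F u) -> W i (iter s F v).
  move=> Xu Xv uv i s st [_ <-]; split; first by apply: X_iter => //; exact: cFX.
  apply/esym/itin_suffix; apply: (itin_prefix _ uv).
  by rewrite leq_add ?(ltnW st)//; exact: leq_bigmax.
apply/setP => i; rewrite !inE; apply/asboolP/asboolP => H s st Ws; apply: (H s st).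
  exact: sub Ws.
exact: sub Ws.
Qed.

Lemma m_unvisited t S :
  measurable (X `&` unvisited t @^-1` [set S] : set (measurableTypeR R)).
Proof. exact: m_cyl (cyl_unvisited t S). Qed.

(** A target can only be entered when none of the others is being read, which makes
    the set of unvisited targets known from the past. *)
Lemma unvisited_hit t S i :
  pr P (X `&` unvisited t @^-1` [set S] `&` pre t (W i)) <=
    cK G * th * pr P (X `&` unread t @^-1` [set S]).
Proof.
have K1 := cK1 G.
apply: (@le_trans _ _ (pr P (X `&` unread t @^-1` [set S] `&` pre t (W i)))).
  apply: pr_le.
  - by apply: measurableI; [exact: m_unvisited|apply: m_pre; exact: m_wset].
  - by apply: measurableI; [exact: m_cyl (cyl_unread t S)|apply: m_pre; exact: m_wset].
  - move=> x [[Xx /= <-] [_ Wx]]; split => //; split => //=.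
    apply/setP => j; rewrite !inE; apply/asboolP/asboolP => H s st Ws; last first.
      apply: (H s) Ws; apply: leq_trans st; rewrite -[X in (X < _)%N]addn0 ltn_add2l.
      exact: len_gt0.
    have [/H|ts] := leqP (s + len j) t; first exact.
    exact: W_no_overlap st ts Ws Wx.
apply: le_trans (qb_le (cyl_unread t S) (cyl_wset _ _ _ _ _)) _.
rewrite -mulrA ler_pM2l; last by lra.
by rewrite mulrC ler_wpM2r ?pr_ge0.
Qed.

(** With [i] targets left, a collector needs a time proportional to the harmonic sum
    of [i]. *)
Definition potential t : R :=
  \sum_(S : {set T}) harmonic_sum #|S| * pr P (X `&` unvisited t @^-1` [set S]).

(** At most one target is visited at each time, and each unvisited one is visited
    with probability at most [cK G * th]: dividing by the number of unvisited targets
    makes the expected loss independent of that number. *)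
Lemma potential_step t : potential t - potential t.+1 <= cK G * th.
Proof.
have K1 := cK1 G.
pose p (S S' : {set T}) : set (measurableTypeR R) :=
  X `&` unvisited t @^-1` [set S] `&` unvisited t.+1 @^-1` [set S'].
have mp S S' : measurable (p S S').
  rewrite (_ : p S S' = (X `&` unvisited t @^-1` [set S]) `&`
                        (X `&` unvisited t.+1 @^-1` [set S'])).
    by apply: measurableI; exact: m_unvisited.
  by rewrite setIACA setIid setIA.
have unvX u S : X `&` unvisited u @^-1` [set S] `<=` X by move=> x [].
have mW i : measurable (pre t (W i)) by apply: m_pre; exact: m_wset.
have pot0 : potential t = \sum_(S : {set T}) \sum_(S' : {set T}) harmonic_sum #|S| * pr P (p S S').
  apply: eq_bigr => S _; rewrite -mulr_sumr; congr (_ * _).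
  apply: pr_fin_fibres; [exact: m_unvisited|exact: unvX|exact: m_unvisited].
have pot1 : potential t.+1 = \sum_(S : {set T}) \sum_(S' : {set T}) harmonic_sum #|S'| * pr P (p S S').
  rewrite exchange_big/=; apply: eq_bigr => S' _; rewrite -mulr_sumr; congr (_ * _).
  rewrite (pr_fin_fibres (m_unvisited t.+1 S') (@unvX _ _) (m_unvisited t)).
  by apply: eq_bigr => S _; rewrite /p setIAC.
rewrite pot0 pot1 -sumrB.
apply: (@le_trans _ _ (\sum_(S : {set T}) cK G * th * pr P (X `&` unread t @^-1` [set S]))); last first.
  rewrite -mulr_sumr -(pr_fin_fibres (@cmX _ G) (@subset_refl _ X)).
    by rewrite cPX mulr1.
  by move=> S; exact: m_cyl (cyl_unread t S).
apply: ler_sum => S _; rewrite -sumrB.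
pose q i S' : set (measurableTypeR R) :=
  X `&` unvisited t @^-1` [set S] `&` pre t (W i) `&` unvisited t.+1 @^-1` [set S'].
apply: (@le_trans _ _ (\sum_(S' : {set T}) \sum_(i in S) #|S|%:R^-1 * pr P (q i S'))); last first.
  rewrite exchange_big/=.
  apply: (@le_trans _ _ (\sum_(i in S) #|S|%:R^-1 *
      (cK G * th * pr P (X `&` unread t @^-1` [set S])))).
    apply: ler_sum => i iS; rewrite -mulr_sumr ler_wpM2l ?invr_ge0//.
    rewrite -(pr_fin_fibres (A := X `&` unvisited t @^-1` [set S] `&` pre t (W i))).
    - exact: unvisited_hit.
    - by apply: measurableI => //; exact: m_unvisited.
    - by move=> x [[]].
    - exact: m_unvisited.
  rewrite -mulr_suml sumr_const -[_ *+ _]mulr_natl mulrC.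
  have [->|S0] := eqVneq (#|S|%:R : R) 0.
    by rewrite mul0r mulr0 !mulr_ge0 ?pr_ge0//; lra.
  by rewrite mulfV// mulr1.
apply: ler_sum => S' _.
have [p0|/set0P[x [[Xx tS] tS']]] := eqVneq (p S S') set0.
  rewrite p0 pr0 !mulr0 subr0; apply: sumr_ge0 => i _.
  by rewrite mulr_ge0 ?invr_ge0 ?pr_ge0.
have [<-|SS'] := eqVneq S S'.
  rewrite subrr; apply: sumr_ge0 => i _.
  by rewrite mulr_ge0 ?invr_ge0 ?pr_ge0.
have hit y i : unvisited t y = S -> unvisited t.+1 y = S' -> i \in S -> i \notin S' ->
    W i (iter t F y).
  move=> yS yS'; rewrite -{1}yS -{1}yS' !inE => /asboolP H /asboolP H'.
  apply: contrapT => nW; apply: H' => s; rewrite ltnS leq_eqVlt => /orP[/eqP->//|].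
  exact: H.
have S'S : S' \subset S.
  apply/fintype.subsetP => i; rewrite -tS -tS' !inE => /asboolP H; apply/asboolP => s st.
  by apply: H; exact: ltnW.
have [i iS iS'] : exists2 i, i \in S & i \notin S'.
  by apply/fintype.subsetPn; apply: contra SS' => SS; rewrite finset.eqEsubset SS S'S.
have S'E : S' = S :\ i.
  apply/setP => j; rewrite !inE; have [->|ji] := eqVneq j i; first exact/negbTE.
  rewrite /=; apply/idP/idP => [|jS]; first exact: (fintype.subsetP S'S).
  apply: contraT => jS'; have := W_disjoint (hit x j tS tS' jS jS') (hit x i tS tS' iS iS').
  by move/eqP; rewrite (negPf ji).
have cardS : #|S| = #|S'|.+1 by rewrite S'E (cardsD1 i S) iS.
rewrite -mulrBl cardS harmonic_sumS addrC addKr.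
rewrite (bigD1 i)//= -[leLHS]addr0; apply: lerD; last first.
  by apply: sumr_ge0 => j _; rewrite mulr_ge0 ?invr_ge0 ?pr_ge0.
rewrite ler_wpM2l ?invr_ge0//; apply: pr_le => //.
  by rewrite /q setIAC; apply: measurableI; [exact: mp|exact: mW].
move=> y [[Xy /= yS] /= yS']; do 3 split => //.
exact: hit.
Qed.

Lemma unvisited_ge n :
  harmonic_sum #|T| - cK G * th * n%:R <=
  harmonic_sum #|T| * pr P (X `\` (X `&` unvisited n @^-1` [set (finset.set0 : {set T})])).
Proof.
have mu := m_unvisited.
apply: (@le_trans _ _ (potential n)).
  elim: n => [|n IHn].
    rewrite mulr0 subr0 /potential (bigD1 [set: T]%SET)//= cardsT.
    rewrite (_ : _ `&` _ = X) ?cPX ?mulr1 ?lerDl.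
      by apply: sumr_ge0 => S _; rewrite mulr_ge0 ?harmonic_sum_ge0 ?pr_ge0.
    apply/setIidl => x Xx /=; apply/setP => i; rewrite !inE; apply/asboolP => s.
    by rewrite ltn0.
  by have := potential_step n; rewrite -natr1; lra.
rewrite /potential (bigD1 (finset.set0 : {set T}))//= cards0 /harmonic_sum big_ord0 mul0r add0r.
rewrite -/(harmonic_sum #|T|).
have := pr_fin_fibres (@cmX _ G) (@subset_refl _ X) (mu n).
rewrite (bigD1 (finset.set0 : {set T}))//= => E.
have := pr_split P (@cmX _ G) (mu n finset.set0); rewrite [X `&` (X `&` _)]setIA setIid E.
move=> /addrI <-; rewrite mulr_sumr; apply: ler_sum => S _.
by rewrite ler_wpM2r ?pr_ge0// harmonic_sum_le// max_card.
Qed.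

End Potential.

(** * Covering in the time scale of returns: lower bound *)

Section CoverLower.
Variables (R : realType) (G : coded R).
Local Notation X := (cX G).
Local Notation F := (cF G).
Local Notation P := (cP G).
Local Notation L := (cL G).
Local Notation br := (cbr G).
Local Notation wset := (word_set (cX G) (cF G) (cbr G)).
Local Notation itin := (itinerary (cF G) (cbr G)).
Local Notation pre := (hit_at (cX G) (cF G)).
Variables (a b : nat).
Hypothesis ab : a != b.
Hypothesis full_a : forall y, X y -> exists x, [/\ X x, br x = a & F x = y].
Hypothesis full_b : forall y, X y -> exists x, [/\ X x, br x = b & F x = y].

Lemma X_nonempty : X !=set0.
Proof.
apply/set0P/negP => /eqP X0; have := cPX G; rewrite X0 pr0 => /esym/eqP.
by rewrite oner_eq0.
Qed.

Lemma ab_word w : all [pred c | (c == a) || (c == b)] w -> wset (size w) w !=set0.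
Proof.
elim: w => [_|c w IHw /= /andP[cab /IHw[y [Xy yw]]]].
  by have [x Xx] := X_nonempty; exists x; split.
have [x [Xx xc xy]] : exists x, [/\ X x, br x = c & F x = y].
  by move: cab => /orP[] /eqP ->; [exact: full_a|exact: full_b].
by exists x; split => //; rewrite itinS xc xy yw.
Qed.

(** The words in the letters of two full branches are all realized, so that by the
    quasi-Bernoulli property one more letter costs at most a constant factor. *)
Lemma ab_letter : exists k : R, [/\ 0 < k, k <= 1 / 2 & forall w c,
  all [pred c | (c == a) || (c == b)] (rcons w c) ->
  k * pr P (wset (size w) w) <= pr P (wset (size w).+1 (rcons w c))].
Proof.
have K1 := cK1 G; have K0 : 0 < cK G by lra.
pose pa := pr P (wset 1 [:: a]); pose pb := pr P (wset 1 [:: b]).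
have pa0 : 0 < pa by apply: cpos; apply: (@ab_word [:: a]); rewrite /= eqxx.
have pb0 : 0 < pb by apply: cpos; apply: (@ab_word [:: b]); rewrite /= eqxx orbT.
pose k := Num.min (1 / 2) (Num.min pa pb / cK G).
exists k; split; [by rewrite lt_min !divr_gt0// lt_min pa0|by rewrite ge_min lexx|].
move=> w c abw.
have Wrc : wset (size w) w `&` pre (size w) (wset 1 [:: c]) = wset (size w).+1 (rcons w c).
  apply/seteqP; split => x; rewrite /word_set/= -[(size w).+1]addn1 itinD -cats1.
    by move=> [[Xx ->] [_ [_ ->]]].
  move=> [Xx] /eqP; rewrite eqseq_cat ?size_itin// => /andP[/eqP xw /eqP xc].
  by split; split => //; split => //; apply: X_iter => //; exact: cFX.
have := @cqb_ge _ G (size w) 1 w [:: c]; rewrite Wrc.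
have W0 : wset (size w).+1 (rcons w c) !=set0 by rewrite -(size_rcons w c); exact: ab_word.
move=> /(_ W0) H.
have kc : cK G * k <= pr P (wset 1 [:: c]).
  have : k <= Num.min pa pb / cK G by rewrite ge_min lexx orbT.
  rewrite ler_pdivlMr// mulrC => /le_trans; apply.
  move: abw; rewrite all_rcons/= => /andP[/orP[] /eqP -> _].
    by rewrite ge_min lexx.
  by rewrite ge_min lexx orbT.
rewrite -(ler_pM2l K0); apply: le_trans H.
by rewrite mulrA mulrC ler_wpM2l ?pr_ge0.
Qed.

(** The targets are the words [a a b x b x b ... x b b b ...], with the bits of [s] at the
    odd positions from 3 on.  The block [a a] occurs only at their start, and they end
    with [b], so that no two of them overlap. *)
Definition target_sym (s : seq bool) j : nat :=
  if (j < 2)%N || odd j && nth false s (j - 3)./2 then a else b.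

Definition target s len : seq nat := mkseq (target_sym s) len.

Lemma target_ab s len : all [pred c | (c == a) || (c == b)] (target s len).
Proof.
apply/allP => c /mapP[j _ ->] /=; rewrite /target_sym.
by case: ifP => _; rewrite eqxx ?orbT.
Qed.

Lemma target_br s len x j : wset len (target s len) x -> (j < len)%N ->
  br (iter j F x) = target_sym s j.
Proof. by move=> [Xx xw] jl; rewrite -(nth_itin F br x jl) xw nth_mkseq. Qed.

Lemma target_last s len : (2 * size s + 3 <= len)%N -> target_sym s len.-1 = b.
Proof.
move=> sl; have {sl} : (2 * size s + 2 <= len.-1)%N by lia.
move: len.-1 => {}len sl; rewrite /target_sym ltnNge (leq_trans _ sl) ?leq_addl//=.
case: ifP => // /andP[ol]; rewrite nth_default// geq_half_double -mul2n.
have : (2 * size s + 2 != len)%N by apply: contraTneq ol => <-; rewrite addn2 /= negbK mul2n odd_double.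
lia.
Qed.

Lemma target_no_overlap s s' len len' t t' x :
  (2 * size s + 3 <= len)%N -> (1 < len')%N -> (t < t')%N -> (t' < t + len)%N ->
  wset len (target s len) (iter t F x) -> ~ wset len' (target s' len') (iter t' F x).
Proof.
move=> sl l1 tt tl Wt Wt'; have /negP := ab; apply.
have ba k : (k < 2)%N -> br (iter (t' - t + k) F (iter t F x)) = a.
  move=> k2; rewrite -iterD addnAC subnK; last exact: ltnW.
  rewrite addnC iterD (target_br Wt') /target_sym ?k2//; exact: leq_trans l1.
have k0 : (0 < t' - t < len)%N by rewrite subn_gt0 tt ltn_subLR// ltnW.
move: (t' - t)%N k0 ba => k /andP[k0 kl] ba.
have := ba 0%N isT; rewrite addn0 (target_br Wt)// => ka.
have := ba 1%N isT; rewrite addn1.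
have [kl1|lk1] := ltnP k.+1 len.
  rewrite (target_br Wt)// => ka1; move: ka ka1; rewrite /target_sym.
  move: k0; case: (ltnP k 2) => [|k2 _].
    by case: k {kl kl1 ba} => [|[|]]//= _ _ _ ->.
  rewrite /= ltnNge leqW//=; case: (odd k) => /=; first by move=> _ ->.
  by move=> -> _.
have kE : k = len.-1 by lia.
by move: ka; rewrite kE target_last// => ->.
Qed.

Lemma target_inj n (s s' : n.-tuple bool) len len' x :
  (2 * n + 3 <= len)%N -> (2 * n + 3 <= len')%N ->
  wset len (target s len) x -> wset len' (target s' len') x -> s = s'.
Proof.
move=> sl sl' W W'; apply/val_inj/(@eq_from_nth _ false); rewrite ?size_tuple// => i iN.
have il : (2 * i + 3 < len)%N by lia.
have il' : (2 * i + 3 < len')%N by lia.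
have := target_br W il; rewrite (target_br W' il') /target_sym.
have -> : (2 * i + 3 < 2)%N = false by lia.
have -> : odd (2 * i + 3) by rewrite oddD mul2n odd_double.
have -> : (2 * i + 3 - 3)./2 = i by rewrite addnK mul2n doubleK.
rewrite /=; case: nth; case: nth => // E; have := ab; first by rewrite E eqxx.
by rewrite -E eqxx.
Qed.

Lemma target_rcons s len : target s len.+1 = rcons (target s len) (target_sym s len).
Proof. by rewrite /target /mkseq -addn1 iotaD map_cat cats1. Qed.

(** At the first length where the mass drops below [th], it was above [th] one letter
    before, and a letter costs at most a factor [k]. *)
Lemma target_mass (k th : R) s l0 : 0 < k -> (forall w c,
    all [pred c | (c == a) || (c == b)] (rcons w c) ->
    k * pr P (wset (size w) w) <= pr P (wset (size w).+1 (rcons w c))) ->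
  0 < th -> th < k ^+ l0 -> exists len, [/\ (l0 <= len)%N,
    th < pr P (wset len (target s len)) & pr P (wset len (target s len)) <= th / k].
Proof.
move=> k0 Hk th0 thl.
have step len : k * pr P (wset len (target s len)) <= pr P (wset len.+1 (target s len.+1)).
  rewrite target_rcons; have := Hk (target s len) (target_sym s len).
  by rewrite size_mkseq -target_rcons; apply; exact: target_ab.
have low len : k ^+ len <= pr P (wset len (target s len)).
  elim: len => [|len IHl].
    rewrite expr0 (_ : wset 0 _ = X) ?cPX//.
    by apply/seteqP; split => [x []//|x Xx]; split.
  by rewrite exprS; apply: le_trans (step _); rewrite ler_pM2l.
have [m Hm] := P_word_small G th0.
pose p len := (l0 <= len)%N && (pr P (wset len (target s len)) <= th).
have : exists len, p len.
  exists (m + l0)%N; rewrite /p leq_addl/=; apply: le_trans (Hm (take m (target s (m + l0)))).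
  apply: pr_le; [exact: m_wset|exact: m_wset|move=> x [Xx <-]; split => //].
  by rewrite itinD take_size_cat// size_itin.
move=> /ex_minnP[[|len] /andP[l0l lth] Hmin].
  by move: l0l thl lth (low 0%N); rewrite leqn0 => /eqP ->; lra.
move: l0l; rewrite leq_eqVlt ltnS => /orP[/eqP l0E|l0l].
  by have := low len.+1; rewrite -l0E; rewrite -l0E in lth; lra.
exists len; split => //.
  rewrite ltNge; apply/negP => lth'; have := Hmin len.
  by rewrite /p l0l lth' ltnn => /(_ isT).
by rewrite ler_pdivlMr// mulrC; exact: le_trans (step _) lth.
Qed.

(** The conformal measure of a word dominates its mass, and length dominates both. *)
Lemma word_wide (q d : R) n w : 0 < q ->
  (forall k A, cylindrical X F br k A -> pr P A <= q * pr L A) ->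
  0 < d -> 4 * cA G * q * d < pr P (wset n w) ->
  exists y1 y2, [/\ wset n w y1, wset n w y2 & 2 * d < y2 - y1].
Proof.
move=> q0 Hq d0 Pw; apply: contrapT => H.
have A1 := cA1 G; have A0 : 0 < 4 * cA G * q * d by rewrite !mulr_gt0//; lra.
have [x0 W0] : wset n w !=set0.
  by apply/set0P; apply: contraTneq Pw => ->; rewrite pr0 -leNgt ltW.
have d4 : x0 - 2 * d <= x0 + 2 * d by lra.
have Lw : pr L (wset n w) <= cA G * (x0 + 2 * d - (x0 - 2 * d)).
  apply: le_trans (clen_le G d4); apply: pr_le; first exact: m_wset.
    by apply: measurableI => //; exact: cmX.
  move=> x Wx; split; first exact: wsetX Wx.
  rewrite /= in_itv/=; apply/andP; split; rewrite leNgt; apply/negP => xx; apply: H.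
    by exists x, x0; split => //; lra.
  by exists x0, x; split => //; lra.
have := Hq _ _ (cyl_wset X F br n w); have := ler_wpM2l (ltW q0) Lw; lra.
Qed.

(** Take [2 ^ n0] targets of mass about [th], a multiple of [d], with [n0] of the order of
    [ln (1 / d)]: the initial potential is at least [n0 / 2] and decreases by a multiple of
    [d] at each time.  The factor 4 in [e] makes [k ^ (2 * n0 + 3)], the least mass of a
    target that carries all its bits, larger than [th]. *)
Lemma cover_lower : exists c d0 : R, [/\ 0 < c, 0 < d0 &
  forall d, 0 < d -> d < d0 -> exists n (A : set (measurableTypeR R)),
    [/\ c * d^-1 * ln (1 / d) <= n%:R, measurable A, A `<=` X, 1 / 2 <= pr P A &
      forall x, A x -> exists p, (forall y, `|y - p| <= d -> cY G y) /\
        forall t, (t < n)%N -> d < `|iter t F x - p|]].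
Proof.
have [q q0 Hq] := P_le_L G; have [k [k0 k2 Hk]] := ab_letter.
have K1 := cK1 G; have K0 : 0 < cK G by lra.
have A1 := cA1 G; have A0 : 0 < cA G by lra.
pose g := 4 * cA G * q; have g0 : 0 < g by rewrite !mulr_gt0.
pose lam := - ln k; have klam : k = expR (- lam) by rewrite opprK lnK.
have lam0 : 0 < lam.
  by rewrite oppr_gt0 -ln1 ltr_ln ?posrE//; lra.
pose e := (4 * lam)^-1; have e0 : 0 < e by rewrite invr_gt0 mulr_gt0.
pose c := k * e / (16 * cK G * g); have c0 : 0 < c by rewrite divr_gt0 ?mulr_gt0.
exists c, (Num.min (Num.min 1 (expR (- (2 / e))))
                   (Num.min ((k ^+ 3 / g) ^+ 2) (k / (8 * cK G * g)))).
split => //.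
  by rewrite !lt_min ltr01 expR_gt0 exprn_gt0 ?divr_gt0 ?exprn_gt0 ?mulr_gt0.
move=> d d0; rewrite !lt_min => /andP[/andP[d1 de] /andP[dk dk']].
pose l := ln (1 / d).
have di : 0 < 1 / d by rewrite divr_gt0.
have el : 2 <= e * l.
  rewrite mulrC -ler_pdivrMr// -[leLHS]expRK ler_ln ?posrE ?expR_gt0//.
  by rewrite div1r -[expR _]invrK -expRN lef_pV2 ?posrE ?expR_gt0// ltW.
pose n0 := Num.truncn (e * l).
have n0le : n0%:R <= e * l by rewrite truncn_le; lra.
have n0gt : e * l < n0%:R + 1 by rewrite natr1; exact: truncnS_gt.
have n01 : 1 <= n0%:R :> R by lra.
clearbody n0.
pose th := g * d; have th0 : 0 < th by rewrite mulr_gt0.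
have thl : th < k ^+ (2 * n0 + 3).
  pose eta := expR (- (l / 2)).
  have etaE : eta ^+ 2 = d.
    rewrite expr2 -expRD -opprD -mulrDl -mulr2n -[l *+ 2]mulr_natr mulfK//.
    by rewrite /l div1r lnV ?posrE// opprK lnK.
  have eta0 : 0 < eta by exact: expR_gt0.
  have etak : g * eta < k ^+ 3.
    rewrite mulrC -ltr_pdivlMr//; rewrite -(@ltr_pXn2r _ 2) ?nnegrE ?etaE ?ltW//.
    by rewrite divr_gt0 ?exprn_gt0.
  rewrite exprD; apply: (@lt_le_trans _ _ (eta * k ^+ 3)).
    by rewrite /th -etaE expr2 mulrCA ltr_pM2l.
  rewrite ler_pM2r ?exprn_gt0// klam -expRM_natl ler_expR.
  have : n0%:R * (4 * lam) <= l by rewrite -ler_pdivlMr ?mulr_gt0// mulrC.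
  by rewrite natrM; lra.
have /choice[len Hlen] : forall s : n0.-tuple bool, exists len, [/\ (2 * n0 + 3 <= len)%N,
    th < pr P (wset len (target s len)) & pr P (wset len (target s len)) <= th / k].
  by move=> s; exact: target_mass.
pose z (s : n0.-tuple bool) := target s (len s).
have szl s : (2 * size (tval s) + 3 <= len s)%N.
  by rewrite size_tuple; have [] := Hlen s.
have thk0 : 0 <= th / k by rewrite ltW// divr_gt0.
have len1 s : (1 < len s)%N by apply: leq_trans (szl s); rewrite addn3.
have len0 s : (0 < len s)%N by exact: ltnW.
have Wle s : pr P (wset (len s) (z s)) <= th / k by have [] := Hlen s.
have Wno s s' t t' x : (t < t')%N -> (t' < t + len s)%N ->
    wset (len s) (z s) (iter t F x) -> ~ wset (len s') (z s') (iter t' F x).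
  by move=> tt tl; exact: target_no_overlap.
have Wdis s s' x : wset (len s) (z s) x -> wset (len s') (z s') x -> s = s'.
  by apply: target_inj; have := szl s; have := szl s'; rewrite !size_tuple.
have := unvisited_ge thk0 len0 Wle Wno Wdis.
rewrite card_tuple card_bool; set HM := harmonic_sum R (2 ^ n0) => Hun.
have HMn : n0%:R / 2 <= HM by exact: harmonic_sum_pow2.
clearbody HM.
have HM0 : 0 < HM.
  by apply: lt_le_trans HMn; apply: divr_gt0 => //; exact: lt_le_trans n01.
have thk : 0 < cK G * (th / k) by rewrite mulr_gt0// divr_gt0.
pose n := Num.truncn (HM / (2 * (cK G * (th / k)))).
have nle : n%:R <= HM / (2 * (cK G * (th / k))).
  by rewrite truncn_le; apply: divr_ge0; apply: ltW => //; exact: mulr_gt0.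
have ngt : HM / (2 * (cK G * (th / k))) < n%:R + 1 by rewrite natr1; exact: truncnS_gt.
clearbody n.
pose U := X `&` unvisited G len z n @^-1` [set finset.set0].
have mU : measurable (U : set (measurableTypeR R)) by exact: m_unvisited.
exists n, (X `\` U); split.
- have H1 : n0%:R * k / (4 * (cK G * g)) / d <= HM / (2 * (cK G * (th / k))).
    have -> : HM / (2 * (cK G * (th / k))) = HM * (k / (2 * (cK G * g) * d)).
      by rewrite /th; field; rewrite !gt_eqF.
    have -> : n0%:R * k / (4 * (cK G * g)) / d = n0%:R / 2 * (k / (2 * (cK G * g) * d)).
      by field; rewrite !gt_eqF.
    by rewrite ler_wpM2r// divr_ge0 ?mulr_ge0// ltW.
  have H2 : 2 <= k / (4 * (cK G * g)) / d.
    rewrite ler_pdivlMr//; move: dk'; rewrite ltr_pdivlMr ?mulr_gt0// => dk'.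
    by rewrite ler_pdivlMr ?mulr_gt0//; lra.
  have H3 : e * l / 2 <= n0%:R by lra.
  have -> : c * d^-1 * ln (1 / d) = (e * l / 2) * (k / (4 * (cK G * g)) / d) / 2.
    by rewrite /c -/l; field; rewrite !gt_eqF.
  have := ler_wpM2r (_ : 0 <= k / (4 * (cK G * g)) / d) H3.
  have := ler_wpM2r (_ : 0 <= k / (4 * (cK G * g)) / d) n01.
  have E1 : n0%:R * k / (4 * (cK G * g)) / d = n0%:R * (k / (4 * (cK G * g)) / d).
    by rewrite !mulrA.
  rewrite E1 in H1; move: H1 H2 ngt; set w := _ / d => H1 H2 ngt H4 H5.
  have {}H4 := H4 _; have {}H5 := H5 _.
  have w0 : 0 <= w by lra.
  by move: (H4 w0) (H5 w0); lra.
- by apply: measurableD => //; exact: cmX.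
- by move=> x [].
- rewrite -(ler_pM2l HM0). apply: le_trans (Hun n).
  have w0 : 0 < 2 * (cK G * (th / k)) by exact: mulr_gt0.
  move: nle w0; set w := cK G * (th / k) => nle w0; move: nle; rewrite ler_pdivlMr//.
  by rewrite mulrCA [n%:R * w]mulrC; move: (w * _) => u; lra.
move=> x [Xx nU].
have [s Hs] : exists s, s \in unvisited G len z n x.
  by apply/finset.set0Pn/eqP => E; apply: nU; split.
move: Hs; rewrite inE => /asboolP Hs.
have [y1 [y2 [W1 W2 y12]]] : exists y1 y2, [/\ wset (len s) (z s) y1,
    wset (len s) (z s) y2 & 2 * d < y2 - y1].
  by have [_ + _] := Hlen s; exact: word_wide.
exists ((y1 + y2) / 2); split.
  move=> y; rewrite ler_norml => /andP[yl yr].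
  apply: (@cY_interval _ G y1 y2); [exact: cXY (wsetX W1)|exact: cXY (wsetX W2)|].
  by apply/andP; split; lra.
move=> t tn; rewrite ltNge ler_norml; apply/negP => /andP[yl yr].
apply: (Hs _ tn); apply: (cconv W1 W2); [|lra|lra].
by apply: X_iter => //; exact: cFX.
Qed.

End CoverLower.

(** * Changes of variables along branches *)

Section MeasureTools.
Import HBNNSimple.
Local Open Scope ereal_scope.
Context d (T : measurableType d) (R : realType).
Variables (m nu : {measure set T -> \bar R}) (J : set T) (w : T -> R).
Hypotheses (mJ : measurable J) (mw : measurable_fun J w).
Hypothesis w0 : forall x, J x -> (0 <= w x)%R.
Hypothesis dens : forall A, measurable A -> A `<=` J ->
  m A = \int[nu]_(x in A) (w x)%:E.

Let density_nnsfun (h : {nnsfun T >-> R}) :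
  \int[m]_(x in J) (h x)%:E = \int[nu]_(x in J) ((h x)%:E * (w x)%:E).
Proof.
under [LHS]eq_integral do rewrite fimfunE -fsumEFin//.
rewrite [LHS]ge0_integral_fsum//; last 2 first.
  - by move=> r; exact/measurable_EFinP/measurableT_comp.
  - by move=> n x _; rewrite EFinM nnfun_muleindic_ge0.
under [RHS]eq_integral.
  move=> x xJ; rewrite fimfunE -fsumEFin// ge0_mule_fsuml; last first.
    by move=> r; rewrite EFinM nnfun_muleindic_ge0.
  over.
rewrite [RHS]ge0_integral_fsum//; last 2 first.
  - move=> r; apply: emeasurable_funM; last exact/measurable_EFinP.
    by apply/measurable_EFinP; exact/measurableT_comp.
  - move=> n x Jx; apply: mule_ge0; last by rewrite lee_fin w0.
    by rewrite EFinM nnfun_muleindic_ge0.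
apply: eq_fsbigr => r _.
have mh : measurable (h @^-1` [set r]) by exact: measurable_sfunP.
have [r0|r0] := leP 0%R r; last first.
  rewrite !integral0_eq// => x _; rewrite preimage_nnfun0// indicE in_set0 mulr0//.
  by rewrite mul0e.
rewrite integralZl_indic_nnsfun// integral_indic//.
under [RHS]eq_integral do rewrite EFinM -muleA.
rewrite ge0_integralZl//; last 2 first.
  - apply: emeasurable_funM; last exact/measurable_EFinP.
    by apply/measurable_EFinP; exact/measurable_indic.
  - by move=> x Jx; rewrite mule_ge0// ?lee_fin ?w0.
congr (_ * _); rewrite dens; [|exact: measurableI|by move=> x []].
rewrite setIC integral_mkcondr; apply: eq_integral => x xJ.
rewrite patchE indicE; case: ifPn => [|_]; rewrite ?mul1e ?mul0e//.
Qed.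

(** By approximation with simple functions, for which it is the hypothesis on sets. *)
Lemma integral_density (h : T -> \bar R) : measurable_fun J h ->
  (forall x, J x -> 0 <= h x) ->
  \int[m]_(x in J) h x = \int[nu]_(x in J) (h x * (w x)%:E).
Proof.
move=> mh h0; pose h_ := nnsfun_approx mJ mh.
transitivity (lim (\int[m]_(x in J) (h_ n x)%:E @[n --> \oo])).
  rewrite -monotone_convergence//=.
  - apply: eq_integral => x /[!inE] Jx; apply/esym/cvg_lim => //=.
    exact: cvg_nnsfun_approx.
  - by move=> n; exact/measurable_EFinP/measurable_funTS.
  - by move=> n x _; rewrite lee_fin.
  - by move=> x _ a b ab; rewrite lee_fin; exact/lefP/nd_nnsfun_approx.
transitivity (lim (\int[nu]_(x in J) ((h_ n x)%:E * (w x)%:E) @[n --> \oo])).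
  by apply: congr_lim; apply/funext => n /=; exact: density_nnsfun.
rewrite -monotone_convergence//=.
- apply: eq_integral => x /[!inE] Jx; apply/cvg_lim => //=.
  apply: cvgeZr => //; exact: cvg_nnsfun_approx.
- move=> n; apply: emeasurable_funM; last exact/measurable_EFinP.
  exact/measurable_EFinP/measurable_funTS.
- by move=> n x Jx; rewrite mule_ge0// ?lee_fin ?w0.
- move=> x Jx a b ab; rewrite -!EFinM lee_fin ler_wpM2r ?w0//.
  exact/lefP/nd_nnsfun_approx.
Qed.

End MeasureTools.

Section Branches.
Variable R : realType.
Implicit Types (J T : set R) (f : R -> R).

Definition strict_mono f J : Prop :=
  (forall x y, J x -> J y -> x < y -> f x < f y) \/
  (forall x y, J x -> J y -> x < y -> f y < f x).

Lemma preimage_interval f J T : is_interval J -> strict_mono f J ->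
  is_interval T -> is_interval (J `&` f @^-1` T).
Proof.
move=> iJ fJ iT x z [Jx Tx] [Jz Tz] y /andP[xy yz].
have Jy : J y by apply: (iJ x z) => //; rewrite xy yz.
split => //=; move: xy yz; rewrite le_eqVlt => /orP[/eqP<-//|xy].
rewrite le_eqVlt => /orP[/eqP->//|yz].
by case: fJ => H; [apply: (iT _ _ Tx Tz)|apply: (iT _ _ Tz Tx)];
  rewrite !ltW//; exact: H.
Qed.

Lemma image_interval f J T : {within J, continuous f} -> T `<=` J ->
  is_interval T -> is_interval (f @` T).
Proof.
move=> cf TJ iT; apply/connected_intervalP.
apply: connected_continuous_connected; first exact/connected_intervalP.
exact: continuous_subspaceW cf.
Qed.

End Branches.

Section Systems.
Variables (R : realType) (S : system R).
Local Notation T := (measurableTypeR R).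
Local Notation I := (state_space S).
Local Notation Z := (branches S).
Local Notation f := (dyn S).
Local Notation phi := (pot S).
Local Notation m := (conf_measure S).
Local Notation mu := (inv_measure S).
Local Notation reg := (regular_part S).
Local Notation rep := (repeller S).
Hypothesis cs : conformal_system S.

Let pm : piecewise_monotone S. Proof. by case: cs => [[]]. Qed.

Let conf : conformal S. Proof. by case: cs => [[]]. Qed.

Lemma Z_interval J : Z J -> is_interval J.
Proof. by move=> ZJ; have [_ [/(_ _ ZJ)[[iJ _] _] _ _ _ _]] := pm. Qed.

Lemma Z_sub J : Z J -> J `<=` I.
Proof. by move=> ZJ; have [_ [/(_ _ ZJ)[_ JI] _ _ _ _]] := pm. Qed.

Lemma Z_continuous J : Z J -> {within J, continuous f}.
Proof. by move=> ZJ; have [_ [_ _ /(_ _ ZJ)cJ _ _]] := pm. Qed.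

Lemma Z_mono J : Z J -> strict_mono f J.
Proof. by move=> ZJ; have [_ [_ _ _ /(_ _ ZJ)mJ _]] := pm. Qed.

Lemma Z_image J : Z J -> f @` J `<=` I.
Proof. by move=> ZJ; have [_ [_ _ _ _ /(_ _ ZJ)fJ]] := pm. Qed.

Lemma Z_nd J : Z J -> exists x y, [/\ J x, J y & x < y].
Proof. by move=> ZJ; have [_ [/(_ _ ZJ)[[_ nJ] _] _ _ _ _]] := pm. Qed.

Lemma I_interval : is_interval I.
Proof. by have [[[iI _] _ _] _] := pm. Qed.

Lemma m_interval J : is_interval J -> measurable (J : set T).
Proof. by move=> iJ; exact: is_interval_measurable. Qed.

Lemma Z_index : exists e : nat -> set R,
  [/\ forall n, Z (e n) \/ e n = set0, forall J, Z J -> exists n, e n = J &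
      forall n k, Z (e n) -> e n = e k -> n = k].
Proof.
have [[_ _ cZ] _] := pm; have /countable_injP[g gi] := cZ.
exists (fun n => xget set0 [set J | Z J /\ g J = n]); split.
- by move=> n; case: xgetP => [J _ [ZJ _]|]; [left|right].
- move=> J ZJ; exists (g J); case: xgetP => [K _ [ZK gK]|/(_ J)]; last first.
    by move=> /(_ (conj ZJ erefl)).
  by apply: gi; rewrite ?inE.
- move=> n k; case: xgetP => [J _ [ZJ <-] _|_ Z0]; case: xgetP => [K _ [ZK <-]|_].
  + by move=> ->.
  + by move=> J0; have [x [y []]] := Z_nd ZJ; rewrite J0.
  + by have [x [y []]] := Z_nd Z0.
  + by have [x [y []]] := Z_nd Z0.
Qed.

Lemma reg_bigcup (e : nat -> set R) : (forall n, Z (e n) \/ e n = set0) ->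
  (forall J, Z J -> exists n, e n = J) -> reg = \bigcup_n e n.
Proof.
move=> e1 e2; apply/seteqP; split => [x [J /e2[n <-] Jx]|x [n _ xe]].
  by exists n.
by exists (e n) => //; case: (e1 n) => // e0; rewrite e0 in xe.
Qed.

Lemma m_reg : measurable (reg : set T).
Proof.
have [e [e1 e2 _]] := Z_index; rewrite (reg_bigcup e1 e2).
apply: bigcupT_measurable => n; case: (e1 n) => [Ze|->//].
by apply: m_interval; exact: Z_interval.
Qed.

Lemma m_preimage J (B : set T) : Z J -> measurable B ->
  measurable (J `&` f @^-1` B : set T).
Proof.
move=> ZJ mB; have mJ := m_interval (Z_interval ZJ).
exact: (subspace_continuous_measurable_fun mJ (Z_continuous ZJ) mJ).
Qed.

Lemma m_reg_preimage (B : set T) : measurable B ->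
  measurable (reg `&` f @^-1` B : set T).
Proof.
move=> mB; have [e [e1 e2 _]] := Z_index; rewrite (reg_bigcup e1 e2) setI_bigcupl.
apply: bigcupT_measurable => n; case: (e1 n) => [Ze|->]; last by rewrite set0I.
exact: m_preimage.
Qed.

Lemma reg_sub : reg `<=` I.
Proof. by move=> x [J /Z_sub]; exact. Qed.

Lemma f_reg x : reg x -> I (f x).
Proof. by move=> [J ZJ Jx]; apply: (Z_image ZJ); exists x. Qed.

Lemma rep_reg x : rep x -> reg x.
Proof. by move=> [_ /(_ 0%N)]. Qed.

Lemma f_rep x : rep x -> rep (f x).
Proof.
move=> [Ix rx]; split; first exact/f_reg/(rx 0%N).
by move=> k; rewrite -iterSr; exact: rx.
Qed.

Lemma rep_f x : reg x -> rep (f x) -> rep x.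
Proof.
move=> rx [_ rfx]; split; first exact: reg_sub.
by case => // k; rewrite iterSr; exact: rfx.
Qed.

Lemma m_rep : measurable (rep : set T).
Proof.
pose Rn n := [set x | I x /\ forall k, (k < n)%N -> reg (iter k f x)].
have -> : rep = \bigcap_n Rn n.
  apply/seteqP; split => [x [Ix rx] n _|x Rx]; first by split.
  by split => [|k]; [have [] := Rx 0%N Logic.I|have [_ /(_ k (ltnSn k))] := Rx k.+1 Logic.I].
apply: bigcapT_measurable => n; elim: n => [|n IHn].
  rewrite (_ : Rn 0%N = I); first exact: m_interval I_interval.
  by apply/seteqP; split => [x []//|x Ix]; split.
rewrite (_ : Rn n.+1 = reg `&` f @^-1` (Rn n)); first exact: m_reg_preimage.
apply/seteqP; split => [x [Ix rx]|x [rx [Ifx rfx]]].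
  split; first exact: (rx 0%N).
  split; first exact/f_reg/(rx 0%N).
  by move=> k kn; rewrite -iterSr; exact: rx.
split; first exact: reg_sub.
by case => // k kn; rewrite iterSr; exact: rfx.
Qed.

(** On each branch the measure of the preimage is the integral of a density with respect
    to the pullback of [m], which vanishes there. *)
Lemma null_preimage (N : set T) : measurable N -> m N = 0%E ->
  m (reg `&` f @^-1` N) = 0%E.
Proof.
move=> mN N0; have [e [e1 e2 _]] := Z_index.
have mJ n : measurable (e n `&` f @^-1` N : set T).
  by case: (e1 n) => [Ze|->]; [exact: m_preimage|rewrite set0I].
rewrite (reg_bigcup e1 e2) setI_bigcupl; apply/eqP; rewrite eq_le measure_ge0 andbT.
apply: le_trans (measure_sigma_subadditive m mJ (bigcupT_measurable _ mJ) (@subset_refl _ _)) _.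
rewrite eseries0// => n _ _ /=.
have [Ze|->] := e1 n; last by rewrite set0I measure0.
have [_ [nu [nuE mE]]] := conf Ze.
have fN : f @` (e n `&` f @^-1` N `&` e n) = f @` e n `&` N.
  apply/seteqP; split => [_ [x [[ex Nx] _] <-]|_ [[x ex <-] Nx]]; last by exists x.
  by split => //; exists x.
have nu0 : nu (e n `&` f @^-1` N) = 0%E.
  rewrite nuE// fN; apply/eqP; rewrite eq_le measure_ge0 andbT -N0.
  have ifJ := image_interval (Z_continuous Ze) (@subset_refl _ (e n)) (Z_interval Ze).
  by apply: le_measure; rewrite ?inE//; apply: measurableI => //; exact: m_interval.
have := mE _ (mJ n); rewrite -setIA [f @^-1` N `&` _]setIC setIA setIid => ->.
have mphi : measurable_fun (e n : set T) phi by have [] := conf Ze.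
rewrite null_set_integral//; apply/measurable_EFinP/measurableT_comp => //.
by apply: measurable_funS mphi; [exact: m_interval (Z_interval Ze)|move=> x []].
Qed.

Lemma m_rep1 : pr m rep = 1.
Proof.
have [[_ mI ms _] _] := cs; have mrep := m_rep.
pose bad := fix bad n := if n is n'.+1 then reg `&` f @^-1` (bad n') else I `\` reg.
have mbad n : measurable (bad n : set T).
  elim: n => [|n IHn] /=; last exact: m_reg_preimage.
  by apply: measurableD; [exact: m_interval I_interval|exact: m_reg].
have bad0 n : m (bad n) = 0%E.
  by elim: n => [|n IHn] /=; [exact: ms|exact: null_preimage].
have Ibad : I `\` rep `<=` \bigcup_n bad n.
  move=> x [Ix nrx]; apply: contrapT => nbad; apply: nrx; split => // k.
  have {}nbad n : ~ bad n x by move=> bx; apply: nbad; exists n.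
  elim: k x Ix nbad => [|k IHk] x Ix nbad.
    by apply: contrapT => nrx; exact: (nbad 0%N).
  have rx : reg x by apply: contrapT => nrx; exact: (nbad 0%N).
  rewrite iterSr; apply: IHk; first exact: f_reg.
  by move=> n bx; apply: (nbad n.+1).
have mIr : measurable (I `\` rep : set T).
  by apply: measurableD => //; exact: m_interval I_interval.
have Ir0 : m (I `\` rep) = 0%E.
  apply/eqP; rewrite eq_le measure_ge0 andbT.
  apply: le_trans (measure_sigma_subadditive m mbad mIr Ibad) _.
  by rewrite eseries0// => n _ _; exact: bad0.
have := pr_split m (m_interval I_interval) mrep.
rewrite {1}/pr mI /= {2}/pr Ir0 /= addr0 setIidr; last by move=> x [].
by move=> <-.
Qed.

Lemma mu_rep1 : pr mu rep = 1.
Proof.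
have [_ [_ dom]] := cs; have mrep := m_rep.
have mC : measurable (~` rep : set T) by exact: measurableC.
have m0 : m (~` rep) = 0%E.
  by rewrite probability_setC// -prE// m_rep1 subee.
have := (null_content_dominatesP _ _).1 dom _ mC m0.
rewrite probability_setC// -prE// => /eqP; rewrite -EFinB eqe subr_eq0 => /eqP ->//.
Qed.

Lemma m_f_rep : measurable_fun (rep : set T) (f : T -> T).
Proof.
move=> _ B mB; rewrite (_ : _ `&` _ = rep `&` (reg `&` f @^-1` B)).
  by apply: measurableI; [exact: m_rep|exact: m_reg_preimage].
by rewrite setIA (setIidl rep_reg).
Qed.

Lemma iter_rep n x : rep x -> rep (iter n f x).
Proof. by move=> rx; elim: n => //= n; exact: f_rep. Qed.

Lemma m_iter_rep n : measurable_fun (rep : set T) (iter n f : T -> T).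
Proof.
elim: n => [|n IHn]; first exact: measurable_id.
apply: (measurable_comp m_rep _ m_f_rep IHn) => _ [x rx <-]; exact: iter_rep.
Qed.

Lemma m_phi_rep : measurable_fun (rep : set T) phi.
Proof.
move=> _ B mB; have [e [e1 e2 _]] := Z_index.
rewrite (_ : _ `&` _ = rep `&` \bigcup_n (e n `&` phi @^-1` B)).
  apply: measurableI; first exact: m_rep.
  apply: bigcupT_measurable => n; case: (e1 n) => [Ze|->]; last by rewrite set0I.
  have [mphi _] := conf Ze; apply: mphi => //; exact: m_interval (Z_interval Ze).
apply/seteqP; split => [x [rx Bx]|x [rx [n _ []]]]; last by [].
split => //; have := rep_reg rx; rewrite (reg_bigcup e1 e2) => -[n _ ex].
by exists n.
Qed.

Lemma m_birkhoff n : measurable_fun (rep : set T) (birkhoff S n).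
Proof.
apply: measurable_sum => k.
apply: (measurable_comp m_rep _ m_phi_rep (m_iter_rep k)) => _ [x rx <-].
exact: iter_rep.
Qed.

Lemma birkhoffS n x : birkhoff S n.+1 x = phi x + birkhoff S n (f x).
Proof.
rewrite /birkhoff big_ord_recl; congr (_ + _).
by apply: eq_bigr => i _; rewrite iterSr.
Qed.

Lemma I_bounded : exists M : R, forall x, I x -> `|x| <= M.
Proof.
have [[_ [M [_ HM]] _] _] := pm; exists (M + 1) => x Ix.
by apply: HM => //; rewrite ltrDl.
Qed.

(** Conformality says that [m] has density [expR phi] with respect to the pullback of [m]
    by the branch; the formula is the image-measure formula for this pullback, divided
    by the density. *)
Lemma one_step J A (g : R -> \bar R) : Z J -> is_interval A -> A `<=` J ->
  measurable_fun (rep : set T) g -> (forall x, rep x -> (0 <= g x)%E) ->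
  (\int[m]_(y in (f @` A `&` rep : set T)) g y =
   \int[m]_(x in (A `&` rep : set T)) (g (f x) * (expR (- phi x))%:E))%E.
Proof.
move=> ZJ iA AJ mg g0; have mrep := m_rep.
have mA := m_interval iA.
have mfA := m_interval (image_interval (Z_continuous ZJ) AJ iA).
pose E : set T := A `&` rep; pose E' : set T := f @` A `&` rep.
have mE : measurable E by exact: measurableI.
have mE' : measurable E' by exact: measurableI.
have [M HM] := I_bounded.
(* The branch is extended to a measurable function on the whole line that takes a value
   outside of [I] off the set [E]. *)
pose h : T -> T := fun x => if x \in E then f x else M + 1.
have hE x : E x -> h x = f x by move=> Ex; rewrite /h mem_set.
have fE x : E x -> E' (f x).
  by move=> [Ax rx]; split; [exists x|exact: f_rep].
have hE' : h @^-1` E' = E.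
  apply/seteqP; split => [x|x Ex]; last by rewrite /= hE//; exact: fE.
  rewrite /= /h; case: ifPn => [/set_mem//|_ [_ [/HM + _]]].
  by rewrite leNgt (lt_le_trans _ (ler_norm _))// ltrDl.
have mfE B : measurable (B : set T) -> measurable (E `&` f @^-1` B : set T).
  move=> mB; rewrite /E -setIA; apply: measurableI => //.
  exact: m_f_rep.
have mh : measurable_fun setT h.
  move=> _ B mB; rewrite setTI.
  rewrite (_ : h @^-1` B = (E `&` f @^-1` B) `|` (~` E `&` (fun=> M + 1) @^-1` B)).
    apply: measurableU; first exact: mfE.
    apply: measurableI; first exact: measurableC.
    by have := @measurable_cst _ _ T T setT (M + 1) measurableT B mB; rewrite setTI.
  apply/seteqP; split => x /=; rewrite /h; case: ifPn => [/set_mem Ex|/negP xE].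
  - by left.
  - by right; split => // Ex; apply: xE; exact/mem_set.
  - by case=> [[]|[]].
  - by case=> [[Ex]|[]//]; case: xE; exact/mem_set.
have [mphi [nu [nuE mnu]]] := conf ZJ.
have nu_img B : measurable (B : set T) -> B `<=` E' -> nu (h @^-1` B `&` E) = m B.
  move=> mB BE; have hBE : h @^-1` B `&` E = E `&` f @^-1` B.
    rewrite setIC; apply/seteqP; split => x [Ex /=]; rewrite hE//.
  rewrite hBE nuE; last exact: mfE.
  congr (m _); apply/seteqP; split => [_ [x [[Ex Bx] _] <-]//|y By].
  have [[x Ax xy] ry] := BE _ By.
  have rx : rep x by apply: rep_f; [exists J => //; exact: AJ|rewrite xy].
  by exists x => //; split; [split => //=; rewrite xy|exact: AJ].
transitivity (\int[pushforward (mrestr nu mE) h]_(y in E') g y)%E.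
  by apply: eq_measure_integral => B mB BE; exact/esym/nu_img.
have EX : E' `<=` rep by move=> y [].
rewrite ge0_integral_pushforward//; last 2 first.
- exact: measurable_funS mg.
- by move=> y /set_mem [_ /g0].
rewrite hE'.
transitivity (\int[nu]_(x in E) (g \o h) x)%E.
  apply: eq_measure_integral => B mB BE.
  have nuB : nu B = nu (B `&` E) by rewrite (setIidl BE).
  exact: (esym nuB).
have mgf : measurable_fun E (g \o f : T -> \bar R).
  apply: (measurable_comp mrep) => //; first by move=> _ [x [_ /f_rep rx] <-].
  by apply: measurable_funS m_f_rep => // x [].
have mphiE : measurable_fun E phi by apply: measurable_funS m_phi_rep => // x [].
rewrite [RHS](@integral_density _ _ _ m nu E (fun x => expR (phi x))) //.
- apply: eq_integral => x /set_mem Ex; rewrite /= hE// -muleA -EFinM -expRD.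
  by rewrite addNr expR0 mule1.
- by apply: measurableT_comp.
- move=> B mB BE; have BJ : B `&` J = B by apply: setIidl => x /BE[/AJ].
  by have := mnu B mB; rewrite BJ.
- apply: emeasurable_funM => //; apply/measurable_EFinP.
  by apply: measurableT_comp => //; exact: measurableT_comp.
- by move=> x [_ /f_rep /g0 gx]; rewrite mule_ge0// lee_fin expR_ge0.
Qed.

Lemma iter_interval (ws : seq (set R)) A : branch_word S ws ->
  A `<=` branch_domain S ws -> is_interval A -> is_interval (iter (size ws) f @` A).
Proof.
elim: ws A => [A _ _ iA|J ws IHws A bw Aw iA] /=; first by rewrite image_id.
have ZJ : Z J by exact: (bw 0%N).
have AJ : A `<=` J by move=> x /Aw[_ /(_ 0%N isT)].
have -> : iter (size ws).+1 f @` A = iter (size ws) f @` (f @` A).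
  by rewrite image_comp; apply: eq_imagel => x _ /=; rewrite -iterS iterSr.
apply: IHws; first by move=> k; exact: (bw k.+1).
  move=> _ [x Ax <-]; split; first by apply: (Z_image ZJ); exists x => //; exact: AJ.
  by move=> k kw; rewrite -iterSr; have [_ /(_ k.+1 kw)] := Aw _ Ax.
exact: image_interval (Z_continuous ZJ) AJ iA.
Qed.

Lemma branch_domain_interval (ws : seq (set R)) : branch_word S ws ->
  is_interval (branch_domain S ws).
Proof.
elim: ws => [_|J ws IHws bw].
  rewrite (_ : branch_domain S [::] = I); first exact: I_interval.
  by apply/seteqP; split => [x []//|x Ix]; split.
have ZJ : Z J by exact: (bw 0%N).
rewrite (_ : branch_domain S (J :: ws) = J `&` f @^-1` branch_domain S ws).
  apply: preimage_interval; [exact: Z_interval|exact: Z_mono|apply: IHws].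
  by move=> k; exact: (bw k.+1).
apply/seteqP; split => [x [Ix xw]|x [Jx [Ifx fxw]]].
  have Jx := xw 0%N isT; split => //; split.
    by apply: (Z_image ZJ); exists x.
  by move=> k kw; rewrite -iterSr; exact: (xw k.+1).
split; first exact: Z_sub Jx.
by case => // k kw; rewrite iterSr; exact: fxw.
Qed.

(** One branch at a time, by the cocycle identity of Birkhoff sums. *)
Lemma word_step (ws : seq (set R)) A (g : R -> \bar R) : branch_word S ws ->
  is_interval A -> A `<=` branch_domain S ws ->
  measurable_fun (rep : set T) g -> (forall x, rep x -> (0 <= g x)%E) ->
  (\int[m]_(y in (iter (size ws) f @` A `&` rep : set T)) g y =
   \int[m]_(x in (A `&` rep : set T))
     (g (iter (size ws) f x) * (expR (- birkhoff S (size ws) x))%:E))%E.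
Proof.
elim: ws A => [A _ _ _ mg g0|J ws IHws A bw iA Aw mg g0] /=.
  rewrite image_id; apply: eq_integral => x _.
  by rewrite /birkhoff big_ord0 oppr0 expR0 mule1.
have ZJ : Z J by exact: (bw 0%N).
have AJ : A `<=` J by move=> x /Aw[_ /(_ 0%N isT)].
have -> : (fun x => f (iter (size ws) f x)) @` A = iter (size ws) f @` (f @` A).
  by rewrite image_comp; apply: eq_imagel => x _ /=; rewrite -iterS iterSr.
have bw' : branch_word S ws by move=> k; exact: (bw k.+1).
have ifA : is_interval (f @` A) := image_interval (Z_continuous ZJ) AJ iA.
have fAw : f @` A `<=` branch_domain S ws.
  move=> _ [x Ax <-]; split; first by apply: (Z_image ZJ); exists x => //; exact: AJ.
  by move=> k kw; rewrite -iterSr; have [_ /(_ k.+1 kw)] := Aw _ Ax.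
rewrite (IHws _ bw' ifA fAw mg g0).
rewrite (one_step ZJ iA AJ); last 2 first.
- apply: emeasurable_funM.
    apply: (measurable_comp m_rep _ mg (m_iter_rep _)) => _ [x rx <-].
    exact: iter_rep.
  apply/measurable_EFinP; apply: measurableT_comp => //.
  by apply: measurableT_comp => //; exact: m_birkhoff.
- by move=> x rx; rewrite mule_ge0 ?lee_fin ?expR_ge0// g0//; exact: iter_rep.
apply: eq_integral => x _; rewrite -iterS iterSr birkhoffS -muleA -EFinM -expRD.
by rewrite opprD addrC.
Qed.

End Systems.

(** * From a conformal system to its coding *)

Section CodedSystem.
Variables (R : realType) (S : system R).
Local Notation T := (measurableTypeR R).
Local Notation I := (state_space S).
Local Notation Z := (branches S).
Local Notation f := (dyn S).
Local Notation m := (conf_measure S).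
Local Notation mu := (inv_measure S).
Local Notation rep := (repeller S).
Hypothesis cs : conformal_system S.

(** Bounds for the Jacobian of the iterate on [A] turn the change of variables into a
    comparison of measures. *)
Lemma iter_expansion (ws : seq (set R)) A (c1 c2 : R) (B : set T) : branch_word S ws ->
  is_interval A -> A `<=` branch_domain S ws -> 0 <= c1 ->
  (forall x, A x -> rep x -> c1 <= expR (- birkhoff S (size ws) x) <= c2) ->
  measurable B ->
  c1 * pr m (A `&` rep `&` iter (size ws) f @^-1` B) <=
    pr m (B `&` (iter (size ws) f @` A `&` rep)) <=
  c2 * pr m (A `&` rep `&` iter (size ws) f @^-1` B).
Proof.
move=> bw iA Aw c10 Hc mB; set n := size ws in Hc *.
have mrep := m_rep cs; have mA := m_interval iA.
have mfA := m_interval (iter_interval cs bw Aw iA).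
pose W : set T := A `&` rep.
have mW : measurable W by exact: measurableI.
have mWB : measurable (W `&` iter n f @^-1` B : set T).
  rewrite /W -setIA; apply: measurableI => //.
  by have := m_iter_rep cs n mrep mB.
have E : (m (B `&` (iter n f @` A `&` rep)) =
    \int[m]_(x in W) ((\1_B (iter n f x))%:E * (expR (- birkhoff S n x))%:E))%E.
  rewrite -(word_step cs (g := fun y => (\1_B y)%:E) bw iA Aw).
  - by rewrite integral_indic//; exact: measurableI.
  - by apply/measurable_EFinP; exact: measurable_indic.
  - by move=> x _; rewrite lee_fin.
have Wr : W `<=` rep by move=> x [].
have m1 : measurable_fun W (fun x => (\1_B (iter n f x))%:E : \bar R).
  apply/measurable_EFinP; apply: (measurable_comp (F := setT)) => //.
  by apply: measurable_funS (m_iter_rep cs n).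
have m2 : measurable_fun W (fun x => (expR (- birkhoff S n x))%:E : \bar R).
  apply/measurable_EFinP; apply: measurableT_comp => //; apply: measurableT_comp => //.
  by apply: measurable_funS (m_birkhoff cs n).
have Ec c : 0 <= c -> (c%:E * m (W `&` iter n f @^-1` B) =
    \int[m]_(x in W) (c%:E * (\1_B (iter n f x))%:E))%E.
  move=> c0; rewrite ge0_integralZl//.
  congr (_ * _)%E; rewrite -[LHS]mul1e -[1%E]/(1%R%:E) -integral_cst//.
  rewrite integral_mkcondr; apply: eq_integral => x _; rewrite patchE indicE.
  case: ifPn => [/set_mem Bx|/negP Bx]; first by rewrite mem_set.
  by rewrite memNset// => Bx'; apply: Bx; exact/mem_set.
have c20 : 0 <= c2 \/ W = set0.
  have [W0|/set0P[x [Ax rx]]] := eqVneq W set0; first by right.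
  by left; have /andP[_] := Hc _ Ax rx; exact: le_trans (expR_ge0 _).
rewrite -!lee_fin !EFinM !prE//; last first.
  by apply: measurableI => //; exact: measurableI.
rewrite -/W E; apply/andP; split.
  rewrite Ec//; apply: ge0_le_integral => //.
  - by move=> x _; rewrite mule_ge0 ?lee_fin.
  - by apply: emeasurable_funM.
  - by apply: emeasurable_funM.
  - move=> x [Ax rx]; rewrite muleC lee_wpmul2l ?lee_fin//.
    by have /andP[] := Hc _ Ax rx.
case: c20 => [c20|->]; last first.
  by rewrite integral_set0 set0I measure0 mule0.
rewrite Ec//; apply: ge0_le_integral => //.
- by apply: emeasurable_funM.
- by apply: emeasurable_funM.
- move=> x [Ax rx]; rewrite muleC lee_wpmul2r ?lee_fin//.
  by have /andP[] := Hc _ Ax rx.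
Qed.

Lemma rep_iter n x : I x -> (forall k, (k < n)%N -> regular_part S (iter k f x)) ->
  rep (iter n f x) -> rep x.
Proof.
elim: n x => // n IHn x Ix rx; rewrite iterSr => rfx.
have r0 := rx 0%N isT; apply: rep_f => //; apply: IHn => //; first exact: f_reg cs _ r0.
by move=> k kn; rewrite -iterSr; exact: rx.
Qed.

Hypothesis disj : forall J K x, Z J -> Z K -> J x -> K x -> J = K.
Variable Cd : R.
Hypothesis dist : bounded_distortion_pot S Cd.
Variable n1 : nat.
Hypothesis contr : (((2 * n1 + 5)%:R * (Cd + 1))%:E * exp_sup S n1 < 1)%E.
Hypothesis qb : quasi_bernoulli S.
Hypothesis psi : psi_mixing S.
Variable a : R.
Hypothesis a1 : 1 <= a.
Hypothesis len_ge : forall x y, I x -> I y -> x < y -> y - x <= a * pr m `]x, y[%classic.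
Hypothesis len_le : forall x y, x <= y -> pr m `[x, y]%classic <= a * (y - x).

Variable e : nat -> set R.
Hypothesis e1 : forall n, Z (e n) \/ e n = set0.
Hypothesis e2 : forall J, Z J -> exists n, e n = J.
Hypothesis e3 : forall n k, Z (e n) -> e n = e k -> n = k.

Definition label (x : R) : nat := xget 0%N [set n | e n x].

Lemma label_mem x : rep x -> e (label x) x.
Proof.
move=> /rep_reg[J /e2[n <-] Jx]; rewrite /label; case: xgetP => // /(_ n).
by move=> /(_ Jx).
Qed.

Lemma e_Z n x : e n x -> Z (e n).
Proof. by case: (e1 n) => // ->. Qed.

Lemma label_uniq n x : e n x -> label x = n.
Proof.
move=> enx; rewrite /label; case: xgetP => [k _ ekx|/(_ n)]; last by move=> /(_ enx).
by apply: e3; [exact: e_Z ekx|exact: (disj (e_Z ekx) (e_Z enx) ekx enx)].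
Qed.

Local Notation wset := (word_set rep f label).
Local Notation dom w := (branch_domain S [seq e n | n <- w]).

Lemma wset_size n w : wset n w !=set0 -> size w = n.
Proof. by move=> [x [_ <-]]; rewrite size_itin. Qed.

Lemma wsetE w : wset (size w) w = dom w `&` rep.
Proof.
apply/seteqP; split => [x [rx xw]|x [[Ix wx] rx]].
  split => //; split => [|k]; first by case: rx.
  rewrite size_map => kw; rewrite (nth_map 0%N)// -[in nth 0%N _]xw nth_itin//.
  by apply: label_mem; exact: iter_rep.
split => //; apply: (@eq_from_nth _ 0%N); rewrite ?size_itin// => k kw.
rewrite nth_itin//; apply: label_uniq; have := wx k; rewrite size_map => /(_ kw).
by rewrite (nth_map 0%N).
Qed.

Lemma wset_branch n w : wset n w !=set0 -> branch_word S [seq e n | n <- w].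
Proof.
move=> W0; have sw := wset_size W0; move: W0; rewrite -sw wsetE => -[x [[Ix wx] rx]].
move=> k; rewrite size_map => kw; have := wx k; rewrite size_map => /(_ kw).
by rewrite (nth_map 0%N)// => /e_Z.
Qed.

Lemma img_wsetE w : branch_word S [seq e n | n <- w] ->
  iter (size w) f @` wset (size w) w = iter (size w) f @` dom w `&` rep.
Proof.
move=> bw; rewrite wsetE; apply/seteqP; split => [_ [x [wx rx] <-]|_ [[x wx <-] rx]].
  by split; [exists x|exact: iter_rep].
exists x => //; split => //; have [Ix wk] := wx; apply: (@rep_iter (size w)) => // k kw.
by exists (nth set0 [seq e n | n <- w] k); [apply: bw|apply: wk]; rewrite size_map.
Qed.

Lemma wset_cat n k v w : size v = n ->
  wset n v `&` hit_at rep f n (wset k w) = wset (n + k) (v ++ w).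
Proof.
move=> vn; apply/seteqP; split => x; rewrite /word_set/= itinD.
  by move=> [[rx ->] [_ [_ ->]]].
move=> [rx] /eqP; rewrite eqseq_cat ?size_itin// => /andP[/eqP xv /eqP xw].
by split; split => //; split => //; exact: iter_rep.
Qed.

Lemma coding_measure_cyl w :
  coding_measure S (Defs.cyl S [seq e n | n <- w]) = pr mu (wset (size w) w).
Proof.
rewrite /coding_measure; congr (fine (mu _)).
rewrite wsetE; apply/seteqP; split => [x [i [_ iw] [rx ix]]|x [[Ix wx] rx]].
  split => //; split => [|k kw]; first by case: rx.
  by rewrite -iw//; have [] := ix k.
have cod : coded_by S (fun k => e (label (iter k f x))) x.
  split => // k; have ek := label_mem (iter_rep cs k rx).
  by split => //; exact: e_Z ek.
exists (fun k => e (label (iter k f x))) => //; split; first by exists x.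
move=> k kw; have := wx k kw; move: kw; rewrite size_map => kw.
by rewrite (nth_map 0%N)// => /label_uniq ->.
Qed.

Lemma words_wset w : wset (size w) w !=set0 -> words S [seq e n | n <- w].
Proof.
rewrite wsetE => -[x [[Ix wx] rx]].
exists (fun k => e (label (iter k f x))); split.
  exists x; split => // k; have ek := label_mem (iter_rep cs k rx).
  by split => //; exact: e_Z ek.
move=> k kw; have := wx k kw; move: kw; rewrite size_map => kw.
by rewrite (nth_map 0%N)// => /label_uniq ->.
Qed.

Lemma coding_measure_mix n k j v w : size v = n -> size w = k ->
  coding_measure S (\bigcup_(y in [set y | size y = j /\
      words S ([seq e n | n <- v] ++ y ++ [seq e n | n <- w])])
    Defs.cyl S ([seq e n | n <- v] ++ y ++ [seq e n | n <- w])) =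
  pr mu (wset n v `&` hit_at rep f (n + j) (wset k w)).
Proof.
move=> vn wk; rewrite /coding_measure; congr (fine (mu _)).
apply/seteqP; split => [x [i [y [yj _] [Si iw]] [rx ix]]|x [[rx xv] [_ [_ xw]]]].
  have ilab l : label (iter l f x) = label (iter l f x) by [].
  have symb l : (l < size ([seq e n | n <- v] ++ y ++ [seq e n | n <- w]))%N ->
      (nth set0 ([seq e n | n <- v] ++ y ++ [seq e n | n <- w]) l) (iter l f x).
    by move=> lw; rewrite -iw//; have [] := ix l.
  rewrite !size_cat !size_map in symb; split; [split => //|split => //; split].
  - apply: (@eq_from_nth _ 0%N); rewrite ?size_itin// => l ln.
    rewrite nth_itin//; apply: label_uniq.
    have := symb l; rewrite nth_cat size_map vn ln (nth_map 0%N) ?vn//.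
    by apply; rewrite (leq_trans ln)// leq_addr.
  - exact: iter_rep.
  - apply: (@eq_from_nth _ 0%N); rewrite ?size_itin// => l lk.
    rewrite nth_itin// -iterD addnC -addnA; apply: label_uniq.
    have E : nth set0 ([seq e n | n <- v] ++ y ++ [seq e n | n <- w]) (n + (j + l)) =
        e (nth 0%N w l).
      rewrite nth_cat size_map vn ltnNge leq_addr/= addKn nth_cat yj ltnNge leq_addr/=.
      by rewrite addKn (nth_map 0%N) ?wk.
    have := symb (n + (j + l))%N; rewrite E; apply.
    by rewrite vn yj wk !ltn_add2l.
have cod : coded_by S (fun k => e (label (iter k f x))) x.
  split => // l; have el := label_mem (iter_rep cs l rx).
  by split => //; exact: e_Z el.
have xE : itinerary f label (n + j + k) x = v ++ itinerary f label j (iter n f x) ++ w.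
  by rewrite -addnA itinD xv itinD -iterD addnC -xw.
pose u := itinerary f label j (iter n f x).
have wsx : wset (size (v ++ u ++ w)) (v ++ u ++ w) x.
  by split => //; rewrite !size_cat vn size_itin wk addnA xE.
have mapE : [seq e n | n <- v] ++ [seq e n | n <- u] ++ [seq e n | n <- w] =
    [seq e n | n <- v ++ u ++ w] by rewrite !map_cat.
exists (fun k => e (label (iter k f x))) => //.
exists [seq e n | n <- u].
  by split; [rewrite size_map size_itin|rewrite mapE; apply: words_wset; exists x].
rewrite mapE; split; first by exists x.
move=> l lw; move: wsx; rewrite wsetE => -[[_ /(_ _ lw) + _]]; move: lw; rewrite size_map => lw.
by rewrite (nth_map 0%N)// => /label_uniq ->.
Qed.

(** Two points with the same itinerary visit the same branches, and the interval is
    bounded. *)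
Lemma birkhoff_distortion : exists2 D : R, 1 <= D & forall n w x y,
  wset n w x -> wset n w y ->
  expR (- birkhoff S n x) / D <= expR (- birkhoff S n y) <= expR (- birkhoff S n x) * D.
Proof.
have [Cd0 HCd] := dist; have [M HM] := I_bounded cs.
pose D := 1 + Cd * (2 * `|M|).
have D1 : 1 <= D by rewrite lerDl !mulr_ge0// ltW.
exists D => // n w x y Wx Wy.
have [rx xw] := Wx; have [ry yw] := Wy.
have key u v : wset n w u -> wset n w v ->
    expR (- birkhoff S n v) <= expR (- birkhoff S n u) * D.
  move=> [ru uw] [rv vw].
  have same : same_branches S n u v.
    move=> k kn; exists (e (label (iter k f u))).
    have eu := label_mem (iter_rep cs k ru); split => //; first exact: e_Z eu.
    rewrite -(nth_itin f label u kn) uw -vw nth_itin//.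
    exact/label_mem/iter_rep.
  have := HCd n u v ru rv same.
  have uv : `|iter n f u - iter n f v| <= 2 * `|M|.
    have [Iu _] := iter_rep cs n ru; have [Iv _] := iter_rep cs n rv.
    apply: le_trans (ler_normB _ _) _; have := HM _ Iu; have := HM _ Iv.
    by have := ler_norm M; lra.
  move=> /le_trans/(_ (ler_wpM2l (ltW Cd0) uv)) => /ler_normlW H.
  have -> : - birkhoff S n v = - birkhoff S n u + (birkhoff S n u - birkhoff S n v) by ring.
  by rewrite expRD ler_wpM2l ?expR_ge0// /D; lra.
rewrite (key x y)// andbT ler_pdivrMr; last by lra.
exact: key.
Qed.

Lemma pr_rep_itv (A : set T) : measurable A -> pr m (rep `&` A) = pr m A.
Proof.
move=> mA; have mrep := m_rep cs; have r1 := m_rep1 cs.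
have := pr_split m measurableT mrep; rewrite setTI r1.
have := pr_split m mA mrep; rewrite [A `&` rep]setIC.
have : pr m (A `\` rep) <= pr m (setT `\` rep).
  by apply: pr_le; [exact: measurableD|exact: measurableD|exact: setSD].
have : pr m setT = 1 by rewrite /pr probability_setT.
by have := pr_ge0 m (A `\` rep); lra.
Qed.

(** Distortion of the measure follows from that of Birkhoff sums by [iter_expansion], and
    so does the contraction rate: the assumption on [n1] makes every Birkhoff sum of length
    [n1] smaller than [- ln 2].  Words have positive measure because of mixing: the ratio
    in the mixing condition would be zero for a null word, not close to one. *)
Lemma exists_coded : exists G : coded R,
  [/\ cY G = I, cX G = rep, cF G = f, cP G = mu & cbr G = label].
Proof.
have mrep := m_rep cs; have frep := @f_rep _ _ cs.
have [D D1 HD] := birkhoff_distortion.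
have D0 : 0 < D by exact: lt_le_trans D1.
have [C C1 HC] := qb; have C0 : 0 < C by exact: lt_trans C1.
have [gam gam0 Hgam] := psi.
have [j Hj] : exists j, gam j < 1 / 2.
  have : \forall j \near \oo, gam j < 1 / 2 by apply: (cvgr_lt 0) => //; lra.
  by move=> [j _ Hj]; exists j; exact: (Hj j (leqnn j)).
have mw n w : measurable (wset n w : set T).
  have [->//|/set0P W0] := eqVneq (wset n w) set0.
  have bw := wset_branch W0; have sw := wset_size W0; rewrite -sw wsetE.
  apply: measurableI => //; exact: m_interval (branch_domain_interval cs bw).
have mix n k v w : wset n v !=set0 -> wset k w !=set0 ->
    0 < pr mu (wset n v) * pr mu (wset k w) /\
    pr mu (wset n v) * pr mu (wset k w) <=
      2 * pr mu (wset n v `&` hit_at rep f (n + j) (wset k w)).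
  move=> v0 w0; have vn := wset_size v0; have wk := wset_size w0.
  have Wv : words S [seq e n | n <- v] by apply: words_wset; rewrite vn.
  have Ww : words S [seq e n | n <- w] by apply: words_wset; rewrite wk.
  have := Hgam j _ _ Wv Ww; rewrite (coding_measure_mix j vn wk) !coding_measure_cyl vn wk.
  set p := pr mu (_ `&` _); set q := _ * pr mu _ => H.
  have q0 : 0 <= q by rewrite mulr_ge0 ?pr_ge0.
  have {}q0 : 0 < q.
    rewrite lt_neqAle q0 andbT; apply: contraTneq H => <-.
    by rewrite invr0 mulr0 sub0r normrN1 -ltNge; lra.
  split => //; move: H; rewrite ler_norml => /andP[H _].
  have : 1 / 2 <= p / q by lra.
  by rewrite ler_pdivlMr//; lra.
have pos n w : wset n w !=set0 -> 0 < pr mu (wset n w).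
  move=> W0; have [+ _] := mix n n w w W0 W0.
  by rewrite lt_neqAle eq_sym mulf_eq0 negb_or => /andP[/andP[p0 _] _];
    rewrite lt_neqAle eq_sym p0 pr_ge0.
have img0 n w : iter n f @` wset n w !=set0 -> wset n w !=set0.
  by move=> [_ [x Wx _]]; exists x.
have m_img n w : measurable (iter n f @` wset n w : set T).
  have [->|/set0P/img0 W0] := eqVneq (iter n f @` wset n w) set0; first by [].
  have bw := wset_branch W0; have sw := wset_size W0; rewrite -sw img_wsetE//.
  apply: measurableI => //; apply: m_interval.
  have := iter_interval cs bw (@subset_refl _ _) (branch_domain_interval cs bw).
  by rewrite size_map.
have n1E x : rep x -> expR (birkhoff S n1 x) < 1 / 2.
  move=> rx; have [Cd0 _] := dist.
  have xs : ((expR (birkhoff S n1 x))%:E <= exp_sup S n1)%E.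
    by apply: ereal_sup_ubound; exists x.
  have c5 : 5 <= (2 * n1 + 5)%:R * (Cd + 1).
    have : 5 <= (2 * n1 + 5)%:R :> R by rewrite ler_nat leq_addl.
    by move=> c5; rewrite -[5]mulr1 ler_pM//; lra.
  have : (((2 * n1 + 5)%:R * (Cd + 1) * expR (birkhoff S n1 x))%:E < 1)%E.
    apply: le_lt_trans contr; rewrite EFinM lee_wpmul2l// lee_fin; lra.
  rewrite lte_fin; have := ler_wpM2r (expR_ge0 (birkhoff S n1 x)) c5; lra.
have n10 : (0 < n1)%N.
  have [x rx] : rep !=set0.
    apply/set0P/negP => /eqP r0; have := m_rep1 cs; rewrite r0 pr0 => /esym/eqP.
    by rewrite oner_eq0.
  case: posnP => // n10; have := n1E _ rx; rewrite n10 /birkhoff big_ord0 expR0; lra.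
pose build := @Coded R I rep f label mu m C (D ^+ 2) a j n1.
have H1 : exists x y, [/\ I x, I y & x < y] by have [[[[[_ ?]]]]] := cs.
have H2 : rep `<=` I by move=> x [].
have H3 : forall A : set T, measurable A -> measurable (rep `&` f @^-1` A).
  by move=> A mA; exact: (m_f_rep cs).
have H4 : forall k, measurable (rep `&` label @^-1` [set k] : set T).
  move=> k; rewrite (_ : _ `&` _ = rep `&` e k).
    apply: measurableI => //; case: (e1 k) => [Ze|->]; [|exact: measurable0].
    exact: m_interval (Z_interval cs Ze).
  apply/seteqP; split => x [rx /=]; last by move/label_uniq.
  by move=> <-; split => //; exact: label_mem.
have H5 : forall A : set T, measurable A -> pr mu (rep `&` f @^-1` A) = pr mu A.
  move=> A mA; have [_ [inv _]] := cs; have mr := m_reg cs.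
  have mrA := m_reg_preimage cs mA.
  rewrite -{2}/(pr mu A) (_ : rep `&` f @^-1` A = rep `&` (regular_part S `&` f @^-1` A)).
    rewrite setIC; have := pr_split mu mrA mrep.
    have -> : pr mu (regular_part S `&` f @^-1` A `\` rep) = 0.
      apply/eqP; rewrite eq_le pr_ge0 andbT.
      apply: le_trans (_ : pr mu (setT `\` rep) <= 0).
        by apply: pr_le; [exact: measurableD|exact: measurableD|exact: setSD].
      have := pr_split mu measurableT mrep; rewrite setTI (mu_rep1 cs).
      have -> : pr mu setT = 1 by rewrite /pr probability_setT.
      by lra.
    by rewrite addr0 => <-; congr fine; exact: inv.
  by rewrite setIA (setIidl (@rep_reg _ S)).
have H6 : forall n w x y z, wset n w x -> wset n w z -> rep y -> x <= y -> y <= z -> wset n w y.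
  move=> n w x y z Wx Wz ry xy yz; have W0 : wset n w !=set0 by exists x.
  have sw := wset_size W0; have bw := wset_branch W0; move: Wx Wz; rewrite -sw wsetE.
  move=> [Dx _] [Dz _]; split => //.
  by apply: (branch_domain_interval cs bw Dx Dz); rewrite xy yz.
have H7 : forall n w x y z, wset n w x -> wset n w z -> rep y -> iter n f x <= y ->
    y <= iter n f z -> (iter n f @` wset n w) y.
  move=> n w x y z Wx Wz ry xy yz; have W0 : wset n w !=set0 by exists x.
  have sw := wset_size W0; have bw := wset_branch W0; move: Wx Wz xy yz.
  rewrite -sw img_wsetE// wsetE sw => -[Dx _] [Dz _] xy yz; split => //.
  rewrite -sw in xy yz *.
  have iD := iter_interval cs bw (@subset_refl _ _) (branch_domain_interval cs bw).
  rewrite size_map in iD; apply: (iD (iter (size w) f x) (iter (size w) f z)).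
  - by exists x.
  - by exists z.
  - by rewrite xy yz.
have H8 : 1 <= D ^+ 2 by rewrite exprn_ege1.
have H9 : forall n w (B : set T), measurable B ->
    let W := wset n w in let U := iter n f @` W in
    pr m W * pr m (B `&` U) <= D ^+ 2 * (pr m (W `&` hit_at rep f n B) * pr m U) /\
    pr m (W `&` hit_at rep f n B) * pr m U <= D ^+ 2 * (pr m W * pr m (B `&` U)).
  move=> n w B mB W U; rewrite /U /W.
  have [->|/set0P W0] := eqVneq (wset n w) set0.
    by rewrite image_set0 set0I setI0 !pr0 !(mul0r, mulr0); split.
  have sw := wset_size W0; have bw := wset_branch W0; have [x0 Wx0] := W0.
  pose c0 := expR (- birkhoff S n x0); have c00 : 0 < c0 by exact: expR_gt0.
  have iD := branch_domain_interval cs bw.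
  have bnd x : dom w x -> rep x -> c0 / D <= expR (- birkhoff S (size [seq e n | n <- w]) x) <= c0 * D.
    move=> Dx rx; rewrite size_map sw; apply: (HD n w) => //.
    by rewrite -sw wsetE.
  have cD0 : 0 <= c0 / D by rewrite divr_ge0 ?ltW.
  have E B' (mB' : measurable B') := iter_expansion bw iD (@subset_refl _ _) cD0 bnd mB'.
  have /andP[l1 u1] := E _ mB; have /andP[l2 u2] := E _ measurableT.
  rewrite size_map -img_wsetE// -wsetE sw setTI setIT in l2 u2.
  rewrite size_map -img_wsetE// -wsetE sw in l1 u1.
  have preE : wset n w `&` hit_at rep f n B = wset n w `&` iter n f @^-1` B.
    by apply/seteqP; split => x [Wx]; [case|split => //; split => //; exact: wsetX Wx].
  rewrite preE; set p := pr m (wset n w) in l2 u2 *.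
  set q := pr m (wset n w `&` _) in l1 u1 *.
  set P := pr m (iter n f @` _) in l2 u2 *; set Q := pr m (B `&` _) in l1 u1 *.
  have p0 : 0 <= p by exact: pr_ge0.
  have q0 : 0 <= q by exact: pr_ge0.
  have P0 : 0 <= P by exact: pr_ge0.
  have Q0 : 0 <= Q by exact: pr_ge0.
  have l1' : c0 * q <= D * Q by move: l1; rewrite mulrAC ler_pdivrMr//; lra.
  have l2' : c0 * p <= D * P by move: l2; rewrite mulrAC ler_pdivrMr//; lra.
  split.
    rewrite -(ler_pM2l c00); have := ler_wpM2l (mulr_ge0 (ltW c00) p0) u1.
    by have := ler_wpM2r (mulr_ge0 (mulr_ge0 (ltW c00) (ltW D0)) q0) l2'; lra.
  rewrite -(ler_pM2l c00); have := ler_wpM2l (mulr_ge0 (ltW c00) q0) u2.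
  by have := ler_wpM2r (mulr_ge0 (mulr_ge0 (ltW c00) (ltW D0)) p0) l1'; lra.
have H10 : forall n w, pr m (wset (n * n1) w) <= 2^-1 ^+ n.
  elim=> [|n IHn] w; first by rewrite expr0 pr_le1.
  have [->|/set0P W0] := eqVneq (wset (n.+1 * n1) w) set0.
    by rewrite pr0 exprn_ge0.
  have bw := wset_branch W0; have sw := wset_size W0.
  pose v := take n1 w; have sv : size v = n1.
    by rewrite size_takel// sw leq_pmull.
  have wE : w = v ++ drop n1 w by rewrite cat_take_drop.
  have iD := branch_domain_interval cs bw.
  have Dv : dom w `<=` dom v.
    move=> x [Ix wx]; split => // k; rewrite size_map sv => kn.
    have kw : (k < size w)%N by rewrite sw (leq_trans kn)// leq_pmull.
    by have := wx k; rewrite size_map => /(_ kw); rewrite !(nth_map 0%N) ?sv// nth_take.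
  have bv : branch_word S [seq e n | n <- v].
    move=> k; rewrite size_map sv => kn.
    have kw : (k < size w)%N by rewrite sw (leq_trans kn)// leq_pmull.
    by have := bw k; rewrite size_map => /(_ kw); rewrite !(nth_map 0%N) ?sv// nth_take.
  have [x0 Wx0] := W0; pose c2 := expR (- birkhoff S n1 x0) * D.
  have Wv x : dom w x -> rep x -> wset n1 v x.
    by move=> Dx rx; rewrite -sv wsetE; split => //; exact: Dv.
  have Wx0' : wset n1 v x0.
    by move: Wx0; rewrite -sw wsetE => -[Dx0 rx0]; exact: Wv.
  have bnd x : dom w x -> rep x ->
      2 <= expR (- birkhoff S (size [seq e n | n <- v]) x) <= c2.
    move=> Dx rx; rewrite size_map sv; apply/andP; split.
      rewrite expRN -[leLHS]invrK lef_pV2 ?posrE ?expR_gt0//.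
      by have := n1E _ rx; lra.
    by have /andP[] := HD _ _ _ _ Wx0' (Wv _ Dx rx).
  have /andP[l _] := iter_expansion bv iD Dv (ler0n R 2) bnd measurableT.
  move: l; rewrite setTI setIT -wsetE sw size_map sv => l.
  have sub : iter n1 f @` dom w `&` rep `<=` wset (n * n1) (drop n1 w).
    move=> _ [[x Dx <-] rx]; split => //.
    have rx0 : rep x.
      have [Ix wx] := Dx; apply: (@rep_iter n1) => // k kn.
      have kw : (k < size w)%N by rewrite sw (leq_trans kn)// leq_pmull.
      exists (nth set0 [seq e n | n <- w] k); first by apply: bw; rewrite size_map.
      by apply: wx; rewrite size_map.
    have [_] : wset (n.+1 * n1) w x by rewrite -sw wsetE.
    by rewrite mulSn itinD => <-; rewrite drop_size_cat// size_itin.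
  have mi : measurable (iter n1 f @` dom w `&` rep : set T).
    apply: measurableI => //; apply: m_interval.
    by have := iter_interval cs bv Dv iD; rewrite size_map sv.
  have := pr_le m mi (mw _ _) sub; have := IHn (drop n1 w).
  by rewrite exprS; lra.
have H11 : forall n k v w, pr mu (wset n v `&` hit_at rep f n (wset k w)) <=
    C * (pr mu (wset n v) * pr mu (wset k w)).
  move=> n k v w; have CC : 0 <= C * (pr mu (wset n v) * pr mu (wset k w)).
    by rewrite !mulr_ge0 ?pr_ge0// ltW.
  have [->|/set0P VW] := eqVneq (wset n v `&` hit_at rep f n (wset k w)) set0.
    by rewrite pr0.
  have [x [Vx [_ Wx]]] := VW.
  have V0 : wset n v !=set0 by exists x.
  have W0 : wset k w !=set0 by exists (iter n f x).
  have vn := wset_size V0; have wk := wset_size W0.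
  have Wv : words S [seq e n | n <- v] by apply: words_wset; rewrite vn.
  have Ww : words S [seq e n | n <- w] by apply: words_wset; rewrite wk.
  rewrite wset_cat// in VW *.
  have Wvw : words S ([seq e n | n <- v] ++ [seq e n | n <- w]).
    by rewrite -map_cat; apply: words_wset; rewrite size_cat vn wk.
  have [_] := HC _ _ Wv Ww Wvw; rewrite -map_cat !coding_measure_cyl size_cat vn wk.
  by rewrite mulrA.
have H12 : forall n k v w, wset n v `&` hit_at rep f n (wset k w) !=set0 ->
    pr mu (wset n v) * pr mu (wset k w) <= C * pr mu (wset n v `&` hit_at rep f n (wset k w)).
  move=> n k v w VW; have [x [Vx [_ Wx]]] := VW.
  have V0 : wset n v !=set0 by exists x.
  have W0 : wset k w !=set0 by exists (iter n f x).
  have vn := wset_size V0; have wk := wset_size W0.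
  have Wv : words S [seq e n | n <- v] by apply: words_wset; rewrite vn.
  have Ww : words S [seq e n | n <- w] by apply: words_wset; rewrite wk.
  rewrite wset_cat// in VW *.
  have Wvw : words S ([seq e n | n <- v] ++ [seq e n | n <- w]).
    by rewrite -map_cat; apply: words_wset; rewrite size_cat vn wk.
  have [+ _] := HC _ _ Wv Ww Wvw; rewrite -map_cat !coding_measure_cyl size_cat vn wk.
  by rewrite -mulrA ler_pdivrMl.
have H13 : forall n k v w, pr mu (wset n v) * pr mu (wset k w) <=
    2 * pr mu (wset n v `&` hit_at rep f (n + j) (wset k w)).
  move=> n k v w; have P0 : 0 <= 2 * pr mu (wset n v `&` hit_at rep f (n + j) (wset k w)).
    by rewrite mulr_ge0 ?pr_ge0.
  have [v0|/set0P v0] := eqVneq (wset n v) set0.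
    by rewrite {1}v0 pr0 mul0r.
  have [w0|/set0P w0] := eqVneq (wset k w) set0.
    by rewrite {1}w0 pr0 mulr0.
  by have [] := mix n k v w v0 w0.
have H14 : forall x y, I x -> I y -> x < y -> y - x <= a * pr m (rep `&` `]x, y[%classic).
  by move=> x y Ix Iy xy; rewrite pr_rep_itv; [exact: len_ge|exact: measurable_itv].
have H15 : forall x y, x <= y -> pr m (rep `&` `[x, y]%classic) <= a * (y - x).
  by move=> x y xy; rewrite pr_rep_itv; [exact: len_le|exact: measurable_itv].
have dom_ac : mu `<< m by have [_ []] := cs.
exists (build (I_interval cs) H1 H2 mrep (mu_rep1 cs) (m_rep1 cs) frep H3 H4 H5 dom_ac H6 H7
  m_img H8 H9 n10 H10 (ltW C1) pos H11 H12 H13 a1 H14 H15); split => //.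
Qed.

End CodedSystem.

(** * Regular measures on an interval *)

Section Ahlfors.
Variables (R : realType) (I : set R) (m : probability (measurableTypeR R) R) (s c : R).
Local Notation T := (measurableTypeR R).
Hypothesis iI : is_interval I.
Hypothesis nI : exists x y, [/\ I x, I y & x < y].
Hypothesis bI : exists M : R, forall x, I x -> `|x| <= M.
Hypothesis mI : pr m I = 1.
Hypothesis c0 : 0 < c.
Hypothesis AR : forall x r, I x -> 0 < r -> r <= 1 ->
  ((r `^ s / c)%:E <= m (ball x r) /\ m (ball x r) <= (c * r `^ s)%:E)%E.

Lemma interval_hull : exists lo hi, [/\ lo < hi, (forall y, I y -> lo <= y <= hi) &
  forall y, lo < y < hi -> I y].
Proof.
have [x [y [Ix Iy xy]]] := nI; have [M HM] := bI.
have I0 : I !=set0 by exists x.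
have hs : has_sup I by split => //; exists M => z /HM; exact/le_trans/ler_norm.
have hi : has_inf I by split => //; exists (- M) => z /HM; rewrite ler_norml => /andP[].
have lox := ge_inf hi.2 Ix; have yhi := ub_le_sup hs.2 Iy.
exists (inf I), (sup I); split.
- by apply: le_lt_trans lox _; exact: lt_le_trans yhi.
- by move=> z Iz; rewrite ge_inf ?ub_le_sup//; [exact: hs.2|exact: hi.2].
- move=> z /andP[lz zh]; have [a Ia az] := inf_lt I0 lz.
  have [b Ib zb] := sup_gt I0 zh.
  by apply: (@iI a b) => //; rewrite (ltW az) (ltW zb).
Qed.

Lemma m_ball x r : measurable (ball x r : set T).
Proof.
by rewrite ball_itv; exact: measurable_itv.
Qed.

Lemma pr_ball x r : I x -> 0 < r -> r <= 1 ->
  r `^ s / c <= pr m (ball x r) <= c * r `^ s.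
Proof.
by move=> Ix r0 r1; have [] := AR Ix r0 r1; rewrite -!prE ?lee_fin;
  [move=> -> ->|exact: m_ball].
Qed.

Lemma powR_small (t e : R) : 0 < t -> 0 < e ->
  exists2 h0, 0 < h0 & forall h, 0 < h -> h < h0 -> h `^ t < e.
Proof.
move=> t0 e0; exists (e `^ t^-1); first exact: powR_gt0.
move=> h h0 he; have hn : h \in Num.nneg by rewrite nnegrE ltW.
have en : e `^ t^-1 \in Num.nneg by rewrite nnegrE powR_ge0.
have := gt0_ltr_powR t0 hn en he.
by rewrite -powRrM mulVf ?gt_eqF// powRr1 ?ltW.
Qed.

(** Equally spaced balls of a common radius cover an interval, and are disjoint if
    the radius is halved: a measure regular of exponent [s] on an interval has
    [s = 1]. *)
Lemma ar_exponent : s = 1.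
Proof.
have [lo [hi [lohi Ilohi Iin]]] := interval_hull.
pose l := hi - lo; have l0 : 0 < l by rewrite subr_gt0.
have key h0 : 0 < h0 -> exists h, [/\ 0 < h, h < h0 & 1 <= c * l * h `^ (s - 1) /\
    (h / 2) `^ (s - 1) <= 2 * c / l].
  move=> h00; pose h1 := Num.min h0 1.
  have h10 : 0 < h1 by rewrite lt_min h00 ltr01.
  pose N := (Num.truncn (l / h1)).+1.
  have N0 : 0 < N%:R :> R by [].
  pose h := l / N%:R.
  have hh : 0 < h by rewrite divr_gt0.
  have hh1 : h < h1.
    by rewrite ltr_pdivrMr// mulrC -ltr_pdivrMr// truncnS_gt.
  have hN : h * N%:R = l by rewrite divfK// gt_eqF.
  have hle1 : h <= 1 by apply: le_trans (ltW hh1) _; rewrite ge_min lexx orbT.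
  exists h; split => //; first by apply: lt_le_trans hh1 _; rewrite ge_min lexx.
  pose ctr i := lo + i%:R * h + h / 2.
  have hh2 : 0 < h / 2 by rewrite divr_gt0.
  have Ic i : (i < N)%N -> I (ctr i).
    move=> iN; have i0 : 0 <= i%:R * h by rewrite mulr_ge0// ltW.
    have iNh : i.+1%:R * h <= l by rewrite -hN mulrC ler_pM2l// ler_nat.
    by apply: Iin; move: iNh; rewrite -(natr1 i) /ctr /l; lra.
  have Iball i r : measurable (ball (ctr i) r : set T) by exact: m_ball.
  have mII : measurable (I : set T) by exact: is_interval_measurable.
  have split_pow r : 0 < r -> r `^ s = r `^ (s - 1) * r.
    move=> r0; have := @powRD R r (s - 1) 1; rewrite subrK powRr1 ?ltW//.
    by apply; apply/implyP => _; rewrite gt_eqF.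
  split.
    have : pr m I <= \sum_(i < N) pr m (ball (ctr i) h).
      apply: le_trans (pr_bigcup_le m N (fun i => Iball i h)).
      apply: pr_le => //; first exact: bigcup_measurable.
      move=> x Ix; have /andP[lox xhi] := Ilohi _ Ix.
      pose i := Num.truncn ((x - lo) / h).
      have xh0 : 0 <= (x - lo) / h by rewrite divr_ge0//; lra.
      have ile : i%:R * h <= x - lo by rewrite -ler_pdivlMr// truncn_le.
      have igt : x - lo < i.+1%:R * h by rewrite -ltr_pdivrMr// truncnS_gt.
      have [iN|Ni] := ltnP i N.
        exists i => //; rewrite /ball/= ltr_norml /ctr.
        by move: igt; rewrite -(natr1 i); lra.
      exists N.-1; first by rewrite /= ltnSn.
      have Nh : N%:R * h <= i%:R * h by rewrite ler_pM2r// ler_nat.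
      have NE : (N.-1)%:R * h + h = l by rewrite -hN mulrC -(natr1 N.-1); ring.
      by rewrite /ball/= ltr_norml /ctr; move: Nh NE ile; rewrite mulrC hN /l; lra.
    rewrite mI => /le_trans; apply.
    apply: (@le_trans _ _ (\sum_(i < N) c * h `^ s)).
      by apply: ler_sum => i _; have /andP[] := pr_ball (Ic i (ltn_ord i)) hh hle1.
    by rewrite sumr_const card_ord -[_ *+ N]mulr_natl split_pow// -hN le_eqVlt;
      apply/orP; left; apply/eqP; ring.
  have h21 : h / 2 <= 1 by lra.
  have dis i j : (i < j < N)%N -> ball (ctr i) (h / 2) `&` ball (ctr j) (h / 2) = set0.
    move=> /andP[ij _]; apply/seteqP; split => // x; rewrite /ball/= !ltr_norml /ctr.
    have : i.+1%:R * h <= j%:R * h by rewrite ler_pM2r// ler_nat.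
    by rewrite -(natr1 i); lra.
  have := pr_disjoint_le1 m (fun i => Iball i (h / 2)) dis.
  have : \sum_(i < N) ((h / 2) `^ s / c) <= \sum_(i < N) pr m (ball (ctr i) (h / 2)).
    by apply: ler_sum => i _; have /andP[] := pr_ball (Ic i (ltn_ord i)) hh2 h21.
  rewrite sumr_const card_ord -[_ *+ N]mulr_natl split_pow// => H1 /(le_trans H1).
  move=> H2; rewrite ler_pdivlMr// -hN.
  move: H2; rewrite mulrA ler_pdivrMr//; lra.
have cl : 0 < (c * l)^-1 by rewrite invr_gt0 mulr_gt0.
have [s1|s1|//] := ltgtP s 1.
  have t0 : 0 < 1 - s by lra.
  have [h0 h00 Hh] := powR_small t0 (divr_gt0 l0 (mulr_gt0 (ltr0Sn R 1) c0)).
  have [h [hh hlt [_ H]]] := key _ h00.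
  have hh2 : 0 < h / 2 by rewrite divr_gt0.
  have h2l : h / 2 < h0 by lra.
  have := Hh _ hh2 h2l; rewrite (_ : 1 - s = - (s - 1)); last by ring.
  set p := (h / 2) `^ (s - 1) in H; have p0 : 0 < p by exact: powR_gt0.
  have q0 : 0 <= l / (2 * c) by rewrite divr_ge0 ?mulr_ge0// ltW.
  rewrite powRN -/p -(ltr_pM2l p0) mulfV ?gt_eqF// ltNge => /negP; case.
  apply: le_trans (ler_wpM2r q0 H) _.
  by rewrite le_eqVlt; apply/orP; left; apply/eqP; field; rewrite !gt_eqF.
have t0 : 0 < s - 1 by lra.
have [h0 h00 Hh] := powR_small t0 cl.
have [h [hh hlt [H _]]] := key _ h00.
have := Hh _ hh hlt; rewrite -[(c * l)^-1]mul1r ltr_pdivlMr ?mulr_gt0//; lra.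
Qed.

(** As the exponent is one, small balls have measure of the order of their radius; large
    radii only affect the constant since the interval is bounded. *)
Lemma conf_length : exists2 a : R, 1 <= a &
  (forall x y, I x -> I y -> x < y -> y - x <= a * pr m `]x, y[%classic) /\
  (forall x y, x <= y -> pr m `[x, y]%classic <= a * (y - x)).
Proof.
have [lo [hi [lohi Ilohi Iin]]] := interval_hull.
have s1 := ar_exponent.
pose l := hi - lo; have l0 : 0 < l by rewrite subr_gt0.
have l1' : 0 < 1 + l by lra.
have c1 : 0 <= 2 * c * (1 + l) by rewrite !mulr_ge0// ltW.
exists (1 + c + 2 * c * (1 + l)); first by rewrite -addrA lerDl addr_ge0// ltW.
split=> x y.
  move=> Ix Iy xy; pose r := (y - x) / (2 * (1 + l)).
  have xyl : y - x <= l.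
    by have /andP[] := Ilohi _ Ix; have /andP[] := Ilohi _ Iy; rewrite /l; lra.
  have l1 : 0 < 2 * (1 + l) by rewrite mulr_gt0.
  have r0 : 0 < r by rewrite divr_gt0// subr_gt0.
  have rE : r * (2 * (1 + l)) = y - x by rewrite divfK// gt_eqF.
  have r1 : r <= 1 by rewrite ler_pdivrMr//; lra.
  have rxy : r <= (y - x) / 2.
    by rewrite -rE; have := mulr_ge0 (ltW r0) (ltW l0); lra.
  have Iz : I ((x + y) / 2) by apply: (@iI x y) => //; apply/andP; split; lra.
  have /andP[+ _] := pr_ball Iz r0 r1; rewrite s1 (powRr1 (ltW r0)) => H.
  have : pr m (ball ((x + y) / 2) r) <= pr m `]x, y[%classic.
    apply: pr_le; [exact: m_ball|exact: measurable_itv|].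
    by move=> z; rewrite /ball/= in_itv/= ltr_distlC => /andP[]; lra.
  move=> /(le_trans H); rewrite ler_pdivrMr// => H2.
  have := ler_wpM2r (ltW l1) H2; rewrite rE => /le_trans; apply.
  have p0 := pr_ge0 m `]x, y[%classic.
  have := mulr_ge0 p0 (ltW c0); lra.
move=> xy; have mII : measurable (I : set T) by exact: is_interval_measurable.
have mxy : measurable (`[x, y]%classic : set T) by exact: measurable_itv.
have d0 : 0 <= y - x by lra.
have out : pr m (setT `\` I) = 0.
  have m1 : pr m setT = 1 by rewrite /pr probability_setT.
  have := pr_split m measurableT mII; rewrite setTI mI m1 => /esym/eqP.
  by rewrite addrC -subr_eq0 addrK => /eqP.
have [IE|/set0P[z [/= zxy Iz]]] := eqVneq (`[x, y]%classic `&` I) set0.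
  have : pr m `[x, y]%classic <= pr m (setT `\` I).
    apply: pr_le => //; first exact: measurableD.
    by move=> z zxy; split => // Iz; have : (`[x, y]%classic `&` I) z by []; rewrite IE.
  by rewrite out => /le_trans; apply; rewrite mulr_ge0// !addr_ge0// ltW.
apply: (@le_trans _ _ ((1 + c) * (y - x))); last first.
  by rewrite ler_wpM2r// lerDl.
apply/ler_addgt0Pr => e e0; pose r := (y - x) + e / (1 + c).
have e'0 : 0 < e / (1 + c) by rewrite divr_gt0// addr_gt0.
have rE : (1 + c) * r = (1 + c) * (y - x) + e by rewrite /r mulrDr [_ * (e / _)]mulrC divfK// gt_eqF// addr_gt0.
rewrite -rE; have r0 : 0 < r by rewrite /r; lra.
have [r1|r1] := leP r 1; last first.
  apply: le_trans (pr_le1 m mxy) _.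
  by have := mulr_ge0 (ltW c0) (ltW r0); lra.
have /andP[_] := pr_ball Iz r0 r1; rewrite s1 (powRr1 (ltW r0)) => H.
apply: (@le_trans _ _ (pr m (ball z r))).
  apply: pr_le => //; first exact: m_ball.
  move: zxy; rewrite in_itv/= => /andP[xz zy] w.
  rewrite /= in_itv/= /ball/= => /andP[xw wy].
  by rewrite ltr_norml /r; apply/andP; split; lra.
by have := ltW r0; lra.
Qed.

End Ahlfors.

(** * The first return map *)

Section FirstReturn.
Variables (R : realType) (S : system R) (Y : set R) (iY : is_interval Y).
Local Notation T := (measurableTypeR R).
Local Notation I := (state_space S).
Local Notation f := (dyn S).
Local Notation m := (conf_measure S).
Local Notation mu := (inv_measure S).
Local Notation G0 := (first_return S iY).

Lemma first_timeP (P : nat -> Prop) :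
  (exists n, [/\ (0 < n)%N, P n, forall k, (0 < k)%N -> P k -> (n <= k)%N &
     first_time R P = n%:R%:E]) \/
  (first_time R P = +oo%E /\ forall k, (0 < k)%N -> ~ P k).
Proof.
have [[k [k0 Pk]]|H] := pselect (exists k, (0 < k)%N /\ P k); last first.
  right; have nP k : (0 < k)%N -> ~ P k by move=> k0 Pk; apply: H; exists k.
  split => //; rewrite /first_time (_ : [set _ | _ in _] = set0) ?ereal_inf0//.
  by apply/seteqP; split => // z [k [k0 Pk]]; case: (nP _ k0 Pk).
pose p n := `[< (0 < n)%N /\ P n >].
have : exists n, p n by exists k; exact/asboolP.
move=> /ex_minnP[n /asboolP[n0 Pn] nmin]; left; exists n.
have min_n j : (0 < j)%N -> P j -> (n <= j)%N by move=> j0 Pj; apply/nmin/asboolP.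
split => //; apply/eqP; rewrite eq_le; apply/andP; split.
  by apply: ereal_inf_lbound; exists n.
apply: le_ereal_inf_tmp => _ [j [j0 Pj] <-]; rewrite lee_fin ler_nat; exact: min_n.
Qed.

Lemma natE_inj (k n : nat) : k%:R%:E = n%:R%:E :> \bar R -> k = n.
Proof. by case=> /eqP; rewrite eqr_nat => /eqP. Qed.

Lemma return_timeP x n : return_time S Y x = n%:R%:E ->
  [/\ (0 < n)%N, Y (iter n f x), forall k, (0 < k < n)%N -> ~ Y (iter k f x) &
      return_nat S Y x = n].
Proof.
move=> xn; have rn : return_nat S Y x = n.
  rewrite /return_nat; case: xgetP => [k _ xk|/(_ n) H]; last by case: H.
  by apply: natE_inj; rewrite -xn -xk.
have [[k [k0 Yk kmin Ek]]|[E _]] := first_timeP (fun n => Y (iter n f x)); last first.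
  by move: xn; rewrite /return_time E.
have kn : k = n.
  by apply: natE_inj; rewrite -xn -Ek.
rewrite -kn; split => //; last by rewrite kn.
by move=> j /andP[j0 jk] Yj; have := kmin _ j0 Yj; rewrite leqNgt jk.
Qed.

(** Two overlapping branches have the same return time, so their union is again an
    interval of constancy, and they are equal by maximality. *)
Lemma return_branches_disjoint J K x : return_branches S Y J -> return_branches S Y K ->
  J x -> K x -> J = K.
Proof.
move=> [[[iJ nJ] JY [n Jn]] Jmax] [[[iK nK] KY [k Kk]] Kmax] Jx Kx.
have nk : n%:R%:E = k%:R%:E :> \bar R by rewrite -(Jn _ Jx) (Kk _ Kx).
have JK : return_const S Y (J `|` K).
  split; [split| |].
  - move=> u v uJ vJ w /andP[uw wv].
    have [wx|xw] := leP w x.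
      by case: uJ => Hu; [left; apply: (iJ u x)|right; apply: (iK u x)] => //; rewrite uw.
    by case: vJ => Hv; [left; apply: (iJ x v)|right; apply: (iK x v)] => //;
      rewrite (ltW xw) wv.
  - by have [u [v [Ju Jv uv]]] := nJ; exists u, v; split => //; left.
  - by move=> u [/JY|/KY].
  - by exists n => u [/Jn//|/Kk]; rewrite nk.
have JE := Jmax _ JK (@subsetUl _ J K); have KE := Kmax _ JK (@subsetUr _ J K).
by rewrite -[LHS]JE KE.
Qed.

Hypothesis im : interval_map S.
Hypothesis AR : ahlfors_regular S I.
Hypothesis YI : Y `<=` I.
Hypothesis muY : (0 < mu Y)%E.
Hypothesis good : good_system G0.

Let cs : conformal_system S. Proof. by case: im. Qed.

Let mY : measurable (Y : set T). Proof. exact: is_interval_measurable. Qed.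

Let m_Y_gt0 : (0 < m Y)%E.
Proof.
rewrite lt_neqAle measure_ge0 andbT; apply/negP => /eqP mY0.
have [_ [_ dom]] := cs; have := (null_content_dominatesP _ _).1 dom _ mY (esym mY0).
by move=> muY0; move: muY; rewrite muY0 ltxx.
Qed.

Lemma pr_normalized (P : probability T R) (A : set T) : (0 < P Y)%E -> measurable A ->
  pr (normalized_restriction P iY) A = pr P (A `&` Y) / pr P Y.
Proof.
move=> PY mA; rewrite {1}/pr /normalized_restriction/= /mnormalize/= /mrestr setTI.
rewrite gt_eqF//= lt_eqF/=; last by rewrite -ge0_fin_numE// fin_num_measure.
by rewrite fineM// fin_num_measure//; exact: measurableI.
Qed.

Lemma pr_inv_Y (A : set T) : measurable A -> A `<=` Y ->
  pr mu A = pr mu Y * pr (inv_measure G0) A.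
Proof.
move=> mA AY; rewrite (pr_normalized muY mA) (setIidl AY) mulrC divfK// gt_eqF//.
by rewrite -lte_fin prE.
Qed.

Lemma exists_coded_return : exists G : coded R,
  [/\ cY G = Y, cX G = repeller G0, cF G = dyn G0, cP G = inv_measure G0 &
    (forall x y, cX G x -> cX G y -> cbr G x = cbr G y ->
       return_nat S Y x = return_nat S Y y) /\
    (two_full_branches S Y -> exists a b, [/\ a != b,
      forall y, cX G y -> exists x, [/\ cX G x, cbr G x = a & cF G x = y] &
      forall y, cX G y -> exists x, [/\ cX G x, cbr G x = b & cF G x = y]])].
Proof.
have [[cs0 _ [Cd [dist [n1 [contr _]]]]] [[_ _ qb psi] _]] := good.
have [e [e1 e2 e3]] := Z_index cs0.
have disj J K x : branches G0 J -> branches G0 K -> J x -> K x -> J = K.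
  exact: return_branches_disjoint.
have [[[_ nI] _ _] _] : piecewise_monotone S by case: cs => [[]].
have mI : pr m I = 1 by case: cs => [[_ mI _ _] _]; rewrite /pr mI.
have [c c0 Hc] := AR.
have [a a1 [age ale]] := conf_length (I_interval cs) nI (I_bounded cs) mI c0 Hc.
have pY : 0 < pr m Y by rewrite -lte_fin prE.
have pY1 : pr m Y <= 1 by exact: pr_le1.
have len_ge x y : Y x -> Y y -> x < y ->
    y - x <= a / pr m Y * pr (conf_measure G0) `]x, y[%classic.
  move=> Yx Yy xy; rewrite (pr_normalized m_Y_gt0)//.
  rewrite setIidl; last first.
    move=> z; rewrite /= in_itv/= => /andP[xz zy].
    by apply: (iY Yx Yy); rewrite (ltW xz) (ltW zy).
  apply: le_trans (age _ _ (YI Yx) (YI Yy) xy) _.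
  rewrite -mulrA ler_pM2l ?(lt_le_trans ltr01)//.
  set p := pr m _; have p0 : 0 <= p by exact: pr_ge0.
  rewrite mulrC -mulrA ler_peMr// -invfM invf_ge1 ?mulr_gt0//.
  by apply: mulr_ile1 => //; exact: ltW.
have len_le x y : x <= y -> pr (conf_measure G0) `[x, y]%classic <= a / pr m Y * (y - x).
  move=> xy; have mxy : measurable (`[x, y]%classic : set T) by exact: measurable_itv.
  rewrite (pr_normalized m_Y_gt0)// mulrAC ler_pM2r ?invr_gt0//; apply: le_trans (ale _ _ xy).
  by apply: pr_le => //; exact: measurableI.
have aY1 : 1 <= a / pr m Y by rewrite ler_pdivlMr// mul1r (le_trans pY1).
have [G [GY GX GF GP Gbr]] :=
  exists_coded cs0 disj dist contr qb psi aY1 len_ge len_le e1 e2 e3.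
exists G; split => //; rewrite GX Gbr GF; split.
  move=> x y rx ry xy.
  have := label_mem e2 ry; rewrite -xy => ey; have ex := label_mem e2 rx.
  have [[_ _ [n Jn]] _] := e_Z e1 ex.
  by have [_ _ _ ->] := return_timeP (Jn _ ex); have [_ _ _ ->] := return_timeP (Jn _ ey).
move=> [J [K [[ZJ fJ] [ZK fK] JK]]].
have full j y : full_branch S Y (e j) -> repeller G0 y ->
    exists x, [/\ repeller G0 x, label e x = j & dyn G0 x = y].
  move=> [Zj fj] ry; have [x jx xy] : (dyn G0 @` e j) y by rewrite fj; case: ry.
  exists x; split => //; last exact: (label_uniq disj e1 e3).
  by apply: (rep_f cs0); [exists (e j)|rewrite xy].
have [a' ea] := e2 _ ZJ; have [b' eb] := e2 _ ZK.
exists a', b'; split; first by apply/eqP => ab; apply: JK; rewrite -ea -eb ab.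
  by move=> y; apply: full; rewrite ea; split.
by move=> y; apply: full; rewrite eb; split.
Qed.

Local Notation X := (repeller G0).
Local Notation F := (dyn G0).
Local Notation tau := (return_nat S Y).

Lemma tau_spec x : X x -> [/\ (0 < tau x)%N, F x = iter (tau x) f x &
  forall k, (0 < k < tau x)%N -> ~ Y (iter k f x)].
Proof.
move=> /rep_reg[J [[_ _ [n Jn]] _] Jx].
have [n0 _ nY tn] := return_timeP (Jn _ Jx); split; [by rewrite tn|by []|].
by move=> k; rewrite tn; exact: nY.
Qed.

(** By [iter_ret] below, the time of the [t]-th return. *)
Definition ret t x : nat := \sum_(k < t) tau (iter k F x).

Lemma iter_ret t x : iter t F x = iter (ret t x) f x.
Proof.
elim: t => [|t IHt]; first by rewrite /ret big_ord0.
by rewrite /ret big_ord_recr/= addnC iterD -/(ret t x) -IHt.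
Qed.

Lemma ret_mono s t x : (s <= t)%N -> (ret s x <= ret t x)%N.
Proof. by move=> /subnKC <-; rewrite [leqRHS]/ret big_split_ord/= leq_addr. Qed.

(** By induction on the time, since the orbit avoids [Y] strictly before its first
    return. *)
Lemma visit_return k x : X x -> Y (iter k f x) ->
  exists2 t, (t <= k)%N & iter k f x = iter t F x.
Proof.
have [n] := ubnP k; elim: n k x => // n IHn k x; rewrite ltnS => kn rx Yk.
have [->|k0] := posnP k; first by exists 0%N.
have [t0 Fx tY] := tau_spec rx.
have tk : (tau x <= k)%N.
  by rewrite leqNgt; apply/negP => kt; apply: (tY k) => //; rewrite k0.
have cs0 : conformal_system G0 by case: good => [[]].
have kE : iter k f x = iter (k - tau x) f (F x) by rewrite Fx -iterD subnK.
rewrite kE in Yk *; have kn' : (k - tau x < n)%N.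
  by apply: leq_trans kn; rewrite ltn_subrL t0.
have [t tk' ->] := IHn _ _ kn' (f_rep cs0 rx) Yk.
exists t.+1; last by rewrite iterSr.
by apply: leq_ltn_trans tk' _; rewrite ltn_subrL t0.
Qed.

End FirstReturn.

(** * First entrances *)

Lemma null_bigcup (R : realType) (P : probability (measurableTypeR R) R)
    (A : nat -> set (measurableTypeR R)) :
  (forall n, measurable (A n)) -> (forall n, P (A n) = 0%E) -> P (\bigcup_n A n) = 0%E.
Proof.
move=> mA A0; apply/eqP; rewrite eq_le measure_ge0 andbT.
apply: le_trans (measure_sigma_subadditive P mA (bigcupT_measurable _ mA) (@subset_refl _ _)) _.
by rewrite eseries0// => n _ _; exact: A0.
Qed.

Section Entrance.
Variables (R : realType) (S : system R) (Y : set R) (iY : is_interval Y).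
Local Notation T := (measurableTypeR R).
Local Notation I := (state_space S).
Local Notation f := (dyn S).
Local Notation m := (conf_measure S).
Local Notation mu := (inv_measure S).
Local Notation G0 := (first_return S iY).
Local Notation X := (repeller G0).
Local Notation F := (dyn G0).
Local Notation tau := (return_nat S Y).
Local Notation P := (inv_measure G0).

Hypothesis im : interval_map S.
Hypothesis YI : Y `<=` I.
Hypothesis muY : (0 < mu Y)%E.
Hypothesis good : good_system G0.

(** Time zero counts as an entrance, so that the points of [Y] enter at once. *)
Definition entrance n (A : set R) : set T :=
  [set x | I x /\ (forall k, (k < n)%N -> ~ Y (iter k f x)) /\ A (iter n f x)].

Let cs : conformal_system S. Proof. by case: im. Qed.

Let mI : measurable (I : set T). Proof. exact: is_interval_measurable (I_interval cs). Qed.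

Let mY : measurable (Y : set T). Proof. exact: is_interval_measurable. Qed.

Lemma I_f x : I x -> I (f x). Proof. by case: im => _ + _ _; apply. Qed.

Lemma I_iter n x : I x -> I (iter n f x).
Proof. by move=> Ix; elim: n => //= n; exact: I_f. Qed.

Lemma m_I_preimage (B : set T) : measurable B -> measurable (I `&` f @^-1` B : set T).
Proof. by case: im => _ _ + _; apply. Qed.

Lemma mu_preimage (B : set T) : measurable B -> pr mu (I `&` f @^-1` B) = pr mu B.
Proof.
move=> mB; have [[_ _ ms _] [inv dom]] := cs.
have mreg := m_reg cs; have msing : measurable (singular_part S : set T).
  exact: measurableD.
have ms0 : mu (singular_part S) = 0%E.
  exact: (null_content_dominatesP _ _).1 dom _ msing ms.
apply: EFin_inj; rewrite !prE//; last exact: m_I_preimage.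
rewrite -(inv _ mB); apply/eqP; rewrite eq_le; apply/andP; split; last first.
  apply: le_measure; rewrite ?inE; [exact: m_reg_preimage|exact: m_I_preimage|].
  by apply: setSI; exact: reg_sub.
rewrite -[leRHS]adde0 -[X in (_ <= _ + X)%E]ms0.
apply: le_trans (measureU2 _ (m_reg_preimage cs mB) msing).
apply: le_measure; rewrite ?inE.
- exact: m_I_preimage.
- by apply: measurableU => //; exact: m_reg_preimage.
by move=> x [Ix Bx]; have [rx|nrx] := pselect (regular_part S x); [left|right].
Qed.

Lemma mu_I : pr mu I = 1.
Proof.
by have := mu_preimage measurableT; rewrite setIT /pr probability_setT.
Qed.

Lemma iter_preimageS n (B : set R) :
  I `&` iter n.+1 f @^-1` B = I `&` f @^-1` (I `&` iter n f @^-1` B).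
Proof.
apply/seteqP; split => x /= [Ix]; rewrite -iterS iterSr.
  by move=> Bx; split => //; split => //; exact: I_f.
by move=> [].
Qed.

Lemma m_iter_preimage n (B : set T) : measurable B ->
  measurable (I `&` iter n f @^-1` B : set T).
Proof.
move=> mB; elim: n => [|n IHn]; first exact: measurableI.
by rewrite iter_preimageS; exact: m_I_preimage.
Qed.

Lemma mu_iter_preimage n (B : set T) : measurable B ->
  pr mu (I `&` iter n f @^-1` B) = pr mu B.
Proof.
move=> mB; elim: n => [|n IHn]; last first.
  by rewrite iter_preimageS mu_preimage//; exact: m_iter_preimage.
rewrite (_ : I `&` _ = B `&` I); last by rewrite setIC.
have := pr_split mu mB mI; have := pr_split mu measurableT mI.
have : pr mu (B `\` I) <= pr mu (setT `\` I).
  by apply: pr_le; [exact: measurableD|exact: measurableD|exact: setSD].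
have : pr mu setT = 1 by rewrite /pr probability_setT.
by rewrite setTI mu_I; have := pr_ge0 mu (B `\` I); lra.
Qed.

Lemma entranceS n A :
  entrance n.+1 A = (I `&` f @^-1` (entrance n A)) `\` Y.
Proof.
apply/seteqP; split => x.
  move=> [Ix [nY Ax]]; split; last exact: (nY 0%N).
  split => //; split; first exact: I_f.
  by split => [k kn|]; rewrite -iterSr//; exact: nY.
move=> [[Ix [_ [nY Ax]]] nYx]; split => //; split; last by rewrite iterSr.
by case=> // k kn; rewrite iterSr; exact: nY.
Qed.

Lemma m_entrance n (A : set T) : measurable A -> measurable (entrance n A).
Proof.
move=> mA; elim: n => [|n IHn]; last first.
  by rewrite entranceS; apply: measurableD => //; exact: m_I_preimage.
rewrite (_ : entrance 0 A = I `&` A); first exact: measurableI.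
by apply/seteqP; split => [x [? []]|x [Ix Ax]].
Qed.

Lemma entrance_disjoint i j A : A `<=` Y -> (i < j)%N ->
  entrance i A `&` entrance j A = set0.
Proof.
move=> AY ij; apply/seteqP; split => // x [[_ [_ /AY Yx]] [_ [nY _]]].
exact: (nY _ ij).
Qed.

Variable G : coded R.
Hypotheses (GY : cY G = Y) (GX : cX G = X) (GF : cF G = F) (GP : cP G = P).
Hypothesis Gtau : forall x y, cX G x -> cX G y -> cbr G x = cbr G y -> tau x = tau y.
Local Notation cyl := (cylindrical (cX G) (cF G) (cbr G)).
Local Notation pre := (hit_at (cX G) (cF G)).

Lemma cyl_tau (p : pred nat) : cyl 1 [set x | cX G x /\ p (tau x)].
Proof.
split => [x []//|x y Xx Xy [xy] [_ px]]; split => //.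
by rewrite -(Gtau Xx Xy xy).
Qed.

Lemma entrance_step n (A : set T) : measurable A -> A `<=` cX G ->
  pr mu (entrance n A) <= pr mu (entrance n.+1 A) +
    pr mu Y * pr (cP G) ([set x | cX G x /\ tau x == n.+1] `&` pre 1 A).
Proof.
move=> mA AX; have mV := m_entrance n mA.
rewrite -(mu_preimage mV) (pr_split mu (m_I_preimage mV) mY) -entranceS addrC lerD2l.
set E := _ `&` Y; have mE : measurable (E : set T).
  by apply: measurableI => //; exact: m_I_preimage.
rewrite (pr_inv_Y _ muY mE); last by move=> x [].
rewrite ler_pM2l -?lte_fin ?prE// -GP -(pr_X G mE).
apply: pr_le; first by apply: measurableI => //; exact: cmX.
  apply: measurableI; last exact: m_pre.
  exact: (m_cyl (cyl_tau (fun k => k == n.+1))).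
move=> x [Xx [[Ix [_ [nY Ax]]] Yx]].
have rx : X x by rewrite -GX.
have [t0 Fx tY] := tau_spec rx.
have XY y : cX G y -> Y y by move=> /cXY; rewrite GY.
have YF : Y (iter (tau x) f x).
  by rewrite -Fx; apply: XY; rewrite -GF; exact: cFX.
have tn : tau x = n.+1.
  apply/eqP; rewrite eqn_leq; apply/andP; split; rewrite leqNgt; apply/negP => H.
    by apply: (tY n.+1) => //; apply/XY/AX; rewrite iterSr.
  apply: (nY (tau x).-1); first by rewrite -ltnS prednK.
  by rewrite -iterSr prednK.
split; first by split => //=; rewrite tn.
by split => //=; rewrite GF Fx tn iterSr.
Qed.

(** The share of [Y] that has not returned by time [n] is the whole supply of later
    first entrances: by invariance the mass of the entrances at time [n] is passed on
    to time [n.+1] up to the returns at time [n.+1] exactly, and nothing is left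
    at infinity since the entrance sets are disjoint. *)
Lemma entrance_bound n (A : set T) : measurable A -> A `<=` cX G ->
  pr mu (entrance n A) <=
    pr mu Y * pr (cP G) ([set x | cX G x /\ (n < tau x)%N] `&` pre 1 A).
Proof.
move=> mA AX; set q := pr mu Y * _.
have pY : 0 < pr mu Y by rewrite -lte_fin prE.
have mtau (p : pred nat) : measurable ([set x | cX G x /\ p (tau x)] `&` pre 1 A : set T).
  by apply: measurableI; [exact: (m_cyl (cyl_tau p))|exact: m_pre].
have tele k : pr mu (entrance n A) <= pr mu (entrance (n + k) A) +
    pr mu Y * pr (cP G) ([set x | cX G x /\ (n < tau x <= n + k)%N] `&` pre 1 A).
  elim: k => [|k IHk]; first by rewrite addn0 lerDl mulr_ge0 ?pr_ge0.
  apply: le_trans IHk _; rewrite addnS.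
  apply: le_trans (lerD (entrance_step _ mA AX) (lexx _)) _.
  rewrite -addrA lerD2l -mulrDr ler_pM2l// -prU.
  - apply: pr_le; [apply: measurableU; [exact: (mtau (fun j => j == (n + k).+1))|exact: (mtau (fun j => n < j <= n + k)%N)]|exact: (mtau (fun j => n < j <= (n + k).+1)%N)|].
    move=> x [[[Xx /eqP tx] px]|[[Xx /andP[nt tk]] px]]; split => //; split => //=.
      by rewrite tx ltnS leq_addr leqnn.
    by rewrite nt leqW.
  - exact: (mtau (fun j => j == (n + k).+1)).
  - exact: (mtau (fun j => n < j <= n + k)%N).
  apply/seteqP; split => // x [[[_ /eqP tx] _] [[_ /andP[_ tk]] _]].
  by rewrite tx ltnn in tk.
rewrite leNgt; apply/negP => qlt.
pose e := pr mu (entrance n A) - q; have e0 : 0 < e by rewrite subr_gt0.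
have ge_e k : e <= pr mu (entrance (n + k) A).
  rewrite /e lerBlDr; apply: le_trans (tele k) _; rewrite lerD2l ler_pM2l//.
  apply: pr_le; [exact: (mtau (fun j => n < j <= n + k)%N)|exact: (mtau (fun j => n < j)%N)|].
  by move=> x [[Xx /andP[nt _]] px].
pose k := (Num.truncn e^-1).+1.
have := @pr_disjoint_le1 _ _ _ mu (fun k => entrance (n + k) A) k
  (fun i => m_entrance _ mA) _.
have dis i j : (i < j < k)%N -> entrance (n + i) A `&` entrance (n + j) A = set0.
  move=> /andP[ij _]; apply: entrance_disjoint; last by rewrite ltn_add2l.
  by rewrite -GY; apply: subset_trans AX _; exact: cXY.
move=> /(_ dis) le1; have : \sum_(i < k) e <= 1.
  by apply: le_trans le1; apply: ler_sum => i _; exact: ge_e.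
rewrite sumr_const card_ord -[_ *+ k]mulr_natl -ler_pdivlMr// div1r leNgt.
by rewrite truncnS_gt.
Qed.

(** The return time depends on the first symbol only: by the quasi-Bernoulli property,
    the place of the entrance is independent of the delay up to a factor. *)
Lemma entrance_cyl n k (A : set T) : cyl k A ->
  pr mu (entrance n A) <= pr mu Y * (cK G *
    (pr (cP G) [set x | cX G x /\ (n < tau x)%N] * pr (cP G) A)).
Proof.
move=> cA; apply: le_trans (entrance_bound n (m_cyl cA) (cylX cA)) _.
rewrite ler_pM2l -?lte_fin ?prE//.
by apply: qb_le cA; exact: (cyl_tau (fun j => n < j)%N).
Qed.

(** Almost every orbit enters [Y], at a point of [X]: the points that visit [Y]
    infinitely often form an invariant set of measure at least [mu Y]. *)
Lemma entrance_all : pr mu (I `\` \bigcup_n entrance n (cX G)) = 0.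
Proof.
have pY : 0 < pr mu Y by rewrite -lte_fin prE.
pose U := \bigcup_n (I `&` iter n f @^-1` Y).
have mU : measurable (U : set T).
  by apply: bigcupT_measurable => n; exact: m_iter_preimage.
pose B := \bigcap_n (I `&` iter n f @^-1` U).
have mB : measurable (B : set T).
  by apply: bigcapT_measurable => n; exact: m_iter_preimage.
have UI : U `<=` I by move=> x [n _ []].
have BI : B `<=` I by move=> x /(_ 0%N Logic.I)[].
have U_f x : I x -> U (f x) -> U x.
  by move=> Ix [n _ [_ Yx]]; exists n.+1 => //; split => //; rewrite /= -iterS iterSr.
have U_iter n x : I x -> U (iter n f x) -> U x.
  by move=> Ix; elim: n => //= n IHn Ux; apply/IHn/U_f => //; exact: I_iter.
have invB : I `&` f @^-1` B = B.
  apply/seteqP; split => x.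
    move=> [Ix Bfx] [_|n _]; last first.
      by have [_ H] := Bfx n Logic.I; split => //; rewrite /preimage/= -iterS iterSr.
    by split => //; apply: U_f => //; have [] := Bfx 0%N Logic.I.
  move=> Bx; split; first exact: BI.
  move=> n _; have [Ix Ux] := Bx n.+1 Logic.I.
  by split; [exact: I_f|move: Ux; rewrite /= -iterS iterSr].
have muB : pr mu B = pr mu U.
  have nI : nonincreasing_seq (fun n => I `&` iter n f @^-1` U).
    apply/nonincreasing_seqP => n; rewrite subsetEset => x [Ix Ux]; split => //.
    by apply: U_f => //; exact: I_iter.
  have := @nonincreasing_cvg_mu _ _ _ mu (fun n => I `&` iter n f @^-1` U).
  move=> /(_ _ (fun n => m_iter_preimage n mU) mB nI) cv.
  have fin : (mu (I `&` iter 0 f @^-1` U) < +oo)%E.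
    by rewrite -ge0_fin_numE// fin_num_measure//; exact: m_iter_preimage.
  have E : mu \o (fun n => I `&` iter n f @^-1` U) = (fun=> mu U).
    apply: funext => n /=; rewrite -!prE ?mu_iter_preimage//; exact: m_iter_preimage.
  have := cv fin; rewrite E => cvU; have := cvg_unique _ cvU (cvg_cst _).
  by rewrite /pr => <-.
have B1 : pr mu B = 1.
  have [_ _ _ erg] := im; have [B0|] := erg _ mB BI invB; last by rewrite /pr => ->.
  have pB0 : pr mu B = 0 by rewrite /pr B0.
  suff : pr mu Y <= 0 by rewrite leNgt pY.
  rewrite -[leRHS]pB0 muB; apply: pr_le => //.
  by move=> x Yx; exists 0%N => //; split => //; exact: YI.
pose N := \bigcup_n (I `&` iter n f @^-1` (Y `\` cX G)).
have mX : measurable (cX G) := @cmX R G.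
have mN : measurable (N : set T).
  by apply: bigcupT_measurable => n; apply: m_iter_preimage; exact: measurableD.
have mE : measurable (I `\` \bigcup_n entrance n (cX G) : set T).
  by apply: measurableD => //; apply: bigcupT_measurable => n; exact: m_entrance.
have N0 : mu N = 0%E.
  apply: null_bigcup => n; first by apply: m_iter_preimage; exact: measurableD.
  have mYX : measurable (Y `\` cX G : set T) by exact: measurableD.
  rewrite -prE; last exact: m_iter_preimage.
  rewrite mu_iter_preimage// (pr_inv_Y _ muY mYX); last by move=> x [].
  rewrite -GP -(pr_X G mYX) setIDA (_ : _ `\` _ = set0) ?pr0 ?mulr0//.
  by apply/seteqP; split => // x [[]].
have prN : pr mu N = 0 by rewrite /pr N0.
apply/eqP; rewrite eq_le pr_ge0 andbT.
rewrite -[leRHS](_ : pr mu (I `\` B) + pr mu N = 0); last first.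
  have := pr_split mu mI mB; rewrite setIC (setIidl BI) B1 mu_I prN; lra.
apply: le_trans (prU_le mu (measurableD mI mB) mN).
apply: pr_le => //; first by apply: measurableU => //; exact: measurableD.
move=> x [Ix nEx]; have [Bx|] := pselect (B x); last by left.
right; have [_ [k _ [_ Yk]]] := Bx 0%N Logic.I.
pose p n := `[< Y (iter n f x) >].
have : exists n, p n by exists k; exact/asboolP.
move=> /ex_minnP[n /asboolP Yn nmin]; exists n => //; split => //; split => // Xn.
apply: nEx; exists n => //; split => //; split => // j jn Yj.
by have := nmin j (asboolT Yj); rewrite leqNgt jn.
Qed.

End Entrance.

(** * From the base to the whole interval *)

Section LocalToGlobal.
Variable R : realType.
Implicit Types (J : set R) (g : R -> R).

Lemma finite_gap (E : set R) x : finite_set E ->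
  exists2 r : R, 0 < r & forall q, E q -> q <> x -> r <= `|q - x|.
Proof.
move=> /finite_seqP[s ->]; elim: s => [|q s [r r0 IHs]]; first by exists 1.
have [->|/eqP qx] := eqVneq q x.
  exists r => // z; rewrite /= inE => /orP[/eqP->//|zs]; exact: IHs.
exists (Num.min r `|q - x|).
  by rewrite lt_min r0/= normr_gt0 subr_eq0; exact/eqP.
move=> z; rewrite /= inE ge_min => /orP[/eqP->|zs] zx; first by rewrite lexx orbT.
by rewrite IHs.
Qed.

(** The estimate from [a] holds up to a largest point, which can only be [b]. *)
Lemma local_lipschitz J g (K : R) : is_interval J ->
  (forall x, J x -> exists2 r : R, 0 < r &
     forall y, J y -> `|y - x| < r -> `|g y - g x| <= K * `|y - x|) ->
  forall a b, J a -> J b -> a <= b -> `|g b - g a| <= K * (b - a).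
Proof.
move=> iJ loc a b Ja Jb ab.
pose E := [set t | a <= t <= b /\ forall u, a <= u <= t -> `|g u - g a| <= K * (u - a)].
have Ea : E a.
  split; first by rewrite lexx.
  by move=> u; rewrite -eq_le => /eqP <-; rewrite !subrr normr0 mulr0.
have ubE : ubound E b by move=> t [/andP[]].
have hE : has_sup E by split; [exists a|exists b].
set s := sup E.
have as_ : a <= s by exact: ub_le_sup hE.2 _ Ea.
have sb : s <= b by exact: ge_sup hE.1 ubE.
have Js : J s by apply: (iJ a b) => //; rewrite as_.
have [r r0 Hr] := loc _ Js.
have below u : a <= u -> u < s -> `|g u - g a| <= K * (u - a).
  move=> au us; have [t [_ Et] ut] := sup_gt hE.1 us.
  by apply: Et; rewrite au ltW.
have Es : `|g s - g a| <= K * (s - a).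
  have [<-|/eqP ns] := eqVneq a s; first by rewrite !subrr normr0 mulr0.
  have lt_as : a < s by rewrite lt_neqAle as_ andbT; exact/eqP.
  pose u := Num.max a (s - r / 2).
  have us : u < s by rewrite gt_max lt_as/= ltrBlDr ltrDl divr_gt0.
  have au : a <= u by rewrite le_max lexx.
  have sru : s - r / 2 <= u by rewrite le_max lexx orbT.
  have Ju : J u by apply: (iJ a s) => //; rewrite au ltW.
  have dus : `|u - s| = s - u by rewrite distrC ger0_norm// subr_ge0 ltW.
  have := Hr _ Ju; rewrite dus => /(_ _) H.
  have H1 : `|g u - g s| <= K * (s - u) by apply: H; lra.
  have H2 := below _ au us.
  have -> : g s - g a = (g s - g u) + (g u - g a) by ring.
  apply: le_trans (ler_normD _ _) _; rewrite [`|g s - g u|]distrC.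
  by rewrite (_ : K * (s - a) = K * (s - u) + K * (u - a)) ?lerD//; ring.
have [sbE|/eqP nsb] := eqVneq s b; first by rewrite -sbE.
have lt_sb : s < b by rewrite lt_neqAle sb andbT; exact/eqP.
pose t := Num.min b (s + r / 2).
have st : s < t by rewrite lt_min lt_sb/= ltrDl divr_gt0.
have tb : t <= b by rewrite ge_min lexx.
have tr : t <= s + r / 2 by rewrite ge_min lexx orbT.
have Et : E t.
  split; first by rewrite tb andbT (le_trans as_ (ltW st)).
  move=> u /andP[au ut]; have [us|su] := ltP u s; first exact: below.
  have Ju : J u by apply: (iJ a b) => //; rewrite au (le_trans ut).
  have dus : `|u - s| = u - s by rewrite ger0_norm// subr_ge0.
  have := Hr _ Ju; rewrite dus => H.
  have H1 : `|g u - g s| <= K * (u - s) by apply: H; lra.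
  have -> : g u - g a = (g u - g s) + (g s - g a) by ring.
  apply: le_trans (ler_normD _ _) _.
  by rewrite (_ : K * (u - a) = K * (u - s) + K * (s - a)) ?lerD//; ring.
by have := ub_le_sup hE.2 Et; rewrite -/s leNgt st.
Qed.

(** A mean value inequality that allows one-sided derivatives at the endpoints. *)
Lemma derivative_lipschitz (A J : set R) g (M : R) : is_interval J -> J `<=` A ->
  (forall x, J x -> exists2 d, derivative_within A g x d & `|d| <= M) ->
  forall x y, J x -> J y -> `|g x - g y| <= (M + 1) * `|x - y|.
Proof.
move=> iJ JA dg.
have loc x : J x -> exists2 r : R, 0 < r &
    forall y, J y -> `|y - x| < r -> `|g y - g x| <= (M + 1) * `|y - x|.
  move=> Jx; have [d gd dM] := dg _ Jx.
  move: gd => /cvgrPdist_lt /(_ 1 ltr01) -[r /= r0 Hr]; exists r => // y Jy yx.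
  have [->|/eqP nyx] := eqVneq y x; first by rewrite !subrr normr0 mulr0.
  have := Hr y; rewrite /ball_/= distrC => /(_ yx).
  have yx' : y != x by exact/eqP.
  move=> /(_ yx' (JA _ Jy)) H.
  have nz : `|y - x| != 0 by rewrite normr_eq0 subr_eq0.
  rewrite -ler_pdivrMr ?lt0r ?nz//= -normf_div.
  have -> : (g y - g x) / (y - x) = d - (d - (g y - g x) / (y - x)) by ring.
  by apply: le_trans (ler_normB _ _) _; apply: lerD => //; exact: ltW.
move=> x y Jx Jy; have [xy|/ltW yx] := leP x y.
  rewrite distrC [`|x - y|]distrC [`|y - x|]ger0_norm ?subr_ge0//.
  exact: (local_lipschitz iJ loc).
by rewrite [`|x - y|]ger0_norm ?subr_ge0//; exact: (local_lipschitz iJ loc).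
Qed.

End LocalToGlobal.

Section Cylinders.
Variables (R : realType) (S : system R).
Local Notation T := (measurableTypeR R).
Local Notation I := (state_space S).
Local Notation Z := (branches S).
Local Notation f := (dyn S).
Local Notation m := (conf_measure S).

Hypothesis cs : conformal_system S.
Hypothesis m_open : forall x y, I x -> I y -> x < y -> 0 < pr m `]x, y[%classic.
Hypothesis m_point : nonatomic S.

Lemma nd_intervalP (U : set R) : is_interval U ->
  nd_interval U \/ forall x y, U x -> U y -> x = y.
Proof.
move=> iU; have [nd|nnd] := pselect (nd_interval U); [by left|right => x y Ux Uy].
have [xy|yx|//] := ltgtP x y; exfalso; apply: nnd; split => //.
  by exists x, y.
by exists y, x.
Qed.

Lemma is_intervalI (U V : set R) : is_interval U -> is_interval V ->
  is_interval (U `&` V).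
Proof.
move=> iU iV x z [Ux Vx] [Uz Vz] y xyz.
by split; [exact: (iU x z)|exact: (iV x z)].
Qed.

(** The branches have full measure and points are null, whereas intervals are not. *)
Lemma nd_meets_branch U : nd_interval U -> U `<=` I ->
  exists2 J, Z J & nd_interval (U `&` J).
Proof.
move=> [iU [x [y [Ux Uy xy]]]] UI; apply: contrapT => H.
have [e [e1 e2 _]] := Z_index cs.
have iUe n : is_interval (U `&` e n).
  by apply: is_intervalI => //; case: (e1 n) => [/(Z_interval cs)//|-> ? ? []].
have mU : measurable (U : set T) by exact: is_interval_measurable.
have null n : m (U `&` e n) = 0%E.
  have [nd|one] := nd_intervalP (iUe n).
    case: (e1 n) => [Ze|e0]; first by exfalso; apply: H; exists (e n).
    by rewrite e0 setI0 measure0.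
  have [[z Uz]|nz] := pselect (U `&` e n !=set0); last first.
    by rewrite (_ : _ `&` _ = set0) ?measure0//; apply/seteqP; split => // z Uz; case: nz; exists z.
  rewrite (_ : _ `&` _ = [set z]); first exact: m_point.
  by apply/seteqP; split => [t Ut|_ ->//]; exact: one.
have mUe n : measurable (U `&` e n : set T) by exact: is_interval_measurable.
have [[_ _ ms _] _] := cs.
have msing : measurable (singular_part S : set T).
  by apply: measurableD; [exact: is_interval_measurable (I_interval cs)|exact: m_reg].
have sub : `]x, y[%classic `<=` (\bigcup_n (U `&` e n)) `|` singular_part S.
  move=> z; rewrite /= in_itv/= => /andP[xz zy].
  have Uz : U z by apply: (iU x y) => //; rewrite !ltW.
  have [rz|nrz] := pselect (regular_part S z); last by right; split => //; exact: UI.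
  by move: rz; rewrite (reg_bigcup e1 e2) => -[n _ ez]; left; exists n.
have := m_open (UI _ Ux) (UI _ Uy) xy; rewrite ltNge => /negP; apply.
have mxy : measurable (`]x, y[%classic : set T) by exact: measurable_itv.
have mB : measurable (\bigcup_n (U `&` e n) : set T) by exact: bigcupT_measurable.
apply: le_trans (pr_le m mxy (measurableU _ _ mB msing) sub) _.
apply: le_trans (prU_le m mB msing) _.
by rewrite /pr ms (null_bigcup mUe null)/= addr0.
Qed.

Lemma image_nd J U : Z J -> U `<=` J -> nd_interval U -> nd_interval (f @` U).
Proof.
move=> ZJ UJ [iU [x [y [Ux Uy xy]]]]; split.
  exact: (image_interval (Z_continuous cs ZJ) UJ).
have fU z : U z -> (f @` U) (f z) by move=> Uz; exists z.
case: (Z_mono cs ZJ) => H; [exists (f x), (f y)|exists (f y), (f x)].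
  by split; [exact: fU|exact: fU|exact: H (UJ _ Ux) (UJ _ Uy) xy].
by split; [exact: fU|exact: fU|exact: H (UJ _ Ux) (UJ _ Uy) xy].
Qed.

Lemma admissible_inside n U : nd_interval U -> U `<=` I ->
  exists2 V, V `<=` U & n_admissible S n V.
Proof.
elim: n U => [|n IHn] U nU UI; first by exists U.
have [J ZJ nUJ] := nd_meets_branch nU UI.
have UJJ : U `&` J `<=` J by move=> x [].
have [|V Vf [[iV [u [v [Vu Vv uv]]]] _ adm]] := IHn _ (image_nd ZJ UJJ nUJ).
  by move=> _ [x [_ Jx] <-]; apply: (Z_image cs ZJ); exists x.
have UJI : U `&` J `<=` I by move=> x [/UI].
exists ((U `&` J) `&` f @^-1` V); first by move=> x [[]].
split; last 2 first.
- by move=> x [/UJI].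
- move=> [|k] kn; first by exists J => // _ [x [[_ Jx] _] <-].
  have [K ZK kK] := adm k kn; exists K => // _ [x [_ Vx] <-].
  by apply: kK; exists (f x) => //; rewrite -iterSr.
split.
  apply: preimage_interval iV; first by case: nUJ.
  by case: (Z_mono cs ZJ) => H; [left|right] => x y /UJJ Jx /UJJ Jy; exact: H.
have [x Ux xu] := Vf _ Vu; have [y Uy yv] := Vf _ Vv.
have [xy|yx|xy] := ltgtP x y.
- by exists x, y; split => //; split => //=; rewrite ?xu ?yv.
- by exists y, x; split => //; split => //=; rewrite ?xu ?yv.
by move: uv; rewrite -xu -yv xy ltxx.
Qed.

Lemma nd_branch_unique J K V : Z J -> Z K -> nd_interval V -> V `<=` J -> V `<=` K ->
  J = K.
Proof.
move=> ZJ ZK [iV [x [y [Vx Vy xy]]]] VJ VK; apply: contrapT => JK.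
have [[_ [_ dis _ _ _]] _ _ _] : [/\ piecewise_monotone S, m I = 1%E,
  m (singular_part S) = 0%E & conformal S] by case: cs.
suff : (interior J `&` interior K) ((x + y) / 2) by rewrite (dis _ _ ZJ ZK JK).
have xyV : `]x, y[%classic `<=` V.
  move=> z; rewrite /= in_itv/= => /andP[xz zy]; apply: (iV x y) => //.
  by rewrite !ltW.
have in_int (A : set R) : V `<=` A -> interior A ((x + y) / 2).
  move=> VA; apply: (filterS (subset_trans xyV VA)).
  apply: open_nbhs_nbhs; split; first exact: interval_open.
  by rewrite /= in_itv/=; apply/andP; split; lra.
by split; exact: in_int.
Qed.

(** Images of nondegenerate intervals under branches are nondegenerate, and two distinct
    branches have disjoint interiors. *)
Lemma word_unique w w' V : size w = size w' -> branch_word S w -> branch_word S w' ->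
  nd_interval V -> V `<=` branch_domain S w -> V `<=` branch_domain S w' -> w = w'.
Proof.
elim: w w' V => [|J w IHw] [|J' w']//= V [] sw bw bw' nV Vw Vw'.
have ZJ : Z J := bw 0%N isT; have ZJ' : Z J' := bw' 0%N isT.
have VJ : V `<=` J by move=> x /Vw[_ /(_ 0%N isT)].
have VJ' : V `<=` J' by move=> x /Vw'[_ /(_ 0%N isT)].
rewrite (nd_branch_unique ZJ ZJ' nV VJ VJ'); congr cons.
apply: (IHw w' (f @` V)) => //.
- by move=> k kw; exact: (bw k.+1).
- by move=> k kw; exact: (bw' k.+1).
- exact: (image_nd ZJ VJ nV).
- move=> _ [x Vx <-]; split; first by apply: (Z_image cs ZJ); exists x => //; exact: VJ.
  by move=> k kw; rewrite -iterSr; have [_ /(_ k.+1)] := Vw _ Vx; apply.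
- move=> _ [x Vx <-]; split; first by apply: (Z_image cs ZJ); exists x => //; exact: VJ.
  by move=> k kw; rewrite -iterSr; have [_ /(_ k.+1)] := Vw' _ Vx; apply.
Qed.

Lemma admissible_word n V : n_admissible S n V ->
  exists w, [/\ size w = n, branch_word S w & V `<=` branch_domain S w].
Proof.
move=> [nV VI adm].
have /choice[K KP] : forall k, exists J, (k < n)%N -> Z J /\ iter k f @` V `<=` J.
  move=> k; have [kn|] := ltnP k n; last by exists set0.
  by have [J ZJ kJ] := adm _ kn; exists J.
exists (mkseq K n); split; rewrite ?size_mkseq//.
  by move=> k; rewrite size_mkseq => kn; rewrite nth_mkseq//; case: (KP _ kn).
move=> x Vx; split; first exact: VI.
move=> k; rewrite size_mkseq => kn; rewrite nth_mkseq//.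
by have [_] := KP _ kn; apply; exists x.
Qed.

(** The cylinder is the domain of the word of [V]: by uniqueness of this word, every
    admissible interval containing [V] is inside that domain. *)
Lemma cylinder_extends n V : n_admissible S n V -> exists2 C, cylinders S n C & V `<=` C.
Proof.
move=> aV; have [w [sw bw Vw]] := admissible_word aV.
have nV : nd_interval V by case: aV.
exists (branch_domain S w) => //; split; last first.
  move=> K aK wK; have [w' [sw' bw' Kw']] := admissible_word aK.
  have VK : V `<=` K by exact: subset_trans wK.
  suff ww : w = w' by apply/seteqP; split => //; rewrite ww.
  apply: (word_unique _ bw bw' nV Vw); first by rewrite sw.
  exact: subset_trans Kw'.
split.
- split; first exact: (branch_domain_interval cs).
  by have [_ [x [y [Vx Vy xy]]]] := nV; exists x, y; split => //; exact: Vw.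
- by move=> x [].
move=> k kn; exists (nth set0 w k); first by apply: bw; rewrite sw.
by move=> _ [x [_ Hx] <-]; apply: Hx; rewrite sw.
Qed.

End Cylinders.

Section Transfer.
Variables (R : realType) (S : system R) (Y : set R).
Local Notation T := (measurableTypeR R).
Local Notation I := (state_space S).
Local Notation f := (dyn S).
Local Notation m := (conf_measure S).

Hypothesis cs : conformal_system S.
Hypothesis m_open : forall x y, I x -> I y -> x < y -> 0 < pr m `]x, y[%classic.
Hypothesis m_point : nonatomic S.
Hypothesis YI : Y `<=` I.
Hypothesis nY : nd_interval Y.

Let iY : is_interval Y. Proof. by case: nY. Qed.

(** A cylinder may touch [Y] at a single point, where nothing can be said of the orbit. *)
Definition fat N (C : set R) : Prop := cylinders S N C /\ nd_interval (C `&` Y).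

Lemma fat_dense N U : nd_interval U -> U `<=` Y ->
  exists2 C, fat N C & U `&` C !=set0.
Proof.
move=> nU UY.
have [V VU aV] := admissible_inside cs m_open m_point N nU (subset_trans UY YI).
have [C cC VC] := cylinder_extends cs aV.
have [[_ [x [y [Vx Vy xy]]]] _ _] := aV.
exists C; last by exists x; split; [exact: VU|exact: VC].
split => //; split; last first.
  by exists x, y; split => //; split; [exact: VC|exact/UY/VU|exact: VC|exact/UY/VU].
by apply: is_intervalI iY; case: cC => [[[]]].
Qed.

(** A point of [Y] outside all fat cylinders that is not an endpoint of any of them has
    a neighbourhood in [Y] without fat cylinders, against [fat_dense]. *)
Lemma fat_remainder N : finite_set [set C | cylinders S N C /\ C `&` Y !=set0] ->
  exists2 E : set R, finite_set E &
    forall p, Y p -> ~ E p -> exists2 C, fat N C & C p.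
Proof.
move=> fin; have finF : finite_set (fat N).
  by apply: sub_finite_set fin => C [cC [_ [x [_ [Cx _ _]]]]]; split => //; exists x.
pose E := [set sup (C `&` Y) | C in fat N] `|` [set inf (C `&` Y) | C in fat N].
have finE : finite_set E by rewrite finite_setU; split; exact: finite_image.
exists E => // p Yp nEp; apply: contrapT => H.
have nC C : fat N C -> ~ C p by move=> fC Cp; apply: H; exists C.
have [r r0 Hr] := finite_gap p finE.
have far C u : fat N C -> C u -> Y u -> r <= `|u - p|.
  move=> fC Cu Yu; have [[iC _] _] : nd_interval C /\ True by case: fC => [[[]]].
  have iCY : is_interval (C `&` Y) by exact: is_intervalI.
  have np v w : C v -> Y v -> C w -> Y w -> v <= p <= w -> False.
    by move=> Cv Yv Cw Yw vpw; apply: (nC _ fC); exact: (iC v w).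
  have [up|pu|up] := ltgtP u p; last by exfalso; apply: (nC _ fC); rewrite -up.
    have ub : ubound (C `&` Y) p.
      by move=> w [Cw Yw]; rewrite leNgt; apply/negP => pw; apply: (np u w);
        rewrite // !ltW.
    have us : u <= sup (C `&` Y) by apply: ub_le_sup; [exists p|].
    have sp : sup (C `&` Y) <= p by apply: ge_sup => //; exists u.
    have Es : E (sup (C `&` Y)) by left; exists C.
    have ne : sup (C `&` Y) <> p by move=> e; apply: nEp; rewrite -e.
    apply: le_trans (Hr _ Es ne) _.
    rewrite !ler0_norm ?subr_le0//; last exact: ltW.
    by rewrite !opprB lerB.
  have lb : lbound (C `&` Y) p.
    by move=> w [Cw Yw]; rewrite leNgt; apply/negP => pw; apply: (np w u);
      rewrite // !ltW.
  have us : inf (C `&` Y) <= u by apply: ge_inf; [exists p|].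
  have sp : p <= inf (C `&` Y) by apply: lb_le_inf => //; exists u.
  have Es : E (inf (C `&` Y)) by right; exists C.
  have ne : inf (C `&` Y) <> p by move=> e; apply: nEp; rewrite -e.
  apply: le_trans (Hr _ Es ne) _.
  rewrite !ger0_norm ?subr_ge0//; last exact: ltW.
  by rewrite lerB.
pose U := Y `&` `]p - r, p + r[%classic.
have nU : nd_interval U.
  split; first by apply: is_intervalI => //; exact: interval_is_interval.
  have pU q : Y q -> `|q - p| < r -> U q.
    by move=> Yq; rewrite ltr_distl => H'; split => //=; rewrite in_itv.
  have Up : U p by apply: pU => //; rewrite subrr normr0.
  have [_ [x [y [Yx Yy xy]]]] := nY.
  have [xp|px] := ltP x p.
    exists (Num.max x (p - r / 2)), p.
    have Yq : Y (Num.max x (p - r / 2)).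
      by apply: (iY Yx Yp); rewrite le_max lexx/= ge_max (ltW xp)/= lerBlDr lerDl; lra.
    split => //; last by rewrite gt_max xp/=; lra.
    apply: pU => //; rewrite distrC ger0_norm; last first.
      by rewrite subr_ge0 ge_max (ltW xp)/=; lra.
    have : p - r / 2 <= Num.max x (p - r / 2) by rewrite le_max lexx orbT.
    by move: (Num.max _ _) => z; lra.
  have py : p < y by exact: le_lt_trans xy.
  exists p, (Num.min y (p + r / 2)).
  have Yq : Y (Num.min y (p + r / 2)).
    by apply: (iY Yp Yy); rewrite ge_min lexx/= le_min (ltW py)/=; lra.
  split => //; last by rewrite lt_min py/=; lra.
  apply: pU => //; rewrite ger0_norm; last first.
    by rewrite subr_ge0 le_min (ltW py)/=; lra.
  have : Num.min y (p + r / 2) <= p + r / 2 by rewrite ge_min lexx orbT.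
  by move: (Num.min _ _) => z; lra.
have [C fC [u [[Yu]]]] := fat_dense N nU (@subIsetl _ _ _).
rewrite /= in_itv/= => uU Cu; have := far _ _ fC Cu Yu.
by rewrite leNgt ltr_distl uU.
Qed.

Lemma fat_length N : finite_set [set C | cylinders S N C /\ C `&` Y !=set0] ->
  exists2 l : R, 0 < l & forall C, fat N C -> exists x y,
    [/\ C x /\ Y x, C y /\ Y y & l <= y - x].
Proof.
move=> fin; have finF : finite_set (fat N).
  by apply: sub_finite_set fin => C [cC [_ [x [_ [Cx _ _]]]]]; split => //; exists x.
pose D C := [set d : R | 0 < d /\ exists x y, [/\ C x /\ Y x, C y /\ Y y & d = y - x]].
pose len C := xget 1 (D C).
have lenP C : fat N C -> D C (len C).
  move=> [_ [_ [x [y [Cx Cy xy]]]]]; rewrite /len; case: xgetP => // /(_ (y - x)) [].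
  by split; [rewrite subr_gt0|exists x, y].
have [r r0 Hr] := finite_gap 0 (finite_image len finF).
exists r => // C fC; have [l0 [x [y [Cx Cy E]]]] := lenP _ fC.
exists x, y; split => //; rewrite -E.
have rl : (len @` fat N) (len C) by exists C.
have := Hr _ rl; rewrite subr0 ger0_norm; last exact: ltW.
by apply=> E0; rewrite E0 ltxx in l0.
Qed.

(** Density of the visits to [Y] propagates to the whole interval: every point is
    close to some [iter j f p] with [p] in [Y] and [j] bounded, and on the finitely many
    cylinders of length [N1] meeting [Y] the maps [iter j f] are Lipschitz. *)
Lemma cov_dense : cov S Y -> exists k d1 N1, [/\ 1 <= k, 0 < d1 &
  forall d n x, 0 < d -> d < d1 ->
    (forall p, Y p -> exists t, [/\ (t <= n)%N, Y (iter t f x) &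
       `|iter t f x - p| <= d / k]) ->
    delta_dense S d [set iter j f x | j in `I_(n + N1).+1]].
Proof.
move=> [N1 [onto fin [M HM]]].
have [E finE HE] := fat_remainder fin; have [l l0 Hl] := fat_length fin.
pose K := Num.max 0 M + 1.
have MK : M + 1 <= K by rewrite lerD2r le_max lexx orbT.
have K1 : 1 <= K by rewrite lerDr le_max lexx.
have K0 : 0 < K by exact: lt_le_trans K1.
have lip C j x y : fat N1 C -> (j <= N1)%N -> C x -> Y x -> C y -> Y y ->
    `|iter j f x - iter j f y| <= K * `|x - y|.
  move=> [[aC _] [iCY _]] jN Cx Yx Cy Yy; have [w [sw bw Cw]] := admissible_word aC.
  case: j jN => [|j] jN; first by rewrite /= ler_peMl.
  have st : size (take j.+1 w) = j.+1 by rewrite size_takel// sw.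
  apply: le_trans (_ : _ <= (M + 1) * `|x - y|) _; last exact: ler_wpM2r.
  apply: (@derivative_lipschitz R (branch_domain S (take j.+1 w)) (C `&` Y)) => //.
    move=> z [/Cw[Iz zw] _]; split => // i; rewrite st => ij.
    by rewrite nth_take//; apply: zw; rewrite sw; exact: leq_trans ij jN.
  move=> z [Cz Yz].
  have [|||d dz dM] := HM (take j.+1 w) z _ _ Yz.
  - by rewrite st.
  - move=> i; rewrite st => ij; rewrite nth_take//; apply: bw; rewrite sw.
    exact: leq_trans ij jN.
  - have [Iz zw] := Cw _ Cz; split => // i; rewrite st => ij.
    by rewrite nth_take//; apply: zw; rewrite sw; exact: leq_trans ij jN.
  by exists d => //; move: dz; rewrite /branch_derivative st.
pose F := \bigcup_(j in `I_N1.+1) (iter j f @` E).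
have finF : finite_set F.
  by apply: bigcup_finite; [exact: finite_II|move=> j _; exact: finite_image].
have [iI' [a' [b' [Ya Yb ab]]]] := nY.
have iI : is_interval I := I_interval cs.
exists (4 * K), l, N1; split; [lra|by []|].
move=> d n x d0 dl vis y Iy.
(* The target may lie on the orbit of a point of [Y] in no fat cylinder, but such points
   are finitely many. *)
have [y' Iy' [nF yy]] : exists2 y', I y' & ~ F y' /\ `|y' - y| <= d / 2.
  have [r r0 Hr] := finite_gap y finF.
  pose h := Num.min (r / 2) (Num.min (d / 2) ((b' - a') / 2)).
  have h0 : 0 < h by rewrite !lt_min; apply/and3P; split; lra.
  have hr : h <= r / 2 by rewrite ge_min lexx.
  have hd : h <= d / 2 by rewrite !ge_min lexx orbT.
  have hb : h <= (b' - a') / 2 by rewrite !ge_min lexx !orbT.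
  have good z : I z -> `|z - y| = h -> exists2 y', I y' & ~ F y' /\ `|y' - y| <= d / 2.
    move=> Iz zy; exists z => //; rewrite zy; split => // Fz.
    have zy' : z <> y by move=> e; move: zy; rewrite e subrr normr0 => h00; rewrite -h00 ltxx in h0.
    by have := Hr _ Fz zy'; rewrite zy; clear -hr r0; lra.
  have [yab|aby] := leP y ((a' + b') / 2).
    apply: (good (y + h)); last by rewrite addrC addKr gtr0_norm.
    by apply: (iI _ _ Iy (YI Yb)); apply/andP; split; lra.
  apply: (good (y - h)); last by rewrite addrC addKr normrN gtr0_norm.
  by apply: (iI _ _ (YI Ya) Iy); apply/andP; split; lra.
have [j jN [p Yp py]] : (\bigcup_(n in `I_N1.+1) (iter n f @` Y)) y' by rewrite onto.
have nEp : ~ E p by move=> Ep; apply: nF; exists j => //; exists p.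
have [C fC Cp] := HE _ Yp nEp.
have [u [v [[Cu Yu] [Cv Yv] uv]]] := Hl _ fC.
have [iC _] : nd_interval C by case: fC => [[[]]].
pose e := d / (4 * K).
have e0 : 0 < e by rewrite divr_gt0// mulr_gt0.
have eK : 4 * K * e = d by rewrite mulrC divfK// mulf_neq0// gt_eqF.
have el : e < l / 4.
  by apply: (@le_lt_trans _ _ (d / 4)); [rewrite ler_pdivlMr// -eK mulrC; nra|lra].
(* A centre inside the cylinder all of whose e-neighbours are in it too. *)
have [q [Yq qp qC]] : exists q, [/\ Y q, `|q - p| <= e &
    forall z, Y z -> `|z - q| <= e -> C z].
  have [puv|uvp] := leP p ((u + v) / 2).
    exists (p + e); split.
    - by apply: (iY Yp Yv); apply/andP; split; lra.
    - by rewrite addrC addKr gtr0_norm.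
    by move=> z _; rewrite ler_distl => /andP[z1 z2]; apply: (iC _ _ Cp Cv); apply/andP; split; lra.
  exists (p - e); split.
  - by apply: (iY Yu Yp); apply/andP; split; lra.
  - by rewrite addrC addKr normrN gtr0_norm.
  by move=> z _; rewrite ler_distl => /andP[z1 z2]; apply: (iC _ _ Cu Cp); apply/andP; split; lra.
have [t [tn Yt tq]] := vis _ Yq.
have Ct : C (iter t f x) by exact: qC.
exists (iter (j + t) f x).
  by exists (j + t)%N => //=; rewrite ltnS addnC leq_add.
have jN' : (j <= N1)%N by [].
have := lip _ _ _ _ fC jN' Ct Yt Cp Yp; rewrite -iterD py => H.
have tp : `|iter t f x - p| <= 2 * e.
  have := ler_normD (iter t f x - q) (q - p); rewrite subrKA.
  by move: tq qp; rewrite -/e; clear; lra.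
have : `|iter (j + t) f x - y'| <= d / 2.
  by apply: le_trans H _; rewrite -eK; clear -tp K0; nra.
have := ler_normD (y - y') (y' - iter (j + t) f x); rewrite subrKA.
rewrite [`|y' - iter _ _ _|]distrC [`|y - y'|]distrC; move: yy; clear; lra.
Qed.

End Transfer.

(** * Summing the tail of the return time *)

Section TailSum.
Variable R : realType.

(** Blocks between consecutive powers of two: the block starting at [2 ^ J]
    contributes at most a multiple of [2 ^ (J (2 - gamma))]. *)
Lemma tail_sum (t : nat -> R) (gamma K : R) N0 : 2 < gamma -> 0 <= K ->
  (forall n, 0 <= t n <= 1) -> (forall n k, (n <= k)%N -> t k <= t n) ->
  (forall n, (N0 <= n)%N -> t n <= K * n%:R `^ (- gamma)) ->
  exists2 M, 0 < M & forall N, \sum_(n < N) n.+1%:R * t n <= M.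
Proof.
move=> g2 K0 t01 tni tK.
have t0 n : 0 <= t n by case/andP: (t01 n).
have t1 n : t n <= 1 by case/andP: (t01 n).
pose a : R := 2 `^ (2 - gamma).
have a0 : 0 <= a by exact: powR_ge0.
have a1 : a < 1.
  rewrite /a -ltr_ln ?posrE ?powR_gt0// ln_powR ln1 nmulr_rlt0; last lra.
  by rewrite ln_gt0; lra.
pose s N := \sum_(n < N) n.+1%:R * t n.
have s_ge0 N : 0 <= s N by apply: sumr_ge0 => i _; exact: mulr_ge0.
have s_le N N' : (N <= N')%N -> s N <= s N'.
  move=> /subnKC <-; rewrite /s big_split_ord/= lerDl; apply: sumr_ge0 => i _.
  exact: mulr_ge0.
have block J : (N0 <= 2 ^ J)%N -> s (2 ^ J.+1)%N <= s (2 ^ J)%N + 2 * K * a ^+ J.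
  move=> NJ; rewrite /s expnS mul2n -addnn big_split_ord/= lerD2l.
  apply: (@le_trans _ _ (\sum_(i < 2 ^ J) 2 * 2 ^+ J * (K * (2 ^+ J) `^ (- gamma)))).
    apply: ler_sum => i _; apply: ler_pM => //.
      rewrite -natrX -natrM ler_nat mul2n -addnn -addnS leq_add2l.
      exact: ltn_ord.
    apply: le_trans (tni _ _ (leq_addr i (2 ^ J))) _.
    by have := tK _ NJ; rewrite natrX.
  rewrite sumr_const card_ord -[_ *+ (2 ^ J)]mulr_natl natrX.
  have -> : a ^+ J = 2 ^+ J * 2 ^+ J * (2 ^+ J) `^ (- gamma).
    have p2 : (0 : R) < 2 ^+ J by rewrite exprn_gt0.
    have -> : a ^+ J = (2 ^+ J) `^ (2 - gamma).
      have E2 : (2 : R) ^+ J = 2 `^ J%:R by rewrite powR_mulrn.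
      by rewrite E2 -powRrM mulrC powRrM powR_mulrn// powR_ge0.
    by rewrite powRD ?(gt_eqF p2) ?implybT// powR_mulrn ?(ltW p2)// expr2.
  set z := _ `^ _; set w := 2 ^+ J; rewrite le_eqVlt; apply/orP; left; apply/eqP; ring.
have pos1 : 0 <= 2 * K / (1 - a) by rewrite divr_ge0 ?mulr_ge0// subr_ge0 ltW.
exists (s (2 ^ N0)%N + 2 * K / (1 - a) + 1).
  by apply: ltr_pwDr => //; exact: addr_ge0.
move=> N; rewrite -/(s N).
have bJ J : s (2 ^ (N0 + J))%N <= s (2 ^ N0)%N + 2 * K * \sum_(j < J) a ^+ j.
  elim: J => [|J IHJ]; first by rewrite addn0 big_ord0 mulr0 addr0.
  rewrite addnS; apply: le_trans (block _ _) _.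
    by apply: leq_trans (leq_addr J N0) _; exact/ltnW/ltn_expl.
  rewrite big_ord_recr/= mulrDr addrA; apply: lerD IHJ _.
  apply: ler_wpM2l; first exact: mulr_ge0.
  by apply: ler_wiXn2l => //; [exact: ltW|exact: leq_addl].
apply: le_trans (s_le _ (2 ^ (N0 + N))%N _) _.
  by apply: leq_trans (leq_addl N0 N) _; exact/ltnW/ltn_expl.
apply: le_trans (bJ N) _; rewrite -addrA lerD2l ler_wpDr//.
by apply: ler_wpM2l; [exact: mulr_ge0|exact: geometric_sum_le].
Qed.

End TailSum.

(** * Bounds for means *)

Section BoundedIntegrals.
Variables (R : realType) (mu : probability (measurableTypeR R) R)
  (D : set (measurableTypeR R)) (mD : measurable D).
Local Notation T := (measurableTypeR R).
Local Open Scope ereal_scope.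

(** The integral of a nonnegative function is the supremum of the integrals of the simple
    functions below it, so it is monotone for arbitrary functions, in particular for the
    cover time. *)
Lemma le_integral_ge0 (g h : T -> \bar R) : (forall x, D x -> 0 <= g x) ->
  (forall x, D x -> g x <= h x) -> \int[mu]_(x in D) g x <= \int[mu]_(x in D) h x.
Proof.
move=> g0 gh; have h0 x : D x -> 0 <= h x.
  by move=> Dx; exact: le_trans (g0 _ Dx) (gh _ Dx).
rewrite !ge0_integralE//; apply: ereal_sup_le => z [k kg <-].
exists k => //= x; apply: le_trans (kg x) _; rewrite /patch; case: ifPn => // xD.
by apply: gh; rewrite inE in xD.
Qed.

Definition mean_le (g : T -> \bar R) (e : R) : Prop :=
  [/\ measurable_fun D g, forall x, D x -> 0 <= g x &
      \int[mu]_(x in D) g x <= e%:E].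

Lemma mean_le_indic (A : set T) (e : R) : measurable A -> (pr mu A <= e)%R ->
  mean_le (fun x => (\1_A x)%:E) e.
Proof.
move=> mA Ae; split; first exact/measurable_EFinP/measurable_funTS.
  by move=> x _; rewrite lee_fin.
rewrite integral_indic//; apply: le_trans (_ : _ <= mu A) _.
  by apply: le_measure; rewrite ?inE//; exact: measurableI.
by rewrite -prE// lee_fin.
Qed.

Lemma mean_leZ (c : R) g e : (0 <= c)%R -> mean_le g e ->
  mean_le (fun x => c%:E * g x) (c * e).
Proof.
move=> c0 [mg g0 ge]; split; first exact: measurable_funeM.
  by move=> x Dx; rewrite mule_ge0// g0.
by rewrite ge0_integralZl_EFin// EFinM lee_wpmul2l.
Qed.

Lemma mean_leD g h e e' : mean_le g e -> mean_le h e' ->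
  mean_le (fun x => g x + h x) (e + e').
Proof.
move=> [mg g0 ge] [mh h0 he]; split; first exact: emeasurable_funD.
  by move=> x Dx; rewrite adde_ge0// ?g0 ?h0.
by rewrite ge0_integralD// EFinD leeD.
Qed.

Lemma mean_leW g e e' : (e <= e')%R -> mean_le g e -> mean_le g e'.
Proof. by move=> ee [mg g0 ge]; split => //; apply: le_trans ge _; rewrite lee_fin. Qed.

Lemma mean_le_sum (g : nat -> T -> \bar R) (e : nat -> R) N :
  (forall n, mean_le (g n) (e n)) ->
  mean_le (fun x => \sum_(n < N) g n x) (\sum_(n < N) e n).
Proof.
move=> ge; elim: N => [|N IHN].
  rewrite big_ord0 (_ : (fun x => _) = cst 0); last first.
    by apply/funext => x; rewrite big_ord0.
  by split => //; rewrite integral0.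
rewrite big_ord_recr/= (_ : (fun x => _) = (fun x => \sum_(n < N) g n x + g N x)).
  exact: mean_leD.
by apply/funext => x; rewrite big_ord_recr.
Qed.

Lemma mean_le_series (g : nat -> T -> \bar R) (e : nat -> R) (M : R) :
  (forall n, mean_le (g n) (e n)) -> (forall N, (\sum_(n < N) e n <= M)%R) ->
  mean_le (fun x => \sum_(0 <= n <oo) g n x) M.
Proof.
move=> ge eM; have g0 n x : D x -> 0 <= g n x by case: (ge n) => _ + _; apply.
have mg n : measurable_fun D (g n) by case: (ge n).
split.
- by apply: ge0_emeasurable_sum => // n x Dx _; exact: g0.
- by move=> x Dx; apply: nneseries_ge0 => n _ _; exact: g0.
rewrite integral_nneseries//; apply: lime_le.
  by apply: is_cvg_nneseries => n _ _; apply: integral_ge0 => x; exact: g0.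
apply: nearW => N; rewrite big_mkord; apply: le_trans (_ : _ <= (\sum_(n < N) e n)%:E) _.
  by rewrite -sumEFin; apply: lee_sum => n _; case: (ge n).
by rewrite lee_fin.
Qed.

End BoundedIntegrals.

(** * The mean cover time: upper bound *)

Section Assembly.
Variables (R : realType) (S : system R) (Y : set R) (iY : is_interval Y).
Local Notation T := (measurableTypeR R).
Local Notation I := (state_space S).
Local Notation f := (dyn S).
Local Notation m := (conf_measure S).
Local Notation mu := (inv_measure S).
Local Notation G0 := (first_return S iY).
Local Notation tau := (return_nat S Y).

Hypothesis im : interval_map S.
Hypothesis YI : Y `<=` I.
Hypothesis muY : (0 < mu Y)%E.

Variable G : coded R.
Hypotheses (GY : cY G = Y) (GX : cX G = repeller G0) (GF : cF G = dyn G0)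
  (GP : cP G = inv_measure G0).
Hypothesis Gtau : forall x y, cX G x -> cX G y -> cbr G x = cbr G y -> tau x = tau y.
Local Notation X := (cX G).
Local Notation F := (cF G).
Local Notation P := (cP G).
Local Notation cyl := (cylindrical (cX G) (cF G) (cbr G)).
Local Notation pre := (hit_at (cX G) (cF G)).

Let cs : conformal_system S. Proof. by case: im. Qed.

Let mI : measurable (I : set T).
Proof. exact: is_interval_measurable (I_interval cs). Qed.

Let mY : measurable (Y : set T). Proof. exact: is_interval_measurable. Qed.

Let pY : 0 < pr mu Y. Proof. by rewrite -lte_fin prE. Qed.

Let XY x : X x -> Y x. Proof. by move=> /cXY; rewrite GY. Qed.

Definition late n : set T := [set x | X x /\ (n < tau x)%N].

Lemma cyl_late n : cyl 1 (late n).
Proof. exact: (cyl_tau Gtau (fun k => n < k)%N). Qed.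

Lemma m_late n : measurable (late n).
Proof. exact: m_cyl (cyl_late n). Qed.

Lemma late_tail n : pr P (late n) <=
  fine (inv_measure G0 (Y `&` [set x | (n%:R%:E < return_time S Y x)%E])).
Proof.
have -> : Y `&` [set x | (n%:R%:E < return_time S Y x)%E] =
    Y `\` \bigcup_(k < n) (I `&` iter k.+1 f @^-1` Y).
  apply/seteqP; split => x [Yx Hx]; split => //.
    move=> [k /= kn [_ Yk]]; move: Hx; rewrite /= ltNge => /negP; apply.
    apply: (@le_trans _ _ k.+1%:R%:E); last by rewrite lee_fin ler_nat.
    by apply: ereal_inf_lbound; exists k.+1.
  have [[k [k0 Yk _ E]]|[E _]] := @first_timeP R (fun n => Y (iter n f x)); last first.
    by rewrite /= /return_time E ltry.
  rewrite /= /return_time E lte_fin ltr_nat ltnNge; apply/negP => kn.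
  apply: Hx; exists k.-1; first by rewrite /= prednK.
  by split; [exact: YI|rewrite /= -iterS prednK].
rewrite -GP; apply: pr_le; first exact: m_late.
  apply: measurableD => //; apply: bigcup_measurable => k _.
  exact: (m_iter_preimage im).
move=> x [Xx nt]; split; first exact: XY.
move=> [k /= kn [_ Yk]]; have rx : repeller G0 x by rewrite -GX.
have [_ _ tY] := tau_spec rx; apply: (tY k.+1) => //=.
exact: leq_ltn_trans nt.
Qed.

Lemma late_sum (gamma : R) : 2 < gamma ->
  (fun n : nat => fine (inv_measure G0
     (Y `&` [set x | (n%:R%:E < return_time S Y x)%E])))
    =O_\oo (fun n : nat => n%:R `^ (- gamma)) ->
  exists2 M, 0 < M & forall N, \sum_(n < N) n.+1%:R * pr P (late n) <= M.
Proof.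
move=> g2 /eqO_exP[K K0 [N0 _ HK]]; apply: (@tail_sum R (fun n => pr P (late n)) gamma K N0) => //.
- exact: ltW.
- by move=> n; rewrite pr_ge0 pr_le1//; exact: m_late.
- move=> n k nk; apply: pr_le; [exact: m_late|exact: m_late|].
  by move=> x [Xx kx]; split => //; exact: leq_ltn_trans kx.
move=> n Nn; apply: le_trans (late_tail n) _.
have := HK n Nn; rewrite /= [`|_ `^ _|]ger0_norm ?powR_ge0//.
by apply: le_trans; exact: ler_norm.
Qed.

Lemma cover_time_ge0 d x : (0 <= cover_time S d x)%E.
Proof. by apply: le_ereal_inf_tmp => _ [n _ <-]; rewrite lee_fin. Qed.

Lemma cover_time_le d x n : (0 < n)%N -> delta_dense S d [set iter k f x | k in `I_n.+1] ->
  (cover_time S d x <= n%:R%:E)%E.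
Proof. by move=> n0 Hn; apply: ereal_inf_lbound; exists n. Qed.

Lemma cover_time_ge d x (r : R) :
  (forall n, (0 < n)%N -> delta_dense S d [set iter k f x | k in `I_n.+1] -> r <= n%:R) ->
  (r%:E <= cover_time S d x)%E.
Proof. by move=> H; apply: le_ereal_inf_tmp => _ [n [n0 Hn] <-]; rewrite lee_fin H. Qed.

Lemma delta_dense_le d x n k : (n <= k)%N ->
  delta_dense S d [set iter j f x | j in `I_n.+1] ->
  delta_dense S d [set iter j f x | j in `I_k.+1].
Proof.
move=> nk H y Iy; have [_ [j jn <-] yj] := H _ Iy; exists (iter j f x) => //.
by exists j => //=; exact: leq_trans jn _.
Qed.

Lemma retE t x : X x -> ret S iY t x = \sum_(k < t) tau (iter k F x).
Proof. by rewrite /ret GF. Qed.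

Lemma ret_mul q B x : X x ->
  ret S iY (q * B) x = \sum_(i < q) \sum_(b < B) tau (iter (i * B + b) F x).
Proof.
move=> Xx; elim: q => [|q IHq]; first by rewrite mul0n !big_ord0 retE// big_ord0.
rewrite retE// mulSn addnC big_split_ord/= big_ord_recr/= -IHq retE//.
Qed.

Lemma nneseries_ge_term (u : nat -> \bar R) k : (forall n, 0 <= u n)%E ->
  (u k <= \sum_(0 <= n <oo) u n)%E.
Proof.
move=> u0; apply: le_trans (nneseries_lim_ge k.+1 _); last by move=> n _ _.
by rewrite big_nat_recr//= leeDr// sume_ge0.
Qed.

Section UpperBound.
Variables (M : R) (k d1 : R) (N1 : nat).
Hypothesis M0 : 0 < M.
Hypothesis HM : forall N, \sum_(n < N) n.+1%:R * pr P (late n) <= M.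
Hypothesis dense : forall d n x, 0 < d -> d < d1 ->
    (forall p, Y p -> exists t, [/\ (t <= n)%N, Y (iter t f x) &
       `|iter t f x - p| <= d / k]) ->
    delta_dense S d [set iter j f x | j in `I_(n + N1).+1].
Variables (d : R) (B : nat) (Bad : nat -> set R) (E : R).
Hypotheses (d0 : 0 < d) (dd1 : d < d1) (B0 : (0 < B)%N).
Hypothesis cBad : forall q, cyl (q * B) (Bad q).
Hypothesis BadE : forall Q, \sum_(q < Q) pr P (Bad q) <= E.
Hypothesis Bad_dense : forall q x p, X x -> ~ Bad q x -> Y p ->
        exists2 t, (t < q * B)%N & `|iter t F x - p| <= d / k.

Let late0 n : 0 <= pr P (late n). Proof. exact: pr_ge0. Qed.

Let sum_late N : \sum_(n < N) pr P (late n) <= M.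
Proof.
apply: le_trans (HM N); apply: ler_sum => n _.
by rewrite ler_peMl// ler1n.
Qed.

Definition slow n i b j : set T := entrance S Y n (Bad i `&` pre (i * B + b) (late j)).

Definition never : set T := I `\` \bigcup_n entrance S Y n X.

(** The time of the first entrance, plus the durations of the returns in the bad blocks,
    as a series of indicators: the return time of a point is the number of the [j] for
    which the point is in [late j].  The last series makes the bound infinite on the
    points that never enter [Y]. *)
Definition cover_bound (x : T) : \bar R :=
  (\sum_(0 <= n <oo)
     ((n + N1).+1%:R%:E * (\1_(entrance S Y n X) x)%:E +
      \sum_(0 <= i <oo) \sum_(b < B) \sum_(0 <= j <oo) (\1_(slow n i b j) x)%:E) +
   \sum_(0 <= n <oo) (\1_never x)%:E)%E.

Lemma m_slow n i b j : measurable (slow n i b j).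
Proof.
apply: (m_entrance iY im); apply: measurableI; first exact: m_cyl (cBad i).
by apply: m_pre; exact: m_late.
Qed.

Lemma slow_le n i b j : pr mu (slow n i b j) <=
  pr mu Y * (cK G * pr P (late n)) * (cK G * pr P (Bad i)) * pr P (late j).
Proof.
have cB : cyl (i * B + b) (Bad i) by apply: cyl_le (cBad i); exact: leq_addr.
have cS := cyl_setI_pre (@cFX R G) cB (cyl_late j).
apply: le_trans (entrance_cyl im muY GY GX GF GP Gtau n cS) _.
rewrite -!mulrA ler_pM2l//; apply: ler_wpM2l; first by apply: le_trans (cK1 G).
by apply: ler_wpM2l; [exact: pr_ge0|exact: qb_le cB (cyl_late j)].
Qed.

Lemma cover_bound_mean : mean_le mu I cover_bound
  (pr mu Y * cK G * N1.+1%:R * M + pr mu Y * cK G * cK G * (B%:R * M * E) * M).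
Proof.
have K0 : 0 < cK G by apply: lt_le_trans (cK1 G).
have mX : measurable (X : set T) := @cmX R G.
have lvl3 n i b : mean_le mu I (fun x => \sum_(0 <= j <oo) (\1_(slow n i b j) x)%:E)%E
    (pr mu Y * (cK G * pr P (late n)) * (cK G * pr P (Bad i)) * M).
  apply: (mean_le_series mI (fun j => mean_le_indic mI (m_slow n i b j) (slow_le n i b j))).
  move=> N; rewrite -mulr_sumr; apply: ler_wpM2l (sum_late N).
  by rewrite !mulr_ge0 ?pr_ge0// ltW.
have lvl2 n i := mean_le_sum mI B (lvl3 n i).
have lvl1 n : mean_le mu I
    (fun x => \sum_(0 <= i <oo) \sum_(b < B) \sum_(0 <= j <oo) (\1_(slow n i b j) x)%:E)%E
    (pr mu Y * cK G * cK G * (B%:R * M * E) * pr P (late n)).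
  apply: (mean_le_series mI (lvl2 n)) => N.
  under eq_bigr do rewrite sumr_const card_ord -[_ *+ B]mulr_natl.
  have -> : pr mu Y * cK G * cK G * (B%:R * M * E) * pr P (late n) =
    pr mu Y * cK G * cK G * (B%:R * M) * pr P (late n) * E by ring.
  rewrite (eq_bigr (fun i : 'I_N => pr mu Y * cK G * cK G * (B%:R * M) * pr P (late n) *
    pr P (Bad i))); last by move=> i _; ring.
  rewrite -mulr_sumr; apply: ler_wpM2l (BadE N).
  by rewrite !mulr_ge0 ?pr_ge0// ltW.
have lvl0 n : mean_le mu I
    (fun x => (n + N1).+1%:R%:E * (\1_(entrance S Y n X) x)%:E)%E
    (pr mu Y * cK G * N1.+1%:R * (n.+1%:R * pr P (late n))).
  apply: (@mean_leW _ _ _ _ ((n + N1).+1%:R * (pr mu Y * (cK G * pr P (late n))))).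
    have -> : pr mu Y * cK G * N1.+1%:R * (n.+1%:R * pr P (late n)) =
      (N1.+1%:R * n.+1%:R) * (pr mu Y * (cK G * pr P (late n))) by ring.
    apply: ler_wpM2r; first by rewrite !mulr_ge0 ?pr_ge0// ltW.
    by rewrite -natrM ler_nat mulSn mulnS addSn ltnS leq_add2l leq_addr.
  apply: mean_leZ => //; apply: mean_le_indic => //; first exact: (m_entrance iY im).
  have := entrance_cyl im muY GY GX GF GP Gtau n (cylT X F (cbr G) 0).
  by rewrite cPX mulr1.
apply: (mean_leW (e := (pr mu Y * cK G * N1.+1%:R * M +
    pr mu Y * cK G * cK G * (B%:R * M * E) * M) + 0)); first by rewrite addr0.
apply: mean_leD => //; last first.
  apply: (@mean_le_series _ _ _ mI _ (fun=> 0)); last by move=> N; rewrite big1.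
  move=> n; apply: mean_le_indic => //.
    apply: measurableD => //; apply: bigcupT_measurable => j.
    exact: (m_entrance iY im).
  by rewrite (entrance_all im YI muY GP).
apply: (mean_le_series mI (fun n => mean_leD mI (lvl0 n) (lvl1 n))) => N.
rewrite big_split/= -!mulr_sumr.
have E0 : 0 <= E by have := BadE 0; rewrite big_ord0.
apply: lerD; [apply: ler_wpM2l (HM N)|apply: ler_wpM2l (sum_late N)].
  by rewrite !mulr_ge0// ltW.
by rewrite !mulr_ge0// ltW.
Qed.

(** Up to the first block that is not bad, every return is charged by its own term; if
    all blocks are bad, the bound is infinite. *)
Lemma cover_time_bound x : I x -> (cover_time S d x <= cover_bound x)%E.
Proof.
move=> Ix; have ind0 (A : set T) : (0 <= (\1_A x)%:E :> \bar R)%E by rewrite lee_fin.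
have s0 n i b : (0 <= \sum_(0 <= j <oo) (\1_(slow n i b j) x)%:E :> \bar R)%E.
  by apply: nneseries_ge0.
have s1 n i : (0 <= \sum_(b < B) \sum_(0 <= j <oo) (\1_(slow n i b j) x)%:E :> \bar R)%E.
  by apply: sume_ge0.
have s2 n : (0 <= \sum_(0 <= i <oo) \sum_(b < B) \sum_(0 <= j <oo)
    (\1_(slow n i b j) x)%:E :> \bar R)%E by apply: nneseries_ge0.
have s3 n : (0 <= (n + N1).+1%:R%:E * (\1_(entrance S Y n X) x)%:E +
      \sum_(0 <= i <oo) \sum_(b < B) \sum_(0 <= j <oo) (\1_(slow n i b j) x)%:E
      :> \bar R)%E.
  by apply: adde_ge0 => //; apply: mule_ge0.
have [nx|nnx] := pselect (never x).
  suff -> : cover_bound x = +oo%E by rewrite leey.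
  rewrite /cover_bound (_ : (\sum_(0 <= n <oo) (\1_never x)%:E = +oo)%E).
    by rewrite addey// -ltNye (lt_le_trans ltNy0)// nneseries_ge0.
  apply: eq_infty => r; apply: le_trans (nneseries_lim_ge (Num.truncn r).+1 _) => //.
  rewrite big_mkord; under eq_bigr do rewrite indicE mem_set//.
  rewrite sumEFin lee_fin sumr_const card_ord; exact/ltW/truncnS_gt.
have [n Vx] : exists n, entrance S Y n X x.
  by apply: contrapT => H; apply: nnx; split => // -[n _ Vn]; apply: H; exists n.
pose y := iter n f x; have Xy : X y by case: Vx => _ [].
have key q : (forall i, (i < q)%N -> Bad i y) ->
    ((n + N1 + ret S iY (q * B) y).+1%:R%:E <= cover_bound x)%E.
  move=> bad; rewrite /cover_bound.
  apply: le_trans (_ : _ <= _ + 0)%E _; last first.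
    by apply: leeD; [exact: (nneseries_ge_term n s3)|exact: nneseries_ge0].
  rewrite adde0 indicE mem_set// mule1 -addSn natrD EFinD; apply: leeD => //.
  apply: le_trans (nneseries_lim_ge q _); last by move=> i _ _.
  rewrite big_mkord ret_mul// natr_sum -sumEFin; apply: lee_sum => i _.
  rewrite natr_sum -sumEFin; apply: lee_sum => b _.
  apply: le_trans (nneseries_lim_ge (tau (iter (i * B + b) F y)) _); last first.
    by move=> j _ _.
  rewrite big_mkord (eq_bigr (fun=> 1%E)).
    by rewrite sumEFin sumr_const card_ord.
  move=> j _; rewrite indicE mem_set//.
  have [_ [nY _]] := Vx; split => //; split => //; split; first exact: bad.
  split => //; split; last by [].
  by apply: X_iter => //; exact: cFX.
have ret_ge q : (q <= ret S iY (q * B) y)%N.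
  rewrite retE//; apply: (@leq_trans (\sum_(i < q * B) 1)%N).
    by rewrite sum1_card card_ord leq_pmulr.
  apply: leq_sum => i _; have rx : repeller G0 (iter i F y).
    by rewrite -GX; apply: X_iter => //; exact: cFX.
  by have [] := tau_spec rx.
have [all_bad|] := pselect (forall q, Bad q y).
  suff -> : cover_bound x = +oo%E by rewrite leey.
  apply: eq_infty => r; apply: le_trans (key (Num.truncn r).+1 _) => //.
  rewrite lee_fin; apply: le_trans (ltW (truncnS_gt r)) _.
  by rewrite ler_nat; apply: leq_trans (ret_ge _) _; apply: leqW; exact: leq_addl.
move=> /existsNP[q0 nb0].
have exq : exists q, ~~ `[< Bad q y >] by exists q0; exact/asboolPn.
have [q /asboolPn nbq qmin] := ex_minnP exq.
have bad i : (i < q)%N -> Bad i y.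
  by move=> iq; apply: contrapT => /asboolPn nb; have := qmin i nb; rewrite leqNgt iq.
apply: le_trans (key q bad); apply: cover_time_le => //.
apply: (@delta_dense_le _ _ (n + ret S iY (q * B) y + N1)).
  by rewrite addnAC leqW.
apply: dense => // p Yp; have [t tq tp] := Bad_dense Xy nbq Yp.
exists (n + ret S iY t y)%N; have Et : iter (n + ret S iY t y) f x = iter t F y.
  by rewrite addnC iterD GF (iter_ret S iY).
rewrite Et; split => //.
  rewrite leq_add2l; apply: ret_mono; exact: ltnW.
by apply: XY; apply: X_iter => //; exact: cFX.
Qed.

Lemma mean_cover_bound : (mean_cover_time S d <=
  (pr mu Y * cK G * N1.+1%:R * M + pr mu Y * cK G * cK G * (B%:R * M * E) * M)%:E)%E.
Proof.
have [_ _] := cover_bound_mean; apply: le_trans.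
by apply: le_integral_ge0 => x Ix; [exact: cover_time_ge0|exact: cover_time_bound].
Qed.

End UpperBound.

End Assembly.

(** * The mean cover time: all bounds *)

Section Bounds.
Variables (R : realType) (S : system R) (Y : set R) (iY : is_interval Y).
Local Notation T := (measurableTypeR R).
Local Notation I := (state_space S).
Local Notation f := (dyn S).
Local Notation m := (conf_measure S).
Local Notation mu := (inv_measure S).
Local Notation G0 := (first_return S iY).
Local Notation tau := (return_nat S Y).

Hypothesis im : interval_map S.
Hypothesis YI : Y `<=` I.
Hypothesis muY : (0 < mu Y)%E.
Hypothesis good : good_system G0.

Let cs : conformal_system S. Proof. by case: im. Qed.

Let mI : measurable (I : set T).
Proof. exact: is_interval_measurable (I_interval cs). Qed.

Lemma mean_cover_ge d (r : R) (A : set T) : measurable A -> A `<=` I -> 0 <= r ->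
  (forall x, A x -> (r%:E <= cover_time S d x)%E) ->
  ((r * pr mu A)%:E <= mean_cover_time S d)%E.
Proof.
move=> mA AI r0 rA.
have -> : ((r * pr mu A)%:E = \int[mu]_(x in (I : set T)) (r * \1_A x)%:E)%E.
  under eq_integral do rewrite EFinM.
  rewrite ge0_integralZl_EFin//; last exact/measurable_EFinP/measurable_funTS.
  by rewrite integral_indic// (setIidl AI) EFinM prE.
apply: le_integral_ge0 => x Ix; first by rewrite lee_fin mulr_ge0.
rewrite indicE; have [xA|xA] := boolP (x \in A).
  by rewrite mulr1; apply: rA; rewrite inE in xA.
by rewrite mulr0; exact: cover_time_ge0.
Qed.

(** An orbit segment covers the interval by few intervals of length [2 * d], each of
    conformal measure at most a multiple of [d]. *)
Lemma mean_cover_lower (a : R) : 1 <= a ->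
  (forall x y, x <= y -> pr m `[x, y]%classic <= a * (y - x)) ->
  forall d, 0 < d -> (((4 * a)^-1 * d^-1)%:E <= mean_cover_time S d)%E.
Proof.
move=> a1 len_le d d0; have a0 : 0 < a by exact: lt_le_trans a1.
have r0 : 0 <= (4 * a)^-1 * d^-1.
  by rewrite mulr_ge0// invr_ge0 ltW// mulr_gt0.
have := @mean_cover_ge d _ I mI (@subset_refl _ _) r0.
rewrite (mu_I im) mulr1; apply => x Ix; apply: cover_time_ge => n n0 dn.
have mJ j : measurable (`[iter j f x - d, iter j f x + d]%classic : set T).
  exact: measurable_itv.
have : pr m I <= \sum_(j < n.+1) (a * (2 * d)).
  apply: le_trans (_ : _ <= pr m (\bigcup_(j < n.+1)
      `[iter j f x - d, iter j f x + d]%classic)) _.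
    apply: pr_le => //; first by apply: bigcup_measurable => j _; exact: mJ.
    move=> y Iy; have [_ [j jn <-] yj] := dn _ Iy; exists j => //=.
    by rewrite in_itv/= -ler_distl.
  apply: le_trans (pr_bigcup_le _ _ mJ) _; apply: ler_sum => j _.
  apply: le_trans (len_le _ _ _) _; first by lra.
  by rewrite ler_pM2l//; lra.
have -> : pr m I = 1 by case: cs => [[_ mI1 _ _] _]; rewrite /pr mI1.
rewrite sumr_const card_ord -[_ *+ n.+1]mulr_natl -(natr1 n) => H.
rewrite -invfM -[leLHS]div1r ler_pdivrMr; last by rewrite !mulr_gt0.
have n1 : 1 <= n%:R :> R by rewrite ler1n.
have ad : 0 <= a * (2 * d) by rewrite !mulr_ge0// ltW.
apply: le_trans H _; rewrite (_ : n%:R * (4 * a * d) = (n%:R + n%:R) * (a * (2 * d))).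
  by apply: ler_wpM2r => //; rewrite lerD2l.
ring.
Qed.

Variable G : coded R.
Hypotheses (GY : cY G = Y) (GX : cX G = repeller G0) (GF : cF G = dyn G0)
  (GP : cP G = inv_measure G0).

(** An orbit of the original map visits [Y] at most as often as the first return map. *)
Lemma mean_cover_lower_full a b : a != b ->
  (forall y, cX G y -> exists x, [/\ cX G x, cbr G x = a & cF G x = y]) ->
  (forall y, cX G y -> exists x, [/\ cX G x, cbr G x = b & cF G x = y]) ->
  exists c d0 : R, [/\ 0 < c, 0 < d0 & forall d, 0 < d -> d < d0 ->
    ((c * d^-1 * ln (1 / d))%:E <= mean_cover_time S d)%E].
Proof.
move=> ab fa fb; have [c [d0 [c0 d00 H]]] := cover_lower ab fa fb.
have pY : 0 < pr mu Y by rewrite -lte_fin prE//; exact: is_interval_measurable.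
exists (c * (pr mu Y / 2)), d0; split => //; first by rewrite mulr_gt0// divr_gt0.
move=> d dgt0 dd0; have [n [A [nle mA AX PA HA]]] := H d dgt0 dd0.
have AY : A `<=` Y by move=> x /AX/cXY; rewrite GY.
apply: (@le_trans _ _ (n%:R * pr mu A)%:E); last first.
  apply: mean_cover_ge => //; first exact: subset_trans YI.
  move=> x Ax; apply: cover_time_ge => j j0 dj.
  have [p [pY' far]] := HA x Ax.
  have [|_ [i ij <-] pi] := dj p.
    by apply: YI; rewrite -GY; apply: pY'; rewrite subrr normr0 ltW.
  have rx : repeller G0 x by rewrite -GX; exact: AX.
  have Yi : Y (iter i f x) by rewrite -GY; apply: pY'; rewrite distrC.
  have [t ti E] := visit_return good rx Yi.
  rewrite ler_nat leqNgt; apply/negP => jn.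
  have tn : (t < n)%N := leq_ltn_trans ti (leq_ltn_trans (ij : (i <= j)%N) jn).
  by have := far _ tn; rewrite GF -E ltNge distrC pi.
rewrite lee_fin (pr_inv_Y _ muY mA AY) -GP.
rewrite (_ : _ * _ * _ = (c * d^-1 * ln (1 / d)) * (pr mu Y * (1 / 2))); last by ring.
apply: le_trans (_ : _ <= n%:R * (pr mu Y * (1 / 2))) _.
  by apply: ler_wpM2r => //; rewrite mulr_ge0// ltW.
by apply: ler_wpM2l => //; rewrite ler_pM2l.
Qed.

Hypothesis Gtau : forall x y, cX G x -> cX G y -> cbr G x = cbr G y -> tau x = tau y.
Hypothesis m_open : forall x y, I x -> I y -> x < y -> 0 < pr m `]x, y[%classic.
Hypothesis m_point : nonatomic S.

Lemma mean_cover_upper (gamma : R) : cov S Y -> 2 < gamma ->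
  (fun n : nat => fine (inv_measure G0
     (Y `&` [set x | (n%:R%:E < return_time S Y x)%E])))
    =O_\oo (fun n : nat => n%:R `^ (- gamma)) ->
  exists C d0 : R, [/\ 0 < C, 0 < d0 & forall d, 0 < d -> d < d0 ->
    (mean_cover_time S d <= (C * d^-1 * ln (1 / d))%:E)%E].
Proof.
move=> cv g2 tail; have [M M0 HM] := late_sum im YI GY GX GP Gtau g2 tail.
have nY : nd_interval Y by split => //; rewrite -GY; exact: cY_nd.
have [k [d1 [N1 [k1 d10 dense]]]] := cov_dense cs m_open m_point YI nY cv.
have [C [d0 [C0 d00 HC]]] := cover_upper G.
have pY : 0 < pr mu Y by rewrite -lte_fin prE//; exact: is_interval_measurable.
have K0 : 0 < cK G by apply: lt_le_trans (cK1 G).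
have k0 : 0 < k by exact: lt_le_trans k1.
pose c1 := pr mu Y * cK G * N1.+1%:R * M.
pose c2 := pr mu Y * cK G * cK G * (C * k * M * C) * M.
have c10 : 0 < c1 by rewrite !mulr_gt0.
have c20 : 0 < c2 by rewrite !mulr_gt0.
exists (c1 + 2 * c2), (Num.min (Num.min d1 (k * d0)) (Num.min k^-1 (expR (-1)))).
split; first by rewrite addr_gt0// mulr_gt0.
  by rewrite !lt_min d10 mulr_gt0//= invr_gt0 k0 expR_gt0.
move=> d dgt0; rewrite !lt_min => /andP[/andP[dd1 dkd] /andP[dk de]].
have e0 : 0 < d / k by rewrite divr_gt0.
have ed0 : d / k < d0 by rewrite ltr_pdivrMr// mulrC.
have [B [Bad [B0 BC cBad BadE Bdense]]] := HC _ e0 ed0.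
rewrite GY in Bdense.
apply: le_trans (mean_cover_bound im YI muY GY GX GF GP Gtau M0 HM dense
  dgt0 dd1 B0 cBad BadE Bdense) _.
rewrite lee_fin -/c1; set l := ln (1 / d).
have l1 : 1 <= l.
  rewrite -[leLHS]expRK ler_ln ?posrE ?expR_gt0 ?divr_gt0//.
  by rewrite div1r -[expR 1]invrK -expRN lef_pV2 ?posrE ?expR_gt0// ltW.
have d1inv : 1 <= d^-1.
  rewrite invf_ge1// ltW//; apply: lt_le_trans dk _; by rewrite invf_le1 ?k1.
have lk : ln (1 / (d / k)) <= 2 * l.
  rewrite (_ : 1 / (d / k) = (1 / d) * k); last by rewrite !div1r invf_div mulrC.
  rewrite lnM ?posrE ?divr_gt0// -/l mulr_natl mulr2n lerD2l /l ler_ln ?posrE ?divr_gt0//.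
  rewrite ler_pdivlMr// -ler_pdivlMl//; by rewrite mulr1 ltW.
have l2 : 0 <= ln (1 / (d / k)).
  apply: ln_ge0; rewrite div1r invf_ge1// ler_pdivrMr// mul1r.
  by apply: le_trans k1; rewrite -invf_ge1.
have H1 : c1 <= c1 * d^-1 * l.
  by rewrite -mulrA; apply: ler_peMr; [exact: ltW|exact: mulr_ege1].
have H2 : B%:R * M * (C * ln (1 / (d / k))) <= C * k * M * C * d^-1 * (2 * l).
  apply: (@le_trans _ _ (C / (d / k) * M * (C * (2 * l)))).
    apply: ler_pM => //; first by rewrite mulr_ge0// ltW.
    - by rewrite mulr_ge0// ltW.
    - by rewrite ler_pM2r.
    by rewrite ler_pM2l.
  by rewrite invf_div le_eqVlt; apply/orP; left; apply/eqP; ring.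
have H3 : pr mu Y * cK G * cK G * (B%:R * M * (C * ln (1 / (d / k)))) * M <=
    2 * c2 * d^-1 * l.
  rewrite (_ : 2 * c2 * d^-1 * l =
    pr mu Y * cK G * cK G * (C * k * M * C * d^-1 * (2 * l)) * M); last by rewrite /c2; ring.
  by rewrite ler_pM2r// ler_pM2l// !mulr_gt0.
rewrite (_ : (c1 + 2 * c2) * d^-1 * l = c1 * d^-1 * l + 2 * c2 * d^-1 * l).
  exact: lerD.
ring.
Qed.

End Bounds.

Theorem theorem6p1 (R : realType) (S : system R) (Y : set R)
    (iY : is_interval Y) (gamma : R) :
  interval_map S ->
  ahlfors_regular S (state_space S) ->
  Y `<=` state_space S ->
  (0 < inv_measure S Y)%E ->
  cov S Y ->
  good_system (first_return S iY) ->
  2 < gamma ->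
  (fun n : nat => fine (inv_measure (first_return S iY)
     (Y `&` [set x | (n%:R%:E < return_time S Y x)%E])))
    =O_\oo (fun n : nat => n%:R `^ (- gamma)) ->
  let s := fine (hausdorff_dim (state_space S)) in
  (exists c C : R, [/\ 0 < c, c < C &
     \forall delta \near (0 : R)^'+,
       ((c * delta `^ (- s))%:E <= mean_cover_time S delta /\
        mean_cover_time S delta <= (C * delta `^ (- s) * ln (1 / delta))%:E)%E])
  /\
  (two_full_branches S Y ->
   exists c C : R, [/\ 0 < c, c < C &
     \forall delta \near (0 : R)^'+,
       ((c * delta `^ (- s) * ln (1 / delta))%:E <= mean_cover_time S delta /\
        mean_cover_time S delta <= (C * delta `^ (- s) * ln (1 / delta))%:E)%E]).
Proof.
move=> im AR YI muY cv good g2 tail s.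
have cs : conformal_system S by case: im.
have [[[_ nI] _ _] _] : piecewise_monotone S by case: cs => [[]].
have mI : pr (conf_measure S) (state_space S) = 1.
  by case: cs => [[_ mI _ _] _]; rewrite /pr mI.
have [c0 c00 Hc] := AR.
have iI := I_interval cs; have bI := I_bounded cs.
have s1 : s = 1 by exact: ar_exponent iI nI bI mI c00 Hc.
have [a a1 [len_ge len_le]] := conf_length iI nI bI mI c00 Hc.
have a0 : 0 < a by exact: lt_le_trans a1.
have m_open x y : state_space S x -> state_space S y -> x < y ->
    0 < pr (conf_measure S) `]x, y[%classic.
  move=> Ix Iy xy; rewrite -(pmulr_rgt0 _ a0); apply: lt_le_trans (len_ge _ _ Ix Iy xy).
  by rewrite subr_gt0.
have m_point : nonatomic S.
  move=> x; rewrite -prE//; congr EFin; apply/eqP; rewrite eq_le pr_ge0 andbT.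
  by have := len_le x x (lexx x); rewrite subrr mulr0 set_itv1.
have [G [GY GX GF GP [Gtau Gfull]]] := exists_coded_return im AR YI muY good.
have [C [d0 [C0 d00 up]]] :=
  mean_cover_upper im YI muY GY GX GF GP Gtau m_open m_point cv g2 tail.
have near_small (d1 : R) (Q : R -> Prop) : 0 < d1 ->
    (forall d, 0 < d -> d < d1 -> Q d) -> \forall d \near (0 : R)^'+, Q d.
  move=> d10 Hd; near=> d; apply: Hd; first by near: d; exact: nbhs_right_gt.
  by near: d; exact: nbhs_right_lt.
have up' c d : 0 <= c -> 0 < d -> d < Num.min 1 d0 ->
    (mean_cover_time S d <= ((C + c) * d `^ (- s) * ln (1 / d))%:E)%E.
  move=> cge0 dgt0; rewrite lt_min => /andP[d1 dd0]; apply: le_trans (up _ dgt0 dd0) _.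
  rewrite lee_fin s1 powRN powRr1 ?(ltW dgt0)//; apply: ler_wpM2r.
    by rewrite ln_ge0// div1r invf_ge1// ltW.
  by apply: ler_wpM2r; [rewrite invr_ge0 ltW|rewrite lerDl].
split.
  exists (4 * a)^-1, (C + (4 * a)^-1); split.
  - by rewrite invr_gt0 mulr_gt0.
  - by rewrite ltrDr.
  apply: (near_small (Num.min 1 d0)); first by rewrite lt_min ltr01.
  move=> d dgt0 dd0; split; last by apply: up' => //; rewrite invr_ge0 mulr_ge0 ?ltW.
  by rewrite s1 powRN powRr1 ?(ltW dgt0)//; exact: (mean_cover_lower im a1 len_le dgt0).
move=> /Gfull[i [j [ij fi fj]]].
have [c [d1 [c1 d10 low]]] :=
  mean_cover_lower_full im YI muY good GY GX GF GP ij fi fj.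
exists c, (C + c); split => //; first by rewrite ltrDr.
apply: (near_small (Num.min (Num.min 1 d0) d1)); first by rewrite !lt_min ltr01 d00.
move=> d dgt0; rewrite lt_min => /andP[dd0 dd1]; split; last by apply: up' => //; exact: ltW.
by rewrite s1 powRN powRr1 ?(ltW dgt0)//; exact: low.
Unshelve. all: by end_near. Qed.
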